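(* Computing the combinatorial diameter of a polytope is a strongly NP-hard problem.
   Context: The polytope is given as input by an explicit system of linear inequalities $\{x\in\mathbb R^d: Ax\le b\}$ with rational data (hardness holds already for fractional matching polytopes $\{x\in\mathbb R^E: \sum_{e\ni v}x_e\le 1\ \forall v\in V,\ x\ge 0\}$ of simple graphs $G=(V,E)$). The combinatorial diameter of a polytope is the maximum, over pairs of vertices, of the shortest-path distance between them in the 1-skeleton (the graph whose nodes are the vertices of the polytope and whose edges are its 1-dimensional faces). Strongly NP-hard means NP-hard even when all numbers in the input are bounded in magnitude by a polynomial in the input size (equivalently, encoded in unary). *)

(* Defs.v *)
From HB Require Import structures.
From mathcomp Require Import all_boot all_order all_algebra.
From mathcomp Require Import boolp classical_sets reals.

Set Implicit Arguments.
Unset Strict Implicit.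
Unset Printing Implicit Defensive.

Import Order.TTheory GRing.Theory Num.Theory.

Definition word := seq bool.

(* Binary representation, least significant bit first; [bits 0 = [::]]. *)
Definition bits (n : nat) : word :=
  [seq odd (n %/ 2 ^ i) | i <- iota 0 (up_log 2 n.+1)].

(* Prefix-free coding of words: each bit is preceded by [true], and the
   code ends with [false]. *)
Definition delim (w : word) : word :=
  flatten [seq [:: true; b] | b <- w] ++ [:: false].

Definition pair_word (x y : word) : word := delim x ++ y.

(* [None] is the blank, [Some (inl b)] a bit, [Some (inr g)] an auxiliary
   symbol of the machine. *)
Definition symbol (G : finType) : finType := option (bool + G)%type.

(* A two-way infinite tape: [lft] lists the cells to the left of the head,
   nearest first, and [rgt] lists the scanned cell and those to its right;
   all the cells not listed are blank. *)
Record tape (G : finType) := Tape { lft : seq (symbol G); rgt : seq (symbol G) }.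

Inductive direction := GoLeft | Stay | GoRight.

Section Tape.
Variable G : finType.
Implicit Types t : tape G.

Definition scanned t : symbol G := head None (rgt t).

Definition write_and_move t (a : symbol G) (d : direction) : tape G :=
  match d with
  | GoLeft => Tape (behead (lft t)) (head None (lft t) :: a :: behead (rgt t))
  | Stay => Tape (lft t) (a :: behead (rgt t))
  | GoRight => Tape (a :: lft t) (behead (rgt t))
  end.

Definition word_tape (w : word) : tape G := Tape [::] [seq Some (inl b) | b <- w].

(* The longest word of bits that starts at the head. *)
Definition tape_word t : word :=
  (fix read (s : seq (symbol G)) : word :=
     if s is Some (inl b) :: s' then b :: read s' else [::]) (rgt t).

End Tape.

(* There are [ntapes.+2] tapes. The input is on the tape [ord0]; the tape
   [ord_max] is the oracle tape. A state [q] with [verdict q = Some b] is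
   halting (accepting if [b], rejecting otherwise); a nonhalting state with
   [resume q = Some q'] asks the oracle, and the computation goes on in
   [q']. *)
Record machine := Machine {
  ntapes : nat;
  state : finType;
  aux : finType;
  start : state;
  verdict : state -> option bool;
  resume : state -> option state;
  trans : state -> {ffun 'I_ntapes.+2 -> symbol aux} ->
          state * {ffun 'I_ntapes.+2 -> symbol aux * direction} }.

Definition oracle_free (M : machine) := forall q, @resume M q = None.

Section Run.
Variables (f : word -> word) (M : machine).

Definition config := (state M * ('I_(ntapes M).+2 -> tape (aux M)))%type.

Definition init (x : word) : config :=
  (start M, fun i => word_tape (aux M) (if i == ord0 then x else [::])).

(* An oracle call takes one step: it replaces the word [w] at the head of the
   oracle tape by [f w]. *)
Definition step (c : config) : config :=
  let: (q, ts) := c in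
  if verdict q is Some _ then c
  else if resume q is Some q' then
    (q', fun i => if i == ord_max
                  then word_tape (aux M) (f (tape_word (ts i))) else ts i)
  else
    let: (q', act) := trans q [ffun i => scanned (ts i)] in
    (q', fun i => write_and_move (ts i) (act i).1 (act i).2).

Definition decides_within (T : nat) (x : word) (P : Prop) : Prop :=
  exists b, verdict (iter T step (init x)).1 = Some b /\ (b <-> P).

End Run.

Definition language := word -> Prop.

Definition in_P (L : language) : Prop :=
  exists (M : machine) (p : {poly nat}), oracle_free M /\
    forall x, decides_within (fun=> [::]) M p.[size x]%R x (L x).

Definition in_NP (L : language) : Prop :=
  exists (V : language) (p : {poly nat}), in_P V /\
    forall x, L x <->
      exists y : word, (size y <= p.[size x]%R)%N /\ V (pair_word x y).

(* The problem of computing a natural number that is a correct [answer] to a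
   given [valid] instance. Nothing is required for the other instances.
   [max_number] is the largest magnitude of a number that occurs in an
   instance. *)
Record problem := Problem {
  instance : Type;
  encode : instance -> word;
  max_number : instance -> nat;
  valid : instance -> Prop;
  answer : instance -> nat -> Prop }.

Definition solves (f : word -> word) (Q : problem) : Prop :=
  forall I : instance Q, valid I ->
    exists n, answer I n /\ f (encode I) = bits n.

(* Every NP language has a polynomial-time Turing reduction to [Q]. *)
Definition NP_hard (Q : problem) : Prop :=
  forall L : language, in_NP L ->
    exists (M : machine) (p : {poly nat}),
      forall f : word -> word, solves f Q ->
        forall x, decides_within f M p.[size x]%R x (L x).

Definition bounded_problem (p : {poly nat}) (Q : problem) : problem :=
  {| instance := instance Q;
     encode := @encode Q;
     max_number := @max_number Q;
     valid := fun I => valid I /\ (max_number I <= p.[size (encode I)]%R)%N;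
     answer := @answer Q |}.

Definition strongly_NP_hard (Q : problem) : Prop :=
  exists p : {poly nat}, NP_hard (bounded_problem p Q).

Local Open Scope ring_scope.
Local Open Scope classical_set_scope.

Section Polyhedra.
Variables (R : realType) (d : nat).
Implicit Types (P F : set 'cV[R]_d) (u v : 'cV[R]_d).

Definition polyhedron (m : nat) (A : 'M[rat]_(m, d)) (b : 'cV[rat]_m) :
    set 'cV[R]_d :=
  [set x | forall i, (map_mx ratr A *m x) i 0 <= ratr (b i 0)].

Definition is_bounded P : Prop :=
  exists B : R, forall x, P x -> forall i, `|x i 0| <= B.

Definition is_face P F : Prop :=
  exists (c : 'rV[R]_d) (delta : R),
    (forall x, P x -> (c *m x) 0 0 <= delta) /\
    F = P `&` [set x | (c *m x) 0 0 = delta].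

(* [x0] and the points [x0 + col j B] are [k.+1] affinely independent points
   of [F] whose affine hull contains [F]. *)
Definition has_dim F (k : nat) : Prop :=
  exists (x0 : 'cV[R]_d) (B : 'M[R]_(d, k)),
    [/\ F x0, forall j, F (x0 + col j B), \rank B = k
      & forall x, F x -> exists c : 'cV[R]_k, x = x0 + B *m c].

Definition is_vertex P v : Prop := is_face P [set v].

(* A one-dimensional face contains at most two vertices, so that distinct
   vertices on it are its endpoints. *)
Definition adjacent P u v : Prop :=
  [/\ is_vertex P u, is_vertex P v, u <> v
    & exists F, [/\ is_face P F, has_dim F 1, F u & F v]].

Inductive walk P : nat -> 'cV[R]_d -> 'cV[R]_d -> Prop :=
| walk_nil u : walk P 0 u u
| walk_cons n u v w : adjacent P u v -> walk P n v w -> walk P n.+1 u w.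

Definition is_distance P u v (n : nat) : Prop :=
  walk P n u v /\ forall k, walk P k u v -> (n <= k)%N.

Definition is_diameter P (D : nat) : Prop :=
  (exists u v, [/\ is_vertex P u, is_vertex P v & is_distance P u v D]) /\
  (forall u v, is_vertex P u -> is_vertex P v ->
     exists n, is_distance P u v n /\ (n <= D)%N).

End Polyhedra.

Record lin_system := LinSystem {
  nrows : nat;
  ncols : nat;
  lhs : 'M[rat]_(nrows, ncols);
  rhs : 'cV[rat]_nrows }.

Definition encode_rat (r : rat) : word :=
  delim ((numq r < 0) :: bits `|numq r|%N) ++ delim (bits `|denq r|%N).

Definition encode_system (S : lin_system) : word :=
  delim (bits (nrows S)) ++ delim (bits (ncols S)) ++
  flatten [seq encode_rat (lhs S i j)
             | i <- enum 'I_(nrows S), j <- enum 'I_(ncols S)] ++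
  flatten [seq encode_rat (rhs S i ord0) | i <- enum 'I_(nrows S)].

Definition height (r : rat) : nat := maxn `|numq r|%N `|denq r|%N.

Definition system_height (S : lin_system) : nat :=
  maxn (\max_(i < nrows S) \max_(j < ncols S) height (lhs S i j))%N
       (\max_(i < nrows S) height (rhs S i ord0))%N.

Definition solution_set (R : realType) (S : lin_system) : set 'cV[R]_(ncols S) :=
  polyhedron (lhs S) (rhs S).
Arguments solution_set : clear implicits.

(* Nonemptiness is required because the diameter is a maximum over pairs of
   vertices. *)
Definition diameter_problem (R : realType) : problem :=
  {| instance := lin_system;
     encode := encode_system;
     max_number := system_height;
     valid := fun S => is_bounded (solution_set R S) /\ solution_set R S !=set0;
     answer := fun S D => is_diameter (solution_set R S) D |}.

(* Main.v *)
Require Import Defs.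
From HB Require Import structures.
From mathcomp Require Import all_boot all_order all_algebra.
From mathcomp Require Import boolp classical_sets reals.
From mathcomp Require Import ring lra zify.

Set Implicit Arguments.
Unset Strict Implicit.
Unset Printing Implicit Defensive.

Import Order.TTheory GRing.Theory Num.Theory.

(* Cook's tableau turns the computations of a verifier on an input into a set of
   clauses with three literals. For variables [v] and clauses [C], consider the
   polytope in the coordinates [t], [h], [g] and [y_v], [z_v] given by
     0 <= h, 0 <= T_b, |y_v| <= T_b, -(l_1 + l_2 + l_3) <= T_b for each C,
     |z_v| <= 12 (4 - k) (T_b +- y_v) + k (k + 1) / 2 * (1 - 2 h) for k < 4,
     |g| <= 2, 3 - 4 h, 6 - 12 h, 48 t, 48 (1 - t)
   where [T_0 = t - h], [T_1 = 1 - t - h] and [l_i] is [y_v] or [- y_v]. The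
   points [t = 0] and [t = 1] of the line where all other coordinates vanish are
   two tips; with respect to [y] and [z], the polytope is a pyramid with apex the
   hub [t = h = 1/2]. The coordinate [g] cuts every vertex away from the tips
   into several ones, so that a walk must spend steps to climb to the hub: each
   tip is at distance 4 of the hub, and every vertex within 3 of the hub or within
   1 of a tip. A walk of length at most 7 between the tips cannot climb to the
   hub, and hence crosses [t = 1/2] along an edge low in the pyramid; the
   coordinates [y_v] at the crossing are then close to [+- (1/2 - h)], and their
   signs satisfy all the clauses. Conversely, a satisfying assignment gives a
   walk of length 4 between the tips. So the diameter is at most 7 if and only if
   the clauses are satisfiable. All coefficients are bounded by a constant.

   A machine prints this system in polynomial time with nested loops over times
   and cells, asks the oracle for the diameter, and accepts if the binary
   answer has at most three digits. *)

(** * Structured programs for multitape machines *)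

(** Why an edge climbs so little: [g] and each [z_v] occur only in rows that bound their absolute
    values by a minimum of affine functions. Along an edge, either one of these rows stays tight,
    and the edge remains on one affine piece, or the edge changes that coordinate alone. So an edge
    that starts on a piece reaches at most the end of that piece. For [g] the pieces, as functions
    of [h], end at 1/4, 3/8 and 1/2, which gives the three edges from height below 1/4 to the hub.
    For [z_v] let r be the least of the numbers T_b +- y_v divided by 1 - 2h; the pieces break at r
    = 1/12, 1/6, 1/4. The first edge from a tip stays within 1/24 of it in [t], and the next three
    pass at most one break each. The middle edge of a walk of length 7 has both ends three edges
    away from a tip, hence r <= 1/4 on it. Where it crosses t = 1/2, both T_b equal (1 - 2h)/2, so
    |y_v| exceeds a third of T_b, and three false literals would violate the row of their clause.
    The factor 1 - 2h makes these rows pass through the hub, and the rows on [g] keep it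
    positive. *)

Notation sym := (symbol void).

Inductive op := Nop | MoveL | MoveR | Write of sym.

Section Code.
Variable nt : nat.
Notation tp := 'I_nt.+2.
Notation scan := {ffun tp -> sym}.
Notation tapes := (tp -> tape void).

Inductive code :=
| Act of (tp -> op)
| Ask
| Sq of code & code
| Ite of tp & pred sym & code & code
| Loop of tp & pred sym & code.

Definition op_action (o : op) (a : sym) : sym * direction :=
  match o with
  | Nop => (a, Stay) | MoveL => (a, GoLeft) | MoveR => (a, GoRight)
  | Write a' => (a', Stay)
  end.

Definition action (g : tp -> op) (s : scan) : {ffun tp -> sym * direction} :=
  [ffun i => op_action (g i) (s i)].

(** The extra point [None] of a conditional or a loop is the place where its test is evaluated, in a
    step of its own. A sequence needs none: the last step of [c1] leads to the entry of [c2]. *)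
Fixpoint points (c : code) : finType :=
  match c with
  | Act _ | Ask => unit
  | Sq c1 c2 => (points c1 + points c2)%type
  | Ite _ _ c1 c2 => option (points c1 + points c2)%type
  | Loop _ _ c1 => option (points c1)
  end.

Fixpoint entry (c : code) : points c :=
  match c with
  | Act _ | Ask => tt
  | Sq c1 _ => inl (entry c1)
  | Ite _ _ _ _ | Loop _ _ _ => None
  end.

(* In [asks] and [next], the value [None] of type [option (points c)] means
   that control leaves [c]. *)
Fixpoint asks (c : code) : points c -> option (option (points c)) :=
  match c with
  | Act _ => fun=> None
  | Ask => fun=> Some None
  | Sq c1 c2 => fun p => match p with
      | inl p1 => omap (fun o => Some (if o is Some p' then inl p' else inr (entry c2)))
                       (asks p1)
      | inr p2 => omap (omap inr) (asks p2)
      end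
  | Ite _ _ c1 c2 => fun p => match p with
      | None => None
      | Some (inl p1) => omap (omap (Some \o inl)) (asks p1)
      | Some (inr p2) => omap (omap (Some \o inr)) (asks p2)
      end
  | Loop _ _ c1 => fun p => match p with
      | None => None
      | Some p1 => omap (fun o => Some (if o is Some p' then Some p' else None)) (asks p1)
      end
  end.

Fixpoint next (c : code) : points c -> scan -> option (points c) * (tp -> op) :=
  match c with
  | Act g => fun _ _ => (None, g)
  | Ask => fun _ _ => (None, fun=> Nop)
  | Sq c1 c2 => fun p s => match p with
      | inl p1 => let: (o, g) := next p1 s in
                  (Some (if o is Some p' then inl p' else inr (entry c2)), g)
      | inr p2 => let: (o, g) := next p2 s in (omap inr o, g)
      end
  | Ite u P c1 c2 => fun p s => match p with
      | None => (Some (Some (if P (s u) then inl (entry c1) else inr (entry c2))), fun=> Nop)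
      | Some (inl p1) => let: (o, g) := next p1 s in (omap (Some \o inl) o, g)
      | Some (inr p2) => let: (o, g) := next p2 s in (omap (Some \o inr) o, g)
      end
  | Loop u P c1 => fun p s => match p with
      | None => (if P (s u) then Some (Some (entry c1)) else None, fun=> Nop)
      | Some p1 => let: (o, g) := next p1 s in
                   (Some (if o is Some p' then Some p' else None), g)
      end
  end.

Variable f : word -> word.

Definition ask_tapes (ts : tapes) : tapes :=
  fun i => if i == ord_max then word_tape void (f (tape_word (ts i))) else ts i.

Definition act_tapes (g : tp -> op) (ts : tapes) : tapes :=
  fun i => let a := action g [ffun j => scanned (ts j)] i in
           write_and_move (ts i) a.1 a.2.

Definition code_step (c : code) (p : points c) (ts : tapes) : option (points c) * tapes :=
  if asks p is Some o then (o, ask_tapes ts)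
  else let: (o, g) := next p [ffun i => scanned (ts i)] in (o, act_tapes g ts).

(** The count is exact: control leaves [c] at the last of the [n] steps and not before, so [n] can
    be read as a number of iterations of the machine. *)
Fixpoint runs (c : code) n (p : points c) (ts ts' : tapes) : Prop :=
  if n is n'.+1 then
    let: (o, ts1) := code_step p ts in
    if o is Some p' then runs n' p' ts1 ts' else n' = 0 /\ ts1 = ts'
  else False.

Definition term c n ts ts' := runs n (entry c) ts ts'.

Lemma term_act g ts : term (Act g) 1 ts (act_tapes g ts).
Proof. by []. Qed.

Lemma term_ask ts : term Ask 1 ts (ask_tapes ts).
Proof. by []. Qed.

Lemma runs_sq2 c1 c2 n p ts ts1 :
  @runs c2 n p ts ts1 -> @runs (Sq c1 c2) n (inr p) ts ts1.
Proof.
elim: n p ts => // n IH p ts /=; rewrite /code_step /=.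
case: (asks p) => [o|] /=.
  by case: o => [p'|//]; apply: IH.
case: (next _ _) => o g /=.
by case: o => [p'|//]; apply: IH.
Qed.

Lemma runs_sq1 c1 c2 n p ts ts1 m ts2 :
  @runs c1 n p ts ts1 -> term c2 m ts1 ts2 -> @runs (Sq c1 c2) (n + m) (inl p) ts ts2.
Proof.
elim: n p ts => // n IH p ts /=; rewrite /code_step /=.
case: (asks p) => [o|] /=.
  by case: o => [p'|[-> ->]]; [apply: IH|apply: runs_sq2].
case: (next _ _) => o g /=.
by case: o => [p'|[-> ->]]; [apply: IH|apply: runs_sq2].
Qed.

Lemma term_sq c1 c2 n m ts ts1 ts2 :
  term c1 n ts ts1 -> term c2 m ts1 ts2 -> term (Sq c1 c2) (n + m) ts ts2.
Proof.
move=> t1 t2; apply: runs_sq1 t1 _.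
exact: t2.
Qed.

Lemma runs_ite1 u P c1 c2 n p ts ts1 :
  @runs c1 n p ts ts1 -> @runs (Ite u P c1 c2) n (Some (inl p)) ts ts1.
Proof.
elim: n p ts => // n IH p ts /=; rewrite /code_step /=.
case: (asks p) => [o|] /=.
  by case: o => [p'|//]; apply: IH.
case: (next _ _) => o g /=.
by case: o => [p'|//]; apply: IH.
Qed.

Lemma runs_ite2 u P c1 c2 n p ts ts1 :
  @runs c2 n p ts ts1 -> @runs (Ite u P c1 c2) n (Some (inr p)) ts ts1.
Proof.
elim: n p ts => // n IH p ts /=; rewrite /code_step /=.
case: (asks p) => [o|] /=.
  by case: o => [p'|//]; apply: IH.
case: (next _ _) => o g /=.
by case: o => [p'|//]; apply: IH.
Qed.

(** A test rewrites each scanned symbol in place, which may turn an empty list of cells into an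
    explicit blank; hence [act_tapes (fun=> Nop) ts] and not [ts]. *)
Lemma term_ite u (P : pred sym) c1 c2 n ts ts1 :
  term (if P (scanned (ts u)) then c1 else c2) n (act_tapes (fun=> Nop) ts) ts1 ->
  term (Ite u P c1 c2) n.+1 ts ts1.
Proof.
rewrite /term /= /code_step /= ffunE.
by case: ifP => _; [exact: runs_ite1|exact: runs_ite2].
Qed.

Lemma runs_loop u P c1 n p ts ts1 m ts2 :
  @runs c1 n p ts ts1 -> term (Loop u P c1) m ts1 ts2 ->
  @runs (Loop u P c1) (n + m) (Some p) ts ts2.
Proof.
elim: n p ts => // n IH p ts /=; rewrite /code_step /=.
case: (asks p) => [o|] /=.
  by case: o => [p'|[-> ->]] //; apply: IH.
case: (next _ _) => o g /=.
by case: o => [p'|[-> ->]] //; apply: IH.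
Qed.

Lemma term_loop_exit u (P : pred sym) c1 ts : ~~ P (scanned (ts u)) ->
  term (Loop u P c1) 1 ts (act_tapes (fun=> Nop) ts).
Proof. by move=> /negbTE nP; rewrite /term /= /code_step /= ffunE nP. Qed.

Lemma term_loop_step u (P : pred sym) c1 n m ts ts1 ts2 : P (scanned (ts u)) ->
  term c1 n (act_tapes (fun=> Nop) ts) ts1 -> term (Loop u P c1) m ts1 ts2 ->
  term (Loop u P c1) (n + m).+1 ts ts2.
Proof.
move=> pP t1 t2; rewrite /term /= /code_step /= ffunE pP.
exact: runs_loop t1 t2.
Qed.

(* The machine runs [c] and then halts, accepting if and only if the oracle
   head scans a blank. *)
Definition code_machine (c : code) : machine :=
  @Machine nt (points c + option bool)%type void (inl (entry c))
    (fun q => if q is inr (Some b) then Some b else None)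
    (fun q => if q is inl p then
                omap (fun o => if o is Some p' then inl p' else inr None) (asks p)
              else None)
    (fun q s => match q with
       | inl p => let: (o, g) := next p s in
                  (if o is Some p' then inl p' else inr None, action g s)
       | inr _ => (inr (Some (s ord_max == None)), action (fun=> Nop) s)
       end).

Lemma machine_runs c n p ts ts' : @runs c n p ts ts' ->
  iter n (step f (M := code_machine c)) (inl p, ts) = (inr None, ts').
Proof.
elim: n p ts => // n IH p ts; rewrite iterSr /= /code_step.
case: (asks p) => [o|] /=.
  by case: o => [p'|[-> <-]] //; apply: IH.
case: (next _ _) => o g /=.
by case: o => [p'|[-> <-]] //; apply: IH.
Qed.

Lemma code_machine_decides c n x ts' (T : nat) (L : Prop) :
  term c n (init (code_machine c) x).2 ts' -> n < T ->
  ((scanned (ts' ord_max) == None) <-> L) ->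
  decides_within f (code_machine c) T x L.
Proof.
move=> tc nT HL; exists (scanned (ts' ord_max) == None); split=> //.
rewrite -(subnK nT) iterD iterSr.
have -> : iter n (step f (M := code_machine c)) (step f (init (code_machine c) x))
  = step f (iter n (step f (M := code_machine c)) (init (code_machine c) x)).
  by rewrite -iterSr iterS.
have -> : iter n (step f (M := code_machine c)) (init (code_machine c) x) = (inr None, ts').
  exact: machine_runs tc.
rewrite /= ffunE.
(* The verdict survives the remaining time, since a halting configuration is a fixed point of
   [step]. *)
elim: (_ - _) => // k IH; rewrite iterS.
by case: (iter k _ _) IH => q ts /=; case: q => // -[b|//] /= ->.
Qed.

End Code.

(* A tape that holds the word [w] is numbered so that the cell [0] is the blank
   before [w] and [w] occupies the cells [1 .. size w]. *)
Definition cellw (w : word) (i : nat) : sym := nth None (None :: [seq Some (inl b) | b <- w]) i.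

Arguments cellw : simpl never.

(** The lists of a tape are compared cell by cell with a blank default, which identifies tapes that
    differ by trailing blanks only. *)
Definition rep (t : tape void) (w : word) (q : nat) : Prop :=
  (forall i, nth None (rgt t) i = cellw w (q + i)) /\
  (forall i, nth None (lft t) i =
     if i < q then cellw w (q - i.+1) else None).

Lemma rep_scan t w q : rep t w q -> scanned t = cellw w q.
Proof. by case=> r _; rewrite /scanned -nth0 r addn0. Qed.

(** A relation and not a function: a write is described only if the tape holds a single word
    afterwards, and a left move only if the head does not leave the cell 0. *)
Definition opsem (o : op) (x x' : word * nat) : Prop :=
  match o with
  | Nop => x' = x
  | MoveL => x'.1 = x.1 /\ x.2 = x'.2.+1
  | MoveR => x' = (x.1, x.2.+1)
  | Write a => x'.2 = x.2 /\
      forall i, cellw x'.1 i = if i == x.2 then a else cellw x.1 i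
  end.

Lemma rep_op t x x' o : rep t x.1 x.2 -> opsem o x x' ->
  rep (write_and_move t (op_action o (scanned t)).1 (op_action o (scanned t)).2) x'.1 x'.2.
Proof.
case: x x' => w q [w' q'] /= rt; have sc := rep_scan rt; case: rt => r l.
case: o => [|||a] /=.
- case=> -> ->; split=> //= -[|i] /=; first by rewrite sc addn0.
  by rewrite nth_behead r.
- case=> -> Eq; subst q; split=> [[|[|i]]|i] /=.
  + by rewrite -nth0 l ltnS addn0 subn1.
  + by rewrite sc addn1.
  + by rewrite nth_behead r addSn !addnS.
  + by rewrite nth_behead l ltnS subSS.
- case=> -> ->; split=> [i|[|i]] /=.
  + by rewrite nth_behead r addSnnS.
  + by rewrite sc subSS subn0.
  + by rewrite l ltnS subSS.
- case=> -> Ew; split=> [[|i]|i] /=.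
  + by rewrite addn0 Ew eqxx.
  + by rewrite nth_behead r Ew ifN //; lia.
  + rewrite l; case: ltnP => // iq; rewrite Ew ifN //; lia.
Qed.

(** * Timed execution on words and head positions *)

Section Exec.
Variables (nt : nat) (f : word -> word).
Notation tp := 'I_nt.+2.
Notation store := (tp -> word * nat).
Implicit Types (m : store) (c : code nt).

Definition Rep (ts : tp -> tape void) m := forall i, rep (ts i) (m i).1 (m i).2.

Definition sees m u := cellw (m u).1 (m u).2.

Lemma Rep_act ts g m m' : Rep ts m -> (forall i, opsem (g i) (m i) (m' i)) ->
  Rep (act_tapes g ts) m'.
Proof.
by move=> rt og i; rewrite /act_tapes /action !ffunE; apply: rep_op (rt i) (og i).
Qed.

Lemma Rep_nop ts m : Rep ts m -> Rep (act_tapes (fun=> Nop) ts) m.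
Proof. by move=> rt; apply: Rep_act rt _. Qed.

Definition exec c N m m' := exists2 n, n <= N &
  forall ts, Rep ts m -> exists2 ts', term f c n ts ts' & Rep ts' m'.

Lemma exec_le c N N' m m' : exec c N m m' -> N <= N' -> exec c N' m m'.
Proof. by case=> n nN H NN'; exists n => //; apply: leq_trans NN'. Qed.

Lemma exec_act g m m' : (forall i, opsem (g i) (m i) (m' i)) -> exec (Act g) 1 m m'.
Proof.
move=> og; exists 1 => // ts rt; exists (act_tapes g ts); first exact: term_act.
exact: Rep_act og.
Qed.

Lemma exec_sq c1 c2 N1 N2 m m1 m2 :
  exec c1 N1 m m1 -> exec c2 N2 m1 m2 -> exec (Sq c1 c2) (N1 + N2) m m2.
Proof.
move=> [n1 l1 H1] [n2 l2 H2]; exists (n1 + n2); first exact: leq_add.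
move=> ts /H1[ts1 t1 /H2[ts2 t2 r2]]; exists ts2 => //.
exact: term_sq t1 t2.
Qed.

Lemma exec_ite u (P : pred sym) c1 c2 N m m' :
  exec (if P (sees m u) then c1 else c2) N m m' -> exec (Ite u P c1 c2) N.+1 m m'.
Proof.
move=> [n l H]; exists n.+1 => // ts rt.
have [ts' t' r'] := H _ (Rep_nop rt); exists ts' => //; apply: term_ite.
by rewrite (rep_scan (rt u)).
Qed.

Lemma exec_loop_exit u (P : pred sym) c m : ~~ P (sees m u) -> exec (Loop u P c) 1 m m.
Proof.
move=> nP; exists 1 => // ts rt; exists (act_tapes (fun=> Nop) ts); last exact: Rep_nop.
by apply: term_loop_exit; rewrite (rep_scan (rt u)).
Qed.

Lemma exec_loop_step u (P : pred sym) c N1 N2 m m1 m2 : P (sees m u) ->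
  exec c N1 m m1 -> exec (Loop u P c) N2 m1 m2 -> exec (Loop u P c) (N1 + N2).+1 m m2.
Proof.
move=> pP [n1 l1 H1] [n2 l2 H2]; exists (n1 + n2).+1; first by rewrite ltnS leq_add.
move=> ts rt; have [ts1 t1 /H2[ts2 t2 r2]] := H1 _ (Rep_nop rt); exists ts2 => //.
by apply: term_loop_step t1 t2; rewrite (rep_scan (rt u)).
Qed.

Lemma tape_word_rep t w : rep t w 1 -> tape_word t = w.
Proof.
case=> r _; rewrite /tape_word; move: (rgt t) r => s; elim: w s => [|b w IH] s r.
  have := r 0; case: s {r} => //= -[[b|[]]|] s //=.
have := r 0; case: s r => //= a s r Ea; rewrite Ea /=; congr (_ :: _).
by apply: IH => i; apply: (r i.+1).
Qed.

Lemma word_tape_rep w : rep (word_tape void w) w 1.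
Proof. by split=> // -[|i] //=; rewrite nth_nil. Qed.

Definition home (e : tp -> word) : store := fun i => (e i, 1).

Definition upd {T} (e : tp -> T) (u : tp) (x : T) : tp -> T :=
  fun i => if i == u then x else e i.

Lemma exec_ask e : exec (Ask nt) 1 (home e) (home (upd e ord_max (f (e ord_max)))).
Proof.
exists 1 => // ts rt; exists (ask_tapes f ts); first exact: term_ask.
move=> i; rewrite /ask_tapes /home /upd /=; case: eqP => [->|_]; last exact: rt.
by rewrite (tape_word_rep (rt ord_max)); apply: word_tape_rep.
Qed.

Definition bit b : sym := Some (inl b).

Lemma cellw_nth w i : i < size w -> cellw w i.+1 = bit (nth false w i).
Proof. by move=> iw; rewrite /cellw /= (nth_map false). Qed.

Lemma cellw_default w i : size w < i -> cellw w i = None.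
Proof. by move=> iw; rewrite /cellw nth_default //= size_map. Qed.

(** * Moving heads together and editing one word *)

Definition mv (us : pred tp) (o : op) : tp -> op := fun i => if us i then o else Nop.

Definition setq m (us : pred tp) q : store := fun i => if us i then ((m i).1, q) else m i.

Definition nonblank : pred sym := predC1 None.

(** The heads of [us] move in lockstep, and the one on [v] decides when to stop. In this way the
    length of one word selects a cell of another. *)
Definition walkR us v := Loop v nonblank (Act (mv us MoveR)).
Definition walkL us v := Loop v nonblank (Act (mv us MoveL)).
(** The head on [v] may stand on the blank after its word, where [walkL] would stop at once; hence
    the first move. *)
Definition back us v := Sq (Act (mv us MoveL)) (Sq (walkL us v) (Act (mv us MoveR))).

Lemma exec_moveR m us q : exec (Act (mv us MoveR)) 1 (setq m us q) (setq m us q.+1).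
Proof. by apply: exec_act => i; rewrite /mv /setq; case: (us i). Qed.

Lemma exec_moveL m us q : exec (Act (mv us MoveL)) 1 (setq m us q.+1) (setq m us q).
Proof. by apply: exec_act => i; rewrite /mv /setq; case: (us i). Qed.

Lemma exec_walkR m (us : pred tp) v q : us v -> 0 < q -> q <= (size (m v).1).+1 ->
  exec (walkR us v) (2 * (size (m v).1).+1).+1 (setq m us q) (setq m us (size (m v).1).+1).
Proof.
move=> uv q0 qw.
suff H k p : p + k = (size (m v).1).+1 -> 0 < p ->
    exec (walkR us v) (2 * k).+1 (setq m us p) (setq m us (size (m v).1).+1).
  by apply: exec_le (H _ q (subnKC qw) q0) _; rewrite ltnS leq_mul // leq_subr.
elim: k p => [|k IH] p.
  rewrite addn0 => -> _; apply: exec_loop_exit.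
  by rewrite /sees /setq uv /= cellw_default.
move=> Ep p0; rewrite (_ : (2 * k.+1).+1 = (1 + (2 * k).+1).+1); last lia.
apply: exec_loop_step (exec_moveR m us p) (IH _ _ _); last 2 first.
- lia.
- by [].
rewrite /sees /setq uv /=; case: p p0 Ep => // p _ Ep; rewrite cellw_nth //; lia.
Qed.

Lemma exec_walkL m (us : pred tp) v q : us v -> q <= size (m v).1 ->
  exec (walkL us v) (2 * q).+1 (setq m us q) (setq m us 0).
Proof.
move=> uv; elim: q => [|q IH] qw; first by apply: exec_loop_exit; rewrite /sees /setq uv.
rewrite (_ : (2 * q.+1).+1 = (1 + (2 * q).+1).+1); last lia.
apply: exec_loop_step (exec_moveL m us q) (IH _); last exact: ltnW.
by rewrite /sees /setq uv /= cellw_nth.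
Qed.

Lemma exec_back m (us : pred tp) v q : us v -> q <= (size (m v).1) ->
  exec (back us v) (2 * q + 3) (setq m us q.+1) (setq m us 1).
Proof.
move=> uv qw; rewrite (_ : 2 * q + 3 = 1 + ((2 * q).+1 + 1)); last lia.
apply: exec_sq (exec_moveL _ _ _) _; apply: exec_sq (exec_walkL uv qw) _.
exact: exec_moveR.
Qed.

Lemma setq_home e (us : pred tp) : setq (home e) us 1 = home e.
Proof. by apply/funext => i; rewrite /setq /home; case: (us i). Qed.

Definition putc u b := Sq (walkR (pred1 u) u)
  (Sq (Act (mv (pred1 u) (Write (bit b)))) (Sq (walkL (pred1 u) u) (Act (mv (pred1 u) MoveR)))).

Lemma exec_put e u b :
  exec (putc u b) (4 * size (e u) + 10) (home e) (home (upd e u (rcons (e u) b))).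
Proof.
set w := e u; set e' := upd e u _.
have Ew : e' u = rcons w b by rewrite /e' /upd eqxx.
rewrite (_ : 4 * size w + 10 =
  (2 * (size w).+1).+1 + (1 + ((2 * (size w).+1).+1 + 3))); last lia.
apply: (exec_sq (m1 := setq (home e) (pred1 u) (size w).+1)).
  by rewrite -{1}(setq_home e (pred1 u)); apply: (@exec_walkR (home e)) => //=.
apply: (exec_sq (m1 := setq (home e') (pred1 u) (size w).+1)).
  apply: exec_act => i; rewrite /mv /setq /home /=; case: eqP => [->|nu].
    split=> //= j; rewrite Ew /cellw map_rcons -rcons_cons nth_rcons /= size_map.
    case: ltngtP => // h; rewrite nth_default //= size_map -/w; lia.
  by rewrite /= /e' /upd; case: eqP.
apply: (exec_sq (m1 := setq (home e') (pred1 u) 0)).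
  by apply: (@exec_walkL (home e')) => //=; rewrite Ew size_rcons.
by have := exec_moveR (home e') (pred1 u) 0; rewrite setq_home => H; apply: exec_le H _.
Qed.

Definition clearc u := Sq (walkR (pred1 u) u)
  (Sq (Act (mv (pred1 u) MoveL))
  (Sq (Loop u nonblank (Sq (Act (mv (pred1 u) (Write None))) (Act (mv (pred1 u) MoveL))))
      (Act (mv (pred1 u) MoveR)))).

Lemma exec_clear e u :
  exec (clearc u) (5 * size (e u) + 10) (home e) (home (upd e u [::])).
Proof.
set w := e u.
have H k : k <= size w -> exec (Loop u nonblank
    (Sq (Act (mv (pred1 u) (Write None))) (Act (mv (pred1 u) MoveL)))) (3 * k).+1
    (setq (home (upd e u (take k w))) (pred1 u) k) (setq (home (upd e u [::])) (pred1 u) 0).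
  elim: k => [|k IH] kw.
    rewrite take0; apply: exec_loop_exit.
    by rewrite /sees /setq /= eqxx.
  rewrite (_ : (3 * k.+1).+1 = ((1 + 1) + (3 * k).+1).+1); last lia.
  apply: exec_loop_step (IH (ltnW kw)).
    by rewrite /sees /setq /= eqxx /= /upd eqxx cellw_nth // size_takel.
  apply: (exec_sq (m1 := setq (home (upd e u (take k w))) (pred1 u) k.+1)).
    apply: exec_act => i; rewrite /mv /setq /home /upd /=; case: eqP => // _.
    split=> //= j; case: j => //= j; rewrite eqSS /cellw /=.
    case: (ltngtP j k) => h.
    - rewrite !(nth_map false) ?size_takel ?(ltnW kw) //; last lia.
      by rewrite !nth_take //; lia.
    - by rewrite !nth_default // size_map size_takel //; lia.
    - by rewrite nth_default // size_map size_takel //; lia.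
  exact: exec_moveL.
rewrite (_ : 5 * size w + 10 = (2 * (size w).+1).+1 + (1 + ((3 * size w).+1 + 5))); last lia.
apply: (exec_sq (m1 := setq (home e) (pred1 u) (size w).+1)).
  by rewrite -{1}(setq_home e (pred1 u)); apply: (@exec_walkR (home e)) => //=.
apply: exec_sq (exec_moveL _ _ _) _.
apply: exec_sq.
  rewrite (_ : home e = home (upd e u (take (size w) w))); first exact: H.
  by apply/funext => i; rewrite /home /upd take_size; case: eqP => // ->.
by have := exec_moveR (home (upd e u [::])) (pred1 u) 0; rewrite setq_home => H'; apply: exec_le H' _.
Qed.

Fixpoint inc (w : word) : word :=
  if w is b :: w' then if b then false :: inc w' else true :: w' else [:: true].

Lemma size_inc w : size (inc w) <= (size w).+1.
Proof. by elim: w => //= -[] w IH. Qed.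

Definition incc u := Sq (Loop u (pred1 (bit true))
    (Sq (Act (mv (pred1 u) (Write (bit false)))) (Act (mv (pred1 u) MoveR))))
  (Sq (Act (mv (pred1 u) (Write (bit true))))
  (Sq (walkL (pred1 u) u) (Act (mv (pred1 u) MoveR)))).

Lemma exec_inc e u :
  exec (incc u) (5 * size (e u) + 10) (home e) (home (upd e u (inc (e u)))).
Proof.
set w := e u.
pose pos s q := setq (home (upd e u s)) (pred1 u) q.
have pos1 s : pos s 1 = home (upd e u s) by rewrite /pos setq_home.
have wr s s' q a : (forall j, cellw s' j =
      if j == q then a else cellw s j) ->
    exec (Act (mv (pred1 u) (Write a))) 1 (pos s q) (pos s' q).
  by move=> H; apply: exec_act => i; rewrite /mv /pos /setq /home /upd /=; case: eqP.
have sw p b v j b' : cellw (p ++ b' :: v) j =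
    if j == (size p).+1 then bit b' else cellw (p ++ b :: v) j.
  case: j => //= j; rewrite /cellw /= eqSS !map_cat /= !nth_cat size_map.
  case: ltngtP => // h; last by rewrite h subnn.
  by case: (j - size p) (subn_gt0 (size p) j) => //; rewrite h.
have fin p v : exec (Sq (walkL (pred1 u) u) (Act (mv (pred1 u) MoveR)))
    ((2 * (size p).+1).+1 + 1) (pos (p ++ true :: v) (size p).+1) (pos (p ++ true :: v) 1).
  apply: exec_sq (exec_moveR _ _ _); apply: exec_walkL => //=.
  by rewrite /upd eqxx size_cat /=; lia.
(* The carry loop stops right after [p'], on a zero bit or on the blank that ends the word. Writing
   [true] there turns [p' ++ v'] into the incremented word. *)
have H v p : exists p' v' r, [/\ p ++ inc v = p' ++ true :: r, size p' <= size p + size v,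
    (v' = [::] /\ r = [::]) \/ v' = false :: r &
    exec (Loop u (pred1 (bit true))
      (Sq (Act (mv (pred1 u) (Write (bit false)))) (Act (mv (pred1 u) MoveR)))) (3 * size v).+1
      (pos (p ++ v) (size p).+1) (pos (p' ++ v') (size p').+1)].
  elim: v p => [|b v IH] p.
    exists p, [::], [::]; split=> //; [lia|by left|].
    apply: exec_loop_exit; rewrite /sees /pos /setq /= eqxx /= /upd eqxx cats0.
    by rewrite cellw_default.
  case: b => /=; last first.
    exists p, (false :: v), v; split=> //; [lia|by right|].
    apply: exec_le (exec_loop_exit _ _) _ => //.
    rewrite /sees /pos /setq /= eqxx /= /upd eqxx cellw_nth ?nth_cat ?ltnn ?subnn //.
    by rewrite size_cat /=; lia.
  have [p' [v' [r [E1 E2 E3 E4]]]] := IH (rcons p false).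
  exists p', v', r; split=> //; rewrite -?E1 -?cat_rcons ?size_rcons //.
    by rewrite size_rcons in E2; lia.
  apply: (@exec_le _ (1 + 1 + (3 * size v).+1).+1); last lia.
  apply: exec_loop_step E4.
    rewrite /sees /pos /setq /= eqxx /= /upd eqxx cellw_nth ?size_cat /=; last by rewrite size_rcons; lia.
    by rewrite cat_rcons nth_cat ltnn subnn.
  apply: exec_sq; last by rewrite size_rcons; apply: exec_moveR.
  by rewrite !cat_rcons; apply: wr => j; apply: sw.
have [p' [v' [r [/= E1 E2 E3 E4]]]] := H w [::].
apply: (@exec_le _ ((3 * size w).+1 + (1 + ((2 * (size p').+1).+1 + 1)))); last by lia.
rewrite (_ : home e = pos w 1); last first.
  by rewrite pos1; congr home; apply/funext => i; rewrite /upd; case: eqP => // ->.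
rewrite -pos1 E1; apply: exec_sq E4 _; apply: exec_sq (fin p' r).
apply: wr => j; case: E3 => [[-> ->]|->]; last exact: sw.
case: j => //= j; rewrite eqSS cats0 /cellw /= !map_cat nth_cat size_map /=.
case: ltngtP => // h; last by rewrite h subnn.
by rewrite !nth_default //= ?size_map //; lia.
Qed.

End Exec.

(** * Counting loops that print *)

Lemma all_flatten T (p : pred T) ss : all p (flatten ss) = all (all p) ss.
Proof. by elim: ss => //= s ss <-; rewrite all_cat. Qed.

Section Prog.
Variables (nt : nat) (f : word -> word).
Notation tp := 'I_nt.+2.
Notation env := (tp -> word).
Implicit Types (e : env).

Inductive prim := Put of tp & bool | Inc of tp.

(* [For v u c] runs [c] with [v] holding, in unary, [0], ..., [size u - 1];
   [Case u v sh k] branches on the cell number [size v + sh] of [u]. *)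
Inductive prog :=
| Prim of prim
| Skip
| Seq of prog & prog
| For of tp & tp & prog
| Case of tp & tp & bool & (sym -> prog).

Definition ptape p := match p with Put u _ => u | Inc u => u end.

Definition doprim e p : env :=
  match p with
  | Put u b => upd e u (rcons (e u) b)
  | Inc u => upd e u (inc (e u))
  end.

Definition unary k : word := nseq k true.

Definition look e u v (sh : bool) : sym := cellw (e u) (size (e v) + sh).+1.

(** All primitives can be computed from the initial environment because a well-formed program never
    tests, or loops over, a tape that it writes. *)
Fixpoint em c e : seq prim :=
  match c with
  | Prim p => [:: p]
  | Skip => [::]
  | Seq c1 c2 => em c1 e ++ em c2 e
  | For v u c => flatten [seq em c (upd e v (unary k)) | k <- iota 0 (size (e u))]
  | Case u v sh k => em (k (look e u v sh)) e
  end.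

Section Wf.
Variables (lv rg out : pred tp).

(** [A] lists the counters of the enclosing loops, which an inner loop may not reuse. *)
Fixpoint wf (A : seq tp) c : Prop :=
  match c with
  | Prim p => out (ptape p)
  | Skip => True
  | Seq c1 c2 => wf A c1 /\ wf A c2
  | For v u c => [/\ lv v, v \notin A, rg u & wf (v :: A) c]
  | Case u v _ k => [/\ u != v, ~~ out u, ~~ out v & forall s, wf A (k s)]
  end.

Hypothesis lv_out : forall v, lv v -> ~~ out v.
Hypothesis rg_out : forall v, rg v -> ~~ out v.
Hypothesis lv_rg : forall v, lv v -> ~~ rg v.

Lemma em_out A c e : wf A c -> all (fun p => out (ptape p)) (em c e).
Proof.
elim: c A e => [p|//|c1 IH1 c2 IH2|v u c IH|u v sh k IH] A e /=.
- by move->.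
- by case=> w1 w2; rewrite all_cat (IH1 A) // (IH2 A).
- case=> _ _ _ w; rewrite all_flatten all_map; apply/allP => i _ /=.
  exact: IH w.
- by case=> _ _ _ /(_ (look e u v sh)); apply: IH.
Qed.

Lemma em_ext A c e e' : wf A c -> (forall i, ~~ out i -> e i = e' i) -> em c e = em c e'.
Proof.
elim: c A e e' => [p|//|c1 IH1 c2 IH2|v u c IH|u v sh k IH] A e e' //=.
- by case=> w1 w2 E; rewrite (IH1 A e e') // (IH2 A e e').
- case=> lvv _ rgu w E; rewrite (E u) ?rg_out //; congr flatten; apply: eq_map => i.
  by apply: IH w _ => j oj; rewrite /upd; case: eqP => // _; apply: E.
- by case=> _ ou ov w E; rewrite /look (E u) // (E v) //; apply: IH.
Qed.

Lemma doprims_stable l e i : all (fun p => out (ptape p)) l -> ~~ out i ->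
  foldl doprim e l i = e i.
Proof.
elim: l e => //= p l IH e /andP[op ol] oi; rewrite IH //.
by case: p op => [u b|u] /= ou; rewrite /upd; case: eqP oi => // ->; rewrite ou.
Qed.

Lemma doprims_upd l e v x : all (fun p => out (ptape p)) l -> ~~ out v ->
  foldl doprim (upd e v x) l = upd (foldl doprim e l) v x.
Proof.
elim: l e => //= p l IH e /andP[op ol] ov; rewrite -IH //; congr foldl.
apply/funext => i; case: p op => [u b|u] /= ou; rewrite /upd;
  case: (i =P u) => [->|//]; case: (u =P v) => [E|//]; by rewrite -E ou in ov.
Qed.

Lemma size_doprims l e i : size (foldl doprim e l i) <= size (e i) + size l.
Proof.
elim: l e => [|p l IH] e /=; first by rewrite addn0.
apply: leq_trans (IH _) _; case: p => [u b|u] /=; rewrite /upd; case: eqP => [->|_].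
- by rewrite size_rcons; lia.
- lia.
- by have := size_inc (e u); lia.
- lia.
Qed.

(** [B] stands for a bound on the words that loops range over. A [Case] is charged for all three
    possible symbols, so that the bound does not depend on the environment. *)
Fixpoint ops B c : nat :=
  match c with
  | Prim _ | Skip => 1
  | Seq c1 c2 => ops B c1 + ops B c2
  | For _ _ c => (B * (ops B c).+1).+1
  | Case _ _ _ k => (ops B (k None) + ops B (k (bit false)) + ops B (k (bit true))).+1
  end.

Lemma look_vals e u v sh :
  [\/ look e u v sh = None, look e u v sh = bit false | look e u v sh = bit true].
Proof.
rewrite /look; case: (cellw _ _) => [[[]|[]]|];
  by [apply: Or31|apply: Or32|apply: Or33].
Qed.

Lemma ops_look B e u v sh k : ops B (k (look e u v sh)) < ops B (Case u v sh k).
Proof.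
rewrite /= ltnS; case: (look_vals e u v sh) => ->.
- by rewrite -addnA leq_addr.
- by rewrite addnAC leq_addl.
- exact: leq_addl.
Qed.

Lemma size_em B A c e : wf A c -> (forall u, rg u -> size (e u) <= B) ->
  size (em c e) <= ops B c.
Proof.
elim: c A e => [p|//|c1 IH1 c2 IH2|v u c IH|u v sh k IH] A e //=.
- by case=> w1 w2 rB; rewrite size_cat leq_add // (IH1 A, IH2 A).
- case=> lvv _ rgu w rB; rewrite size_flatten /shape -map_comp sumnE big_map.
  apply: (@leq_trans (\sum_(j <- iota 0 (size (e u))) ops B c)).
    apply: leq_sum => j _ /=; apply: IH w _ => i rgi; rewrite /upd; case: eqP => [E|_].
      by rewrite E in rgi; rewrite (negbTE (lv_rg lvv)) in rgi.
    exact: rB.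
  rewrite big_const_seq count_predT size_iota iter_addn_0 mulnC.
  have := rB u rgu; nia.
- case=> _ _ _ w rB.
  exact: leq_trans (IH _ _ _ (w _) rB) (ltnW (ops_look B e u v sh k)).
Qed.

(** In a loop, the heads on [u] and [v] walk along the counter [v]. When [v] holds [k] in unary, the
    head on [u] then scans bit [k], and a blank there means that the range is exhausted. *)
Fixpoint compile c : code nt :=
  match c with
  | Prim (Put u b) => putc u b
  | Prim (Inc u) => incc u
  | Skip => Act (fun=> Nop)
  | Seq c1 c2 => Sq (compile c1) (compile c2)
  | For v u c =>
      let us := pred2 u v in
      Sq (walkR us v) (Sq (Loop u nonblank
           (Sq (back us v) (Sq (compile c) (Sq (putc v true) (walkR us v)))))
         (Sq (back us v) (clearc v)))
  | Case u v sh k =>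
      let us := pred2 u v in
      let adj o := Act (mv (fun i => sh && (i == u)) o) in
      let ret s := Sq (adj MoveL) (Sq (back us v) (compile (k s))) in
      Sq (walkR us v) (Sq (adj MoveR)
        (Ite u (pred1 None) (ret None)
        (Ite u (pred1 (bit false)) (ret (bit false)) (ret (bit true)))))
  end.

(** [M] bounds every tape throughout, since a primitive lengthens one tape by at most one cell. Each
    primitive or pass of a loop costs time linear in [M]. *)
Lemma compileP B M A c e : wf A c ->
  (forall v, lv v -> v \notin A -> e v = [::]) ->
  (forall u, rg u -> size (e u) <= B) ->
  (forall i, size (e i) + ops B c <= M) ->
  exec f (compile c) (ops B c * (30 * M + 60)) (home e) (home (foldl doprim e (em c e))).
Proof.
elim: c A e => [p|//|c1 IH1 c2 IH2|v u c IH|u v sh k IH] A e /=.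
- move=> _ _ _ leM; case: p => [u b|u] /=.
    by apply: exec_le (exec_put _ _ _ _) _; have := leM u; lia.
  by apply: exec_le (exec_inc _ _ _) _; have := leM u; lia.
- by move=> _ _ _ _; apply: exec_le (exec_act _ _) _ => //; lia.
- case=> w1 w2 lve rB leM; rewrite foldl_cat mulnDl.
  apply: exec_sq.
    by apply: IH1 w1 _ _ _ => // i; have := leM i; lia.
  have o1 := em_out e w1.
  rewrite -(em_ext (e := foldl doprim e (em c1 e)) w2); last first.
    by move=> i oi; rewrite doprims_stable.
  apply: IH2 w2 _ _ _ => [v lvv nA|u rgu|i].
  + by rewrite doprims_stable ?lv_out ?lve.
  + by rewrite doprims_stable ?rg_out ?rB.
  + have := size_doprims (em c1 e) e i; have := size_em w1 rB; have := leM i; lia.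
- case=> lvv nvA rgu w lve rB leM.
  have ov := lv_out lvv; have ou := rg_out rgu.
  have nuv : u != v by apply: contraTneq rgu => ->; apply: lv_rg.
  set us := pred2 u v.
  have usv : us v by rewrite /= eqxx orbT.
  have usu : us u by rewrite /= eqxx.
  pose ek j := foldl doprim e (flatten [seq em c (upd e v (unary i)) | i <- iota 0 j]).
  have wout j : all (fun p => out (ptape p))
      (flatten [seq em c (upd e v (unary i)) | i <- iota 0 j]).
    by rewrite all_flatten all_map; apply/allP => i _ /=; apply: em_out w.
  have ek_stable j i : ~~ out i -> ek j i = e i by move=> oi; apply: doprims_stable.
  have rgv i j : rg i -> upd e v (unary j) i = e i.
    by rewrite /upd; case: eqP => // ->; rewrite (negbTE (lv_rg lvv)).
  have ek_size j i : j <= size (e u) -> size (ek j i) <= size (e i) + j * ops B c.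
    move=> ju; apply: leq_trans (size_doprims _ _ _) _; rewrite leq_add2l.
    rewrite size_flatten /shape -map_comp sumnE big_map.
    apply: (@leq_trans (\sum_(l <- iota 0 j) ops B c)).
      apply: leq_sum => l _ /=; apply: size_em w _ => i' rgi; rewrite rgv //.
      exact: rB.
    by rewrite big_const_seq count_predT size_iota iter_addn_0 mulnC.
  (* The store when the loop tests whether to make the pass number [j]. *)
  pose W j := setq (home (upd (ek j) v (unary j))) us j.+1.
  have uB := rB u rgu; have uM := leM u.
  have loop j k : j + k = size (e u) ->
      exec f (Loop u nonblank
        (Sq (back us v) (Sq (compile c) (Sq (putc v true) (walkR us v)))))
        (k * ((ops B c).+1 * (30 * M + 60))).+1 (W j) (W (size (e u))).
    elim: k j => [|k IHk] j.
      rewrite addn0 => ->; apply: exec_loop_exit.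
      rewrite /sees /W /setq usu /= /upd (negbTE nuv) ek_stable //.
      by rewrite cellw_default.
    move=> Ejk; have ju : j < size (e u) by lia.
    apply: (@exec_le _ _ _ (((2 * j + 3) + (ops B c * (30 * M + 60) +
       ((4 * j + 10) + (2 * j.+2).+1))) + (k * ((ops B c).+1 * (30 * M + 60))).+1).+1);
      last by nia.
    apply: exec_loop_step (IHk j.+1 _); last lia.
      rewrite /sees /W /setq usu /= /upd (negbTE nuv) ek_stable //.
      by rewrite cellw_nth.
    apply: exec_sq.
      rewrite /W; apply: exec_back => //=.
      by rewrite /upd eqxx size_nseq.
    rewrite setq_home; apply: exec_sq.
      apply: IH w _ _ _ => [v' lvv'|u' rgu'|i].
      + rewrite inE negb_or => /andP[nv' nA'].
        by rewrite /upd (negbTE nv') ek_stable ?lv_out // lve.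
      + rewrite /upd; case: eqP => [E|_].
          by rewrite E (negbTE (lv_rg lvv)) in rgu'.
        by rewrite ek_stable ?rg_out // rB.
      + rewrite /upd; case: eqP => [E|_].
          by rewrite size_nseq; nia.
        have := ek_size j i (ltnW ju); have := leM i; nia.
    (* The body starts from the outputs of the first [j] passes, but emits what it would emit from
       [e], as it reads no output tape. *)
    rewrite (_ : foldl _ _ _ = upd (ek j.+1) v (unary j)); last first.
      rewrite (em_ext (e' := upd e v (unary j)) w); last first.
        by move=> i oi; rewrite /upd; case: eqP => // _; rewrite ek_stable.
      rewrite doprims_upd ?(em_out _ w) //; congr upd.
      by rewrite /ek -(addn1 j) iotaD map_cat flatten_cat foldl_cat add0n /= cats0.
    have Ep : upd (upd (ek j.+1) v (unary j)) v (rcons (upd (ek j.+1) v (unary j) v) true)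
            = upd (ek j.+1) v (unary j.+1).
      apply/funext => i; rewrite /upd; case: eqP => // _; rewrite eqxx.
      by rewrite /unary -[RHS]/(true :: nseq j true) -cat1s; elim: (j) => //= n' ->.
    apply: exec_sq.
      apply: exec_le (exec_put _ _ _ _) _.
      by rewrite /upd eqxx size_nseq.
    rewrite Ep -{1}(setq_home _ us) /W.
    have := @exec_walkR nt f (home (upd (ek j.+1) v (unary j.+1))) us v 1 usv.
    have -> : size (home (upd (ek j.+1) v (unary j.+1)) v).1 = j.+1.
      by rewrite /= /upd eqxx /= size_nseq.
    exact.
  apply: (@exec_le _ _ _ (3 + ((size (e u) * ((ops B c).+1 * (30 * M + 60))).+1 +
    ((2 * size (e u) + 3) + (5 * size (e u) + 10))))); last first.
    have := leq_mul uB (leqnn ((ops B c).+1 * (30 * M + 60))).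
    by rewrite [(B * _).+1 * _]mulSn -(mulnA B); lia.
  have ev0 : e v = [::] by apply: lve.
  apply: exec_sq.
    have := @exec_walkR nt f (home e) us v 1 usv isT isT.
    rewrite setq_home (_ : size (home e v).1 = 0); last by rewrite /= ev0.
    exact.
  apply: exec_sq.
    rewrite (_ : setq (home e) us _ = W 0); first exact: (loop 0).
    rewrite /W; congr (setq (home _) us _).
    by apply/funext => i; rewrite /upd; case: eqP => // ->; rewrite ev0.
  apply: exec_sq.
    rewrite /W; apply: exec_back => //=.
    by rewrite /upd eqxx size_nseq.
  rewrite setq_home.
  rewrite (_ : home (foldl _ _ _) = home (upd (upd (ek (size (e u))) v (unary (size (e u)))) v [::])).
    apply: exec_le (exec_clear _ _ _) _.
    by rewrite /upd eqxx size_nseq.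
  congr home; apply/funext => i; rewrite /upd; case: eqP => // ->.
  by rewrite -/(ek _) ek_stable ?ev0.
- rewrite -[(_ + _ + _).+1]/(ops B (Case u v sh k)) => -[nuv ou ov w lve rB leM].
  have os := ops_look B e u v sh k; set us := pred2 u v.
  have usv : us v by rewrite /= eqxx orbT.
  have usu : us u by rewrite /= eqxx.
  set s := look e u v sh.
  pose m1 := setq (home e) us (size (e v)).+1.
  pose m2 : tp -> word * nat := fun i =>
    if sh && (i == u) then (e u, (size (e v)).+2) else m1 i.
  have m1u : m1 u = (e u, (size (e v)).+1) by rewrite /m1 /setq usu.
  have see : sees m2 u = s.
    rewrite /sees /m2 m1u eqxx andbT /s /look.
    by case: (sh) => /=; rewrite ?addn1 ?addn0.
  have mR : exec f (Act (mv (fun i => sh && (i == u)) MoveR)) 1 m1 m2.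
    apply: exec_act => i; rewrite /mv /m2; case: ifP => // /andP[_ /eqP ->].
    by rewrite m1u.
  have mL : exec f (Act (mv (fun i => sh && (i == u)) MoveL)) 1 m2 m1.
    apply: exec_act => i; rewrite /mv /m2; case: ifP => // /andP[_ /eqP ->].
    by rewrite m1u.
  have evM := leM v.
  have ret s' : s' = s -> exec f (Sq (Act (mv (fun i => sh && (i == u)) MoveL))
      (Sq (back us v) (compile (k s')))) (1 + ((2 * size (e v) + 3) +
      ops B (k s) * (30 * M + 60))) m2 (home (foldl doprim e (em (k s) e))).
    move=> ->; apply: exec_sq mL _; apply: exec_sq.
      exact: exec_back.
    rewrite setq_home; apply: IH (w _) _ _ _ => // i.
    by apply: leq_trans (leM i); rewrite leq_add2l ltnW.
  apply: (@exec_le _ _ _ ((2 * (size (e v)).+1).+1 + (1 + (1 + ((2 * size (e v) + 3) +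
      ops B (k s) * (30 * M + 60))).+2))); last first.
    move: os evM; rewrite -/s; move: (ops B (Case _ _ _ _)) (ops B (k s)) => o1 o2; nia.
  apply: exec_sq.
    have := @exec_walkR nt f (home e) us v 1 usv isT isT.
    by rewrite setq_home; apply.
  apply: exec_sq mR _; apply: exec_ite; rewrite see /=.
  case: (s =P None) => [E|nE]; first by apply: exec_le (ret _ _) _.
  apply: exec_ite; rewrite see /=.
  case: (s =P bit false) => [E|nE']; first by apply: ret.
  by apply: ret; rewrite /s in nE nE' *; case: (look_vals e u v sh) nE nE' => ->.
Qed.

End Wf.
End Prog.

(** * Polynomial time *)

Definition poly_bounded (g : word -> nat) : Prop :=
  exists p : {poly nat}, forall x, g x <= p.[size x]%R.

Lemma pb_le g h : (forall x, g x <= h x) -> poly_bounded h -> poly_bounded g.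
Proof. by move=> gh [p hp]; exists p => x; apply: leq_trans (gh x) (hp x). Qed.

Lemma pb_poly (p : {poly nat}) : poly_bounded (fun x => p.[size x]%R).
Proof. by exists p. Qed.

Lemma pb_const k : poly_bounded (fun=> k).
Proof. by exists k%:P%R => x; rewrite hornerC. Qed.

Lemma pb_add g h : poly_bounded g -> poly_bounded h -> poly_bounded (fun x => g x + h x).
Proof. by move=> [p gp] [q hq]; exists (p + q)%R => x; rewrite hornerD; apply: leq_add. Qed.

Lemma pb_mul g h : poly_bounded g -> poly_bounded h -> poly_bounded (fun x => g x * h x).
Proof. by move=> [p gp] [q hq]; exists (p * q)%R => x; rewrite hornerM; apply: leq_mul. Qed.

Lemma pb_succ g : poly_bounded g -> poly_bounded (fun x => (g x).+1).
Proof. by move=> pg; apply: pb_le (pb_add pg (pb_const 1)) => x; rewrite addn1. Qed.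

Section Run.
Variable nt : nat.
Notation tp := 'I_nt.+2.
Notation env := (tp -> word).
Implicit Types (c : prog nt) (C : code nt) (e : word -> env) (h : env).

Lemma pb_ops g c : poly_bounded g -> poly_bounded (fun x => ops (g x) c).
Proof.
move=> pg; elim: c => [p||c1 IH1 c2 IH2|v u c IH|u v sh k IH] /=.
- exact: pb_const.
- exact: pb_const.
- exact: pb_add.
- by apply: pb_succ; apply: pb_mul => //; apply: pb_succ.
- by apply: pb_succ; do 2?apply: pb_add.
Qed.

Definition small e := poly_bounded (fun x => \max_i size (e x i)).

Lemma smallP e g : poly_bounded g -> (forall x i, size (e x i) <= g x) -> small e.
Proof. by move=> pg le; apply: pb_le pg => x; apply/bigmax_leqP => i _. Qed.

Lemma small_upd e u (w : word -> word) : small e -> poly_bounded (fun x => size (w x)) ->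
  small (fun x => upd (e x) u (w x)).
Proof.
move=> se pw; apply: smallP (pb_add se pw) _ => x i; rewrite /upd; case: eqP => _.
  exact: leq_addl.
by apply: leq_trans (leq_addr _ _); apply: (leq_bigmax i).
Qed.

(* The time bound does not depend on the oracle. *)
Definition run C e e' := small e -> small e' /\
  exists2 g, poly_bounded g & forall f x, exec f C (g x) (home (e x)) (home (e' x)).

Lemma run_sq C1 C2 e e1 e2 : run C1 e e1 -> run C2 e1 e2 -> run (Sq C1 C2) e e2.
Proof.
move=> r1 r2 /r1 [s1 [g1 p1 x1]]; have [s2 [g2 p2 x2]] := r2 s1; split=> //.
by exists (fun x => g1 x + g2 x) => [|f x]; [apply: pb_add|apply: exec_sq].
Qed.

Lemma run_clear e u : run (clearc u) e (fun x => upd (e x) u [::]).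
Proof.
move=> se; split; first exact: (@small_upd e u (fun=> [::]) se (pb_const 0)).
exists (fun x => 5 * (\max_i size (e x i)) + 10) => [|f x].
  exact: (pb_add (pb_mul (pb_const 5) se) (pb_const 10)).
by apply: exec_le (exec_clear _ _ _) _; rewrite leq_add2r leq_mul2l /= (leq_bigmax u).
Qed.

Section Compile.
Variables (lv out : pred tp).
Let rg : pred tp := fun u => ~~ out u && ~~ lv u.
Hypothesis lv_out : forall v, lv v -> ~~ out v.

Lemma run_compile c e : wf lv rg out [::] c -> (forall x v, lv v -> e x v = [::]) ->
  run (compile c) e (fun x => foldl (@doprim nt) (e x) (em c (e x))).
Proof.
move=> w lve se.
have rg_out v : rg v -> ~~ out v by case/andP.
have lv_rg v : lv v -> ~~ rg v by rewrite /rg => ->; rewrite andbF.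
pose B x := \max_i size (e x i).
have eB x i : size (e x i) <= B x by apply: (leq_bigmax i).
have pM : poly_bounded (fun x => B x + ops (B x) c) by apply: pb_add => //; apply: pb_ops.
split.
  apply: smallP pM _ => x i; apply: leq_trans (size_doprims _ _ _) _.
  by apply: leq_add => //; apply: (size_em lv_rg w).
exists (fun x => ops (B x) c * (30 * (B x + ops (B x) c) + 60)) => [|f x].
  apply: pb_mul; first exact: pb_ops.
  exact: (pb_add (pb_mul (pb_const 30) pM) (pb_const 60)).
by apply: (compileP f lv_out rg_out lv_rg w) => // [v /lve -> //|i]; rewrite leq_add2r.
Qed.

Fixpoint seqm T (l : seq T) (g : T -> prog nt) : prog nt :=
  if l is x :: l' then Seq (g x) (seqm l' g) else Skip nt.

Definition puts u (w : word) := seqm w (fun b => Prim (Put u b)).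

Fixpoint tests (l : seq (tp * tp * bool)) (k : seq sym -> prog nt) : prog nt :=
  if l is a :: l' then Case a.1.1 a.1.2 a.2 (fun s => tests l' (fun ss => k (s :: ss)))
  else k [::].

Lemma wf_seqm A T (l : seq T) g : (forall x, wf lv rg out A (g x)) -> wf lv rg out A (seqm l g).
Proof. by move=> H; elim: l => //=. Qed.

Lemma wf_puts A u w : out u -> wf lv rg out A (puts u w).
Proof. by move=> ou; apply: wf_seqm. Qed.

Lemma wf_tests A l k : all (fun a => [&& a.1.1 != a.1.2, ~~ out a.1.1 & ~~ out a.1.2]) l ->
  (forall ss, wf lv rg out A (k ss)) -> wf lv rg out A (tests l k).
Proof.
elim: l k => [|a l IH] k //= /andP[/and3P[h1 h2 h3] al] H; split=> // s.
by apply: IH.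
Qed.

End Compile.

Section Says.
Variables (T : Type) (G : T -> prim nt).

Definition says c h (w : seq T) := em c h = map G w.

Lemma says_seq c1 c2 h w1 w2 : says c1 h w1 -> says c2 h w2 -> says (Seq c1 c2) h (w1 ++ w2).
Proof. by rewrite /says /= map_cat => -> ->. Qed.

Lemma says_seqm U (l : seq U) g h (w : U -> seq T) : (forall x, says (g x) h (w x)) ->
  says (seqm l g) h (flatten [seq w x | x <- l]).
Proof. by move=> H; elim: l => //= x l IH; apply: says_seq. Qed.

Lemma says_for v u c h (w : nat -> seq T) : (forall k, k < size (h u) -> says c (upd h v (unary k)) (w k)) ->
  says (For v u c) h (flatten [seq w k | k <- iota 0 (size (h u))]).
Proof.
move=> H; rewrite /says /= map_flatten -map_comp; congr flatten.
by apply/eq_in_map => k; rewrite mem_iota => /andP[_]; apply: H.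
Qed.

Lemma says_tests l k h w : says (k [seq look h a.1.1 a.1.2 a.2 | a <- l]) h w ->
  says (tests l k) h w.
Proof. by elim: l k w => //= a l IH k w H; rewrite /says /=; apply: IH. Qed.

Lemma says_prim x h : says (Prim (G x)) h [:: x].
Proof. by []. Qed.

End Says.

Lemma says_puts u w h : says (Put u) (puts u w) h w.
Proof. by elim: w => //= b w IH; rewrite /says /=; congr cons. Qed.

Lemma foldl_put u w h : foldl (@doprim nt) h (map (Put u) w) = upd h u (h u ++ w).
Proof.
elim: w h => [|b w IH] h /=.
  by apply/funext => i; rewrite /upd; case: eqP => // ->; rewrite cats0.
rewrite IH; apply/funext => i; rewrite /upd eqxx cat_rcons.
by case: eqP.
Qed.

Lemma foldl_inc T u (w : seq T) h :
  foldl (@doprim nt) h (map (fun=> Inc u) w) = upd h u (iter (size w) inc (h u)).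
Proof.
elim: w h => [|b w IH] h /=.
  by apply/funext => i; rewrite /upd; case: eqP => // ->.
rewrite IH; apply/funext => i; rewrite /upd eqxx -iterSr.
by case: eqP.
Qed.

End Run.

(** * The tableau of a computation *)

Section Tableau.
Variable M : machine.
Hypothesis ofree : oracle_free M.
Notation k := (ntapes M).+2.
Notation sy := (symbol (aux M)).
Notation view := (state M * {ffun 'I_k -> sy})%type.

(** A halting state idles, so that every computation fills the whole tableau. *)
Definition trm (v : view) : state M * {ffun 'I_k -> sy * direction} :=
  if verdict v.1 is Some _ then (v.1, [ffun i => (v.2 i, Stay)]) else trans v.1 v.2.

Definition tstep := step (fun=> [::]) (M := M).
Definition conf (w : word) (s : nat) : config M := iter s tstep (init M w).

(* Cells are addressed relative to the head: [side] is [true] to its left. *)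
Definition cell (c : config M) (i : 'I_k) (side : bool) (j : nat) : sy :=
  nth None (if side then lft (c.2 i) else rgt (c.2 i)) j.

Definition view_of (c : config M) : view := (c.1, [ffun i => cell c i false 0]).

(** In coordinates relative to the head, it is the tape that shifts. This makes all rules of the
    tableau independent of the head position. *)
Definition moved (c : config M) i (a : sy) (d : direction) side j : sy :=
  match d, side, j with
  | Stay, false, 0 => a
  | Stay, _, _ => cell c i side j
  | GoRight, true, 0 => a
  | GoRight, true, j'.+1 => cell c i true j'
  | GoRight, false, _ => cell c i false j.+1
  | GoLeft, true, _ => cell c i true j.+1
  | GoLeft, false, 0 => cell c i true 0
  | GoLeft, false, 1 => a
  | GoLeft, false, j'.+1 => cell c i false j'
  end.

Lemma tstep_state c : (tstep c).1 = (trm (view_of c)).1.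
Proof.
rewrite /tstep /step /trm /view_of; case: c => q ts /=.
case: (verdict q) => //; rewrite ofree.
have -> : [ffun i => scanned (ts i)] = [ffun i => cell (q, ts) i false 0].
  by apply/ffunP => i; rewrite !ffunE /scanned -nth0.
by case: (trans _ _).
Qed.

Lemma tstep_cell c i side j :
  cell (tstep c) i side j =
  moved c i ((trm (view_of c)).2 i).1 ((trm (view_of c)).2 i).2 side j.
Proof.
rewrite /tstep /step /trm /view_of; case: c => q ts /=.
case: (verdict q) => [b|] /=.
  by rewrite !ffunE /=; case: side => //; case: j.
rewrite ofree.
have -> : [ffun i => scanned (ts i)] = [ffun i => cell (q, ts) i false 0].
  by apply/ffunP => i'; rewrite !ffunE /scanned -nth0.
case: (trans _ _) => q' act /=; rewrite /cell /moved /=; case: (act i) => a d /=.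
case: d => /=; case: side => /=.
- by rewrite nth_behead.
- by case: j => [|[|j]] //=; rewrite ?nth0 // nth_behead.
- by [].
- by case: j => [|j] //=; rewrite nth_behead.
- by case: j.
- by rewrite nth_behead.
Qed.

(* [Cell i side a] says that the tape [i] has [a] in the addressed cell, and
   [Part i v] that the state is [v.1] and the first [i] scanned symbols are
   those of [v.2]. *)
Definition fact : finType := (('I_k * bool * sy) + ('I_k.+1 * view))%type.
Definition Cell i side a : fact := inl (i, side, a).
Definition Part (i : 'I_k.+1) (v : view) : fact := inr (i, v).

Definition holds (c : config M) (j : nat) (e : fact) : bool :=
  match e with
  | inl (i, side, a) => cell c i side j == a
  | inr (i, v) => (c.1 == v.1) &&
      [forall i' : 'I_k, ((i' : nat) < i) ==> (cell c i' false 0 == v.2 i')]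
  end.

(* What a clause at time [s] and cell [j] may depend on, apart from [s] and [j]. *)
Record profile := Profile {
  at_start : bool; has_next_time : bool; at_head : bool; has_next_cell : bool;
  input_bit : option bool; in_guess : bool }.

(* The time [s] or [s + 1], and the cell [0] (for [None]), [j] or [j + 1]. *)
Definition ref := (bool * option bool * fact)%type.

Definition resolve (s j : nat) (r : ref) : nat * nat * fact :=
  (s + r.1.1, if r.1.2 is Some b then j + b else 0, r.2).

Definition here : option bool := Some false.
Definition there : option bool := Some true.

Definition pos ds dj e : bool * ref := (true, (ds, dj, e)).
Definition neg dj e : bool * ref := (false, (false, dj, e)).

(** * Clause templates *)

Definition template := profile -> seq (bool * ref).
Definition cl1 (l : bool * ref) := [:: l; l; l].
Definition cl2 (l1 l2 : bool * ref) := [:: l1; l2; l2].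
Definition cl3 (l1 l2 l3 : bool * ref) := [:: l1; l2; l3].

Definition bitM b : sy := Some (inl b).

(** An empty list means that there is no clause here. Every kind of clause can then be treated
    uniformly at every time and cell. *)
Definition when (b : bool) (c : seq (bool * ref)) := if b then c else [::].

(** [Part ord0 v] depends on the state [v.1] alone, so it is asserted for every [v] with that state,
    whatever the scanned symbols [v.2]. *)
Definition t_start v : template := fun r =>
  when (at_start r && (v.1 == start M)) (cl1 (pos false None (Part ord0 v))).

Definition t_tape (i : 'I_k) side : template := fun r => when (at_start r)
  (if (i == ord0) && ~~ side then
     match input_bit r with
     | Some b => cl1 (pos false here (Cell i side (bitM b)))
     | None => if in_guess r then
         cl3 (pos false here (Cell i side (bitM false)))
             (pos false here (Cell i side (bitM true))) (pos false here (Cell i side None))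
         else cl1 (pos false here (Cell i side None))
     end
   else cl1 (pos false here (Cell i side None))).

(** Blanks of the input tape propagate to the right, so that the guessed cells form one word. *)
Definition t_blank : template := fun r => when (at_start r && has_next_cell r)
  (cl2 (neg here (Cell ord0 false None)) (pos false there (Cell ord0 false None))).

(** The scanned symbols are collected one tape at a time; a clause that mentions all of them at once
    could have more than three literals. *)
Definition t_part (i : 'I_k) v : template := fun r =>
  cl3 (neg None (Part (widen_ord (leqnSn _) i) v)) (neg None (Cell i false (v.2 i)))
      (pos false None (Part (lift ord0 i) v)).

Definition t_state v v' : template := fun r => when (has_next_time r && (v'.1 == (trm v).1))
  (cl2 (neg None (Part ord_max v)) (pos true None (Part ord0 v'))).

Definition t_write v i : template := fun r =>
  let: (a, d) := (trm v).2 i in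
  let put c dj side := when (has_next_time r && c)
    (cl2 (neg None (Part ord_max v)) (pos true dj (Cell i side a))) in
  match d with
  | Stay => put true None false
  | GoRight => put true None true
  | GoLeft => put (at_head r && has_next_cell r) there false
  end.

(** The shifted indices and the test [~~ at_head r] leave out the scanned cell, whose new content is
    the business of [t_write]. *)
Definition t_copy v i (side : bool) a : template := fun r =>
  let copy c dj dj' := when (has_next_time r && c)
    (cl3 (neg None (Part ord_max v)) (neg dj (Cell i side a)) (pos true dj' (Cell i side a))) in
  match ((trm v).2 i).2, side with
  | Stay, false => copy (has_next_cell r) there there
  | Stay, true => copy true here here
  | GoRight, true => copy (has_next_cell r) here there
  | GoRight, false | GoLeft, true => copy (has_next_cell r) there here
  | GoLeft, false => copy (~~ at_head r && has_next_cell r) here there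
  end.

Definition t_cross v i a : template := fun r =>
  if ((trm v).2 i).2 is GoLeft then when (has_next_time r)
    (cl3 (neg None (Part ord_max v)) (neg None (Cell i true a)) (pos true None (Cell i false a)))
  else [::].

Definition t_final v : template := fun r =>
  when (~~ has_next_time r && (verdict v.1 != Some true))
  (cl1 (neg None (Part ord0 v))).

Definition clause_kind : finType :=
  (view + 'I_k * bool + unit + 'I_k * view + view * view + view * 'I_k +
   view * 'I_k * bool * sy + view * 'I_k * sy + view)%type.

Definition tmpl (t : clause_kind) : template :=
  match t with
  | inl (inl (inl (inl (inl (inl (inl (inl v))))))) => t_start v
  | inl (inl (inl (inl (inl (inl (inl (inr (i, side)))))))) => t_tape i side
  | inl (inl (inl (inl (inl (inl (inr tt)))))) => t_blank
  | inl (inl (inl (inl (inl (inr (i, v)))))) => t_part i v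
  | inl (inl (inl (inl (inr (v, v'))))) => t_state v v'
  | inl (inl (inl (inr (v, i)))) => t_write v i
  | inl (inl (inr (v, i, side, a))) => t_copy v i side a
  | inl (inr (v, i, a)) => t_cross v i a
  | inr v => t_final v
  end.

Lemma templates_size t r : tmpl t r != [::] -> size (tmpl t r) = 3.
Proof.
case: t => [[[[[[[[v|[i side]]|[]]|[i v]]|[v v']]|[v i]]|[[[v i] side] a]]|[[v i] a]]|v] /=.
- by rewrite /t_start /when; case: ifP.
- rewrite /t_tape /when; case: ifP => // _; case: ifP => // _.
  by case: (input_bit r) => //; case: ifP.
- by rewrite /t_blank /when; case: ifP.
- by [].
- by rewrite /t_state /when; case: ifP.
- by rewrite /t_write /when; case: (_ i) => a []; case: ifP.
- by rewrite /t_copy /when; case: (_.2) => //; case: side; case: ifP.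
- by rewrite /t_cross /when; case: (_.2) => //; case: ifP.
- by rewrite /t_final /when; case: ifP.
Qed.

Definition ref_ok (r : profile) (l : bool * ref) :=
  (l.2.1.1 ==> has_next_time r) && ((l.2.1.2 == there) ==> has_next_cell r).

Lemma templates_ok t r : all (ref_ok r) (tmpl t r).
Proof.
case: t => [[[[[[[[v|[i side]]|[]]|[i v]]|[v v']]|[v i]]|[[[v i] side] a]]|[[v i] a]]|v] /=.
- by rewrite /t_start /when; case: ifP.
- rewrite /t_tape /when; case: ifP => // _; case: ifP => // _.
  by case: (input_bit r) => //; case: ifP.
- by rewrite /t_blank /when; case: ifP => //= /andP[_ h]; rewrite /ref_ok /= h.
- by [].
- by rewrite /t_state /when; case: ifP => //= /andP[h _]; rewrite /ref_ok /= h.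
- by rewrite /t_write /when; case: (_ i) => a [];
    case: ifP => //= /andP[h]; rewrite /ref_ok /= h //= => /andP[_ ->].
- by rewrite /t_copy /when; case: (_.2) => //; case: side;
    case: ifP => //= /andP[h]; rewrite /ref_ok /= h //= => h'; rewrite ?h' //; move: h' => /andP[_ ->].
- by rewrite /t_cross /when; case: (_.2) => //; case: ifP => //= h; rewrite /ref_ok /= h.
- by rewrite /t_final /when; case: ifP.
Qed.

(** * Satisfying assignments of the tableau and accepting computations *)

Section Instance.
(* [D] is the input, [W] has the length of the input plus that of the longest guess. *)
Variables (S : nat) (D W : word).

Definition prof (s j : nat) : profile :=
  Profile (s == 0) (s.+1 < S) (j == 0) (j.+1 < S)
          (if j < size D then Some (nth false D j) else None) (j < size W).

Definition clause_at t s j : seq (bool * (nat * nat * fact)) :=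
  [seq (l.1, resolve s j l.2) | l <- tmpl t (prof s j)].

Definition satb (alpha : nat * nat * fact -> bool) cl :=
  has (fun l : bool * _ => alpha l.2 == l.1) cl.

Definition tableau_sat (alpha : nat * nat * fact -> bool) : Prop :=
  forall t s j, s < S -> j < S -> clause_at t s j != [::] -> satb alpha (clause_at t s j).

Lemma cell_init w i side j : cell (init M w) i side j =
  if (i == ord0) && ~~ side then nth None [seq bitM b | b <- w] j else None.
Proof.
rewrite /cell /init /=; case: side => /=; first by rewrite andbF nth_nil.
by rewrite andbT; case: (i == ord0) => //=; rewrite nth_nil.
Qed.

Lemma trace_sat y : size D + size y <= size W -> 0 < S ->
  verdict (conf (D ++ y) S.-1).1 = Some true ->
  tableau_sat (fun x => holds (conf (D ++ y) x.1.1) x.1.2 x.2).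
Proof.
move=> Wy S0 acc t s j sS jS; set w := D ++ y; rewrite /clause_at /satb.
have PartE s' v i : holds (conf w s') 0 (Part i v) -> (i == ord_max) ->
    view_of (conf w s') = v.
  move=> /= /andP[/eqP E /forallP H] /eqP Ei; case: v E H => q sc /= E H.
  rewrite /view_of E; congr pair; apply/ffunP => i'; rewrite ffunE.
  by have := H i'; rewrite Ei ltn_ord => /eqP.
case: t => [[[[[[[[v|[i side]]|[]]|[i v]]|[v v']]|[v i]]|[[[v i] side] a]]|[[v i] a]]|v] /=.
- rewrite /t_start /when; case: ifP => //= /andP[/eqP -> /eqP vs] _.
  rewrite /resolve /= vs eqxx /=.
  by rewrite (_ : [forall i', _]) //; apply/forallP => i'.
- rewrite /t_tape /when; case: ifP => //= /eqP s0 _; rewrite s0.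
  have ci sd := cell_init w i sd j.
  case: ifP => [/andP[/eqP i0 ns]|h].
    have sd : side = false by case: (side) ns.
    rewrite i0 sd in ci *; have {ci} := ci false; rewrite eqxx /= => ci.
    case: ltnP => jD /=.
      rewrite /resolve /= /conf /= addn0 ci (nth_map false) ?nth_cat ?jD ?eqxx //.
      by rewrite /w size_cat; lia.
    case: ltnP => jW /=; rewrite /resolve /= /conf /= addn0 ci.
      have [jw|jw] := ltnP j (size w); last by rewrite nth_default ?size_map ?eqxx ?orbT.
      by rewrite (nth_map false) //; case: (nth false w j).
    by rewrite nth_default ?eqxx // size_map /w size_cat; lia.
  by rewrite /resolve /= /conf /= addn0 ci h eqxx.
- rewrite /t_blank /when; case: ifP => //= /andP[/eqP s0 _] _; rewrite s0.
  rewrite /resolve /= /conf /= !addn0 !cell_init eqxx /= orbF orbb.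
  have [jw|jw] := ltnP j (size w); first by rewrite (nth_map false).
  by rewrite addn1 !nth_default ?size_map // ltnW.
- move=> _; rewrite /resolve /= addn0 orbF.
  case H1 : (_ && _) => //=; case E : (cell _ _ _ _ == _) => //=; rewrite eqb_id.
  move/eqP: E => E; have {H1} /andP[-> /forallP H] := H1; apply/forallP => i'; apply/implyP.
  rewrite /bump leq0n add1n ltnS leq_eqVlt => /orP[/eqP/val_inj ->|ii]; first by rewrite E.
  by have := H i'; rewrite ii.
- rewrite /t_state /when; case: ifP => //= /andP[_ /eqP vs] _.
  rewrite /resolve /= addn0 orbF orbb; case H1 : (_ && _) => //=.
  have Ev := PartE s v ord_max H1 (eqxx _).
  rewrite addn1 /conf iterS -/(conf w s) tstep_state Ev vs eqxx /=.
  by rewrite eqb_id; apply/forallP.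
- rewrite /t_write.
  have key sd jj : (holds (conf w s) 0 (Part ord_max v) ->
        moved (conf w s) i ((trm v).2 i).1 ((trm v).2 i).2 sd jj = ((trm v).2 i).1) ->
      (holds (conf w s) 0 (Part ord_max v) == false) ||
      (holds (conf w s.+1) jj (Cell i sd ((trm v).2 i).1) == true).
    move=> H; case H1 : (holds _ _ (Part _ _)) => //=.
    by rewrite tstep_cell (PartE s v ord_max H1 (eqxx _)) H // eqxx.
  case E : ((trm v).2 i) => [a d]; rewrite E /= in key.
  case: d E key => E key; rewrite /when; case: ifP => //= /andP[_ h] _;
    rewrite /resolve /= !addn0 ?addn1 orbF orbb.
  + by have /andP[/eqP -> _] := h; apply: (key false 1).
  + exact: (key false 0).
  + exact: (key true 0).
- rewrite /t_copy.
  have key j1 j2 : (holds (conf w s) 0 (Part ord_max v) ->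
        moved (conf w s) i ((trm v).2 i).1 ((trm v).2 i).2 side j2 = cell (conf w s) i side j1) ->
      [|| holds (conf w s) 0 (Part ord_max v) == false,
          holds (conf w s) j1 (Cell i side a) == false |
          holds (conf w s.+1) j2 (Cell i side a) == true].
    move=> H; case H1 : (holds _ _ (Part _ _)) => //=.
    case Ea : (cell _ _ _ _ == a) => //=; move/eqP: Ea => Ea.
    by rewrite tstep_cell (PartE s v ord_max H1 (eqxx _)) H // Ea eqxx.
  case E : ((trm v).2 i).2 key => key; case Es : side key => key; rewrite /when;
    case: ifP => //= /andP[_ h] _; rewrite /resolve /= !addn0 ?addn1 orbF.
  + exact: key.
  + by apply: key; case: (j) h.
  + exact: key.
  + exact: key.
  + exact: key.
  + exact: key.
- rewrite /t_cross; case E : ((trm v).2 i).2 => //; rewrite /when; case: ifP => //= _ _.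
  rewrite /resolve /= !addn0 addn1 orbF; case H1 : (_ && _) => //=.
  have Ev := PartE s v ord_max H1 (eqxx _).
  case Ea : (cell _ _ _ _ == a) => //=; move/eqP: Ea => Ea.
  by rewrite tstep_cell Ev E /= Ea eqxx.
- rewrite /t_final /when; case: ifP => //= /andP[nS nv] _; rewrite /resolve /= addn0 orbF !orbb.
  have Es : s = S.-1 by lia.
  by rewrite Es; case Ev : (_ == v.1) => //=; move: nv; rewrite -(eqP Ev) acc eqxx.
Qed.

(** No clause forbids two symbols in one cell. The clauses force all facts of the actual run on
    [D ++ y] to hold; spurious further facts do no harm, because [t_final] contradicts the true
    final state unless it accepts. *)
Lemma sat_trace alpha : size W < S -> size D <= size W -> tableau_sat alpha ->
  exists2 y, size D + size y <= size W & verdict (conf (D ++ y) S.-1).1 = Some true.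
Proof.
move=> WS DW H.
have S0 : 0 < S by lia.
pose bl j := alpha (0, j, Cell ord0 false None).
(* The guess ends at the first cell that may be blank. Before it, each cell holds [true] or [false]
   by [t_tape], and [true] is preferred if both are claimed. *)
pose L := find (fun i => bl (size D + i)) (iota 0 (size W - size D)).
have Lle : L <= size W - size D by rewrite -[X in _ <= X](size_iota 0); apply: find_size.
pose y := [seq alpha (0, size D + i, Cell ord0 false (bitM true)) | i <- iota 0 L].
have sy' : size y = L by rewrite size_map size_iota.
exists y; first by rewrite sy'; lia.
pose w := D ++ y; rewrite -/w.
have bl_blank j : size W <= j -> j < S -> bl j.
  move=> Wj jS; have := H (inl (inl (inl (inl (inl (inl (inl (inr (ord0, false))))))))) 0 j S0 jS.
  have e1 : (j < size D) = false by lia.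
  have e2 : (j < size W) = false by lia.
  by rewrite /clause_at /satb /= /t_tape /= e1 e2 /= /resolve /= !addn0 eqb_id orbF !orbb; move/(_ isT).
have bl_next j : bl j -> j.+1 < S -> bl j.+1.
  move=> bj jS; have := H (inl (inl (inl (inl (inl (inl (inr tt))))))) 0 j S0 (ltnW jS).
  rewrite /clause_at /satb /= /t_blank /= jS /= /resolve /= !addn0 addn1 -/(bl j) bj /=.
  by rewrite eqb_id orbF orbb; move/(_ isT).
have bl_after i : L <= i -> size D + i < S -> bl (size D + i).
  elim: i => [|i IH] Li iS.
    have [m0|mp] := leqP (size W - size D) 0; first by apply: bl_blank => //; lia.
    have /= := @nth_find _ 0 (fun i => bl (size D + i)) (iota 0 (size W - size D)).
    rewrite -/L has_find -/L size_iota => /(_ _); rewrite nth_iota; last lia.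
    by rewrite add0n (_ : L = 0); [apply; lia|lia].
  have [iW|Wi] := ltnP i.+1 (size W - size D); last by apply: bl_blank => //; lia.
  have [Li'|Li'] := leqP L i.
    by rewrite addnS; apply: bl_next; [apply: IH Li' _; lia|lia].
  have EL : L = i.+1 by lia.
  have := @nth_find _ 0 (fun i => bl (size D + i)) (iota 0 (size W - size D)).
  rewrite -/L has_find -/L size_iota nth_iota; last lia.
  by rewrite add0n EL; apply.
have init_fact i side j : j < S -> alpha (0, j, Cell i side (cell (init M w) i side j)).
  move=> jS; rewrite cell_init.
  have := H (inl (inl (inl (inl (inl (inl (inl (inr (i, side))))))))) 0 j S0 jS.
  rewrite /clause_at /satb /= /t_tape /=; case: ifP => [/andP[/eqP i0 ns]|_]; last first.
    by rewrite /= /resolve /= !addn0 eqb_id orbF !orbb; move/(_ isT).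
  have sd : side = false by case: (side) ns.
  rewrite i0 sd; case: ltnP => jD /=.
    rewrite /resolve /= !addn0 eqb_id orbF !orbb (nth_map false) ?nth_cat ?jD; first by apply.
    by rewrite size_cat; lia.
  have [jL|Lj] := ltnP (j - size D) L; last first.
    move=> _; rewrite nth_default ?size_map ?size_cat ?sy'; last lia.
    by have := bl_after (j - size D) Lj; rewrite subnKC //; apply.
  rewrite ifT; last by lia.
  rewrite /= /resolve /= !addn0 !eqb_id orbF => /(_ isT).
  have nbl : ~~ bl j.
    have := @before_find _ 0 (fun i => bl (size D + i)) (iota 0 (size W - size D)) (j - size D) jL.
    by rewrite nth_iota; [rewrite add0n subnKC // => ->|lia].
  rewrite -/(bl j) (negbTE nbl) orbF (nth_map false) ?size_cat ?sy'; last lia.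
  rewrite nth_cat ltnNge jD /= (nth_map 0) ?size_iota // nth_iota // add0n subnKC //.
  by case E : (alpha (0, j, Cell ord0 false (bitM true))) => //; rewrite orbF.
(* A step may depend on the next cell, so one cell at the border is lost per step: only the cells
   with [j + s < S] are controlled. *)
have facts s : s < S ->
    (forall i side j, j + s < S -> alpha (s, j, Cell i side (cell (conf w s) i side j))) /\
    (forall v, v.1 = (conf w s).1 -> alpha (s, 0, Part ord0 v)).
  elim: s => [|s IH] sS.
    split=> [i side j jS|v vs]; first by apply: init_fact; lia.
    have := H (inl (inl (inl (inl (inl (inl (inl (inl v)))))))) 0 0 S0 S0.
    by rewrite /clause_at /satb /= /t_start /= vs eqxx /= /resolve /= eqb_id orbF !orbb; move/(_ isT).
  have [Hc Hp] := IH (ltnW sS); set c := conf w s in Hc Hp.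
  pose v := view_of c.
  have full : alpha (s, 0, Part ord_max v).
    have part n (nk : n < k.+1) : alpha (s, 0, Part (Ordinal nk) v).
      elim: n nk => [|n IHn] nk.
        by have := Hp v erefl; congr (alpha (_, _, Part _ _)); apply: val_inj.
      have nk' : n < k by [].
      have := H (inl (inl (inl (inl (inl (inr (Ordinal nk', v))))))) s 0 (ltnW sS) S0.
      rewrite /clause_at /satb /= /resolve /= !addn0 orbF eqb_id => /(_ isT).
      have -> : widen_ord (leqnSn _) (Ordinal nk') = Ordinal (ltnW nk) by apply: val_inj.
      have -> : lift ord0 (Ordinal nk') = Ordinal nk by apply: val_inj.
      rewrite IHn /= ffunE Hc //=; lia.
    by have := part k (ltnSn _); congr (alpha (_, _, Part _ _)); apply: val_inj.
  have nS : s.+1 < S by [].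
  split=> [i side j jS|v' vs']; last first.
    have := H (inl (inl (inl (inl (inr (v, v')))))) s 0 (ltnW sS) S0.
    rewrite /clause_at /satb /= /t_state /= nS /= vs' tstep_state eqxx /= /resolve /=.
    by rewrite !addn0 addn1 full /= eqb_id orbF orbb; move/(_ isT).
  rewrite /conf iterS -/(conf w s) -/c tstep_cell -/v.
  have cw := H (inl (inl (inl (inr (v, i))))) s.
  have cc := fun a => H (inl (inl (inr (v, i, side, a)))) s.
  have cx := fun a => H (inl (inr (v, i, a))) s.
  move: cw cc cx; rewrite /clause_at /satb /= /t_write /t_copy /t_cross.
  case E : ((trm v).2 i) => [a d] /=; rewrite nS /=.
  have sS' := ltnW sS.
  case: d E => E cw cc cx; case: side cc => cc /=.
  - have hc := Hc i true j.+1; have jn : j.+1 < S by lia.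
    have := cc (cell c i true j.+1) j sS' (ltnW jn); rewrite jn /= /resolve /= !addn0 !addn1 full hc; last lia.
    by rewrite /= eqb_id orbF; move/(_ isT).
  - case: j jS => [|[|j]] jS.
    + have hc := Hc i true 0.
      have := cx (cell c i true 0) 0 sS' S0; rewrite /= /resolve /= !addn0 !addn1 full hc; last lia.
      by rewrite /= eqb_id orbF; move/(_ isT).
    + have jn : 1 < S by lia.
      have := cw 0 sS' S0; rewrite jn /= /resolve /= !addn0 !addn1 full.
      by rewrite /= eqb_id orbF orbb; move/(_ isT).
    + have hc := Hc i false j.+1; have jn : j.+2 < S by lia.
      have := cc (cell c i false j.+1) j.+1 sS' (ltnW jn); rewrite jn /= /resolve /= !addn0 !addn1 full hc; last lia.
      by rewrite /= eqb_id orbF; move/(_ isT).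
  - have hc := Hc i true j; have jn : j < S by lia.
    have := cc (cell c i true j) j sS' jn; rewrite /= /resolve /= !addn0 !addn1 full hc; last lia.
    by rewrite /= eqb_id orbF; move/(_ isT).
  - case: j jS => [|j] jS.
      have := cw 0 sS' S0; rewrite /= /resolve /= !addn0 !addn1 full.
      by rewrite /= eqb_id orbF orbb; move/(_ isT).
    have hc := Hc i false j.+1; have jn : j.+1 < S by lia.
    have := cc (cell c i false j.+1) j sS' (ltnW jn); rewrite jn /= /resolve /= !addn0 !addn1 full hc; last lia.
    by rewrite /= eqb_id orbF; move/(_ isT).
  - case: j jS => [|j] jS.
      have := cw 0 sS' S0; rewrite /= /resolve /= !addn0 !addn1 full.
      by rewrite /= eqb_id orbF orbb; move/(_ isT).
    have hc := Hc i true j; have jn : j.+1 < S by lia.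
    have := cc (cell c i true j) j sS' (ltnW jn); rewrite jn /= /resolve /= !addn0 !addn1 full hc; last lia.
    by rewrite /= eqb_id orbF; move/(_ isT).
  - have hc := Hc i false j.+1; have jn : j.+1 < S by lia.
    have := cc (cell c i false j.+1) j sS' (ltnW jn); rewrite jn /= /resolve /= !addn0 !addn1 full hc; last lia.
    by rewrite /= eqb_id orbF; move/(_ isT).
have S1 : S.-1 < S by lia.
have [_ Hp] := facts S.-1 S1; apply/eqP/negPn/negP => nacc.
have := H (inr (view_of (conf w S.-1))) S.-1 0 S1 S0.
rewrite /clause_at /satb /= /t_final /= nacc prednK // ltnn /= /resolve /= !addn0.
by rewrite Hp //= => /(_ isT).
Qed.

End Instance.
End Tableau.

(** * Vertices and edges through tight rows *)

Local Open Scope ring_scope.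

Lemma mulmx_line (R : pzRingType) m d (A : 'M[R]_(m, d)) (x D : 'cV[R]_d) (e : R) i :
  (forall a b : R, a * b = b * a) ->
  (A *m (x + e *: D)) i 0 = (A *m x) i 0 + e * (A *m D) i 0.
Proof.
move=> comm; rewrite mulmxDr mxE; congr (_ + _); rewrite !mxE mulr_sumr.
by apply: eq_bigr => j _; rewrite mxE mulrA (comm _ e) -mulrA.
Qed.

Section TightRows.
Variables (R : realType) (m d : nat) (A : 'M[rat]_(m, d)) (b : 'cV[rat]_m).
Let A' : 'M[R]_(m, d) := map_mx ratr A.
Let P := @polyhedron R d m A b.
Implicit Types x D : 'cV[R]_d.

Definition tight x i := (A' *m x) i 0 == ratr (b i 0).

(** Tight rows are constant along [D], and finitely many other rows have positive slack. *)
Lemma small_step x D : P x -> (forall i, tight x i -> (A' *m D) i 0 = 0) ->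
  exists2 e : R, 0 < e & P (x + e *: D) /\ P (x - e *: D).
Proof.
move=> Px tD.
have [e e0 He] : exists2 e : R, 0 < e &
    forall i, i \in enum 'I_m -> e * `|(A' *m D) i 0| <= ratr (b i 0) - (A' *m x) i 0.
  elim: (enum _) => [|i s [e e0 He]]; first by exists 1.
  have [ti|nti] := boolP (tight x i).
    exists e => // j; rewrite inE => /orP[/eqP ->|/He //].
    by rewrite tD // normr0 mulr0 subr_ge0.
  have pi : 0 < ratr (b i 0) - (A' *m x) i 0.
    by rewrite subr_gt0 lt_neqAle nti Px.
  pose q : R := `|(A' *m D) i 0|.
  have q0 : 0 <= q by apply: normr_ge0.
  exists (Num.min e ((ratr (b i 0) - (A' *m x) i 0) / (q + 1))).
    by rewrite lt_min e0 divr_gt0 // ltr_wpDl.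
  move=> j; rewrite inE => /orP[/eqP ->|/He Hj].
    rewrite -/q; apply: (@le_trans _ _ ((ratr (b i 0) - (A' *m x) i 0) / (q + 1) * q)).
      by rewrite ler_wpM2r // ge_min lexx orbT.
    rewrite mulrAC ler_pdivrMr ?ltr_wpDl // ler_wpM2l ?lerDl //.
    exact: ltW.
  apply: le_trans Hj; rewrite ler_wpM2r // ge_min lexx //.
exists e => //; split=> i.
  have := He i (mem_enum _ i); rewrite mulmxDr -scalemxAr !mxE.
  move: (ler_norm ((A' *m D) i 0)); rewrite !mxE; nra.
have := He i (mem_enum _ i); rewrite mulmxBr -scalemxAr !mxE.
move: (ler_norm (- (A' *m D) i 0)); rewrite normrN !mxE; nra.
Qed.

Lemma vertex_in x : is_vertex P x -> P x.
Proof. by case=> c [delta [_ E]]; have : [set x]%classic x by []; rewrite E => -[]. Qed.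

(** Otherwise [x] is the midpoint of a segment in the polyhedron; the functional that exposes [x] is
    constant on it, so the face is not a point. *)
Lemma vertex_rigid x D : is_vertex P x ->
  (forall i, tight x i -> (A' *m D) i 0 = 0) -> D = 0.
Proof.
move=> vx; have Px := vertex_in vx.
case: vx => c [delta [Hc E]] /(small_step Px) [e e0 [P1 P2]].
have [_ /= cx] : (P `&` [set y | (c *m y) 0 0 = delta])%classic x by rewrite -E.
have cD : (c *m D) 0 0 = 0.
  have := Hc _ P1; have := Hc _ P2.
  rewrite -scaleNr !mulmx_line ?cx; try exact: mulrC.
  nra.
have : [set x]%classic (x + e *: D).
  by rewrite E; split=> //=; rewrite mulmx_line ?cx ?cD ?mulr0 ?addr0 //; apply: mulrC.
rewrite /= => /(canRL (addKr _)); rewrite addNr => /eqP.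
by rewrite scaler_eq0 gt_eqF //= => /eqP.
Qed.

(** The sum of the rows in [I] reaches the sum of their bounds exactly where all of them are tight,
    so it exposes the face that they define. *)
Let face_fun (I : {set 'I_m}) : 'rV[R]_d := \sum_(i in I) row i A'.
Let face_rhs (I : {set 'I_m}) : R := \sum_(i in I) ratr (b i 0).

Let face_funE I x : (face_fun I *m x) 0 0 = \sum_(i in I) (A' *m x) i 0.
Proof.
rewrite /face_fun mulmx_suml summxE; apply: eq_bigr => i _.
by rewrite -row_mul mxE.
Qed.

Let face_of (I : {set 'I_m}) :
  is_face P (P `&` [set x | forall i, i \in I -> (A' *m x) i 0 = ratr (b i 0)])%classic.
Proof.
exists (face_fun I), (face_rhs I); split.
  by move=> x Px; rewrite face_funE; apply: ler_sum => i _; apply: Px.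
apply/seteqP; split=> x [Px /= Hx]; split=> //=.
  by rewrite face_funE; apply: eq_bigr => i /Hx.
move=> i iI; apply/eqP; rewrite -subr_eq0 -oppr_eq0 opprB; apply/eqP.
have /eqP := Hx; rewrite face_funE eq_sym -subr_eq0 -sumrB => /eqP/psumr_eq0P.
by apply=> // j jI; rewrite subr_ge0; apply: Px.
Qed.

Lemma rigid_vertex x : P x ->
  (forall D, (forall i, tight x i -> (A' *m D) i 0 = 0) -> D = 0) -> is_vertex P x.
Proof.
move=> Px rx; rewrite /is_vertex.
suff -> : [set x]%classic =
  (P `&` [set y | forall i, i \in [set i | tight x i]%SET -> (A' *m y) i 0 = ratr (b i 0)])%classic.
  exact: face_of.
apply/seteqP; split=> y.
  by move=> /= ->; split=> //= i; rewrite inE => /eqP.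
case=> Py /= Hy; apply/eqP; rewrite -subr_eq0; apply/eqP/rx => i ti.
by rewrite mulmxBr mxE Hy ?inE // mxE (eqP ti) subrr.
Qed.

Lemma tight_mid u v i : P u -> P v -> tight (2^-1 *: (u + v)) i -> tight u i && tight v i.
Proof.
move=> Pu Pv /eqP; rewrite -scalemxAr mulmxDr !mxE => E.
have := Pu i; have := Pv i; rewrite /tight !mxE => H1 H2.
by apply/andP; split; apply/eqP; lra.
Qed.

(** The rows tight at the midpoint of [u] and [v] are those tight at both. Small steps along [D]
    from there stay in the face, which lies on a line. *)
Lemma adjacent_rigid u v D : adjacent P u v ->
  (forall i, tight u i -> tight v i -> (A' *m D) i 0 = 0) ->
  exists k : R, D = k *: (v - u).
Proof.
case=> vu vv nuv [F [[c [delta [Hc ->]]] [x0 [B [_ _ _ HB]]] Fu Fv]] tD.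
have [Pu Pv] := (vertex_in vu, vertex_in vv).
set mid := 2^-1 *: (u + v).
have Pm : P mid.
  move=> i; rewrite -scalemxAr mulmxDr !mxE.
  have := Pu i; have := Pv i; rewrite !mxE; lra.
have [e e0 [P1 P2]] := small_step Pm (fun i ti =>
  match andP (tight_mid Pu Pv ti) with conj a b => tD i a b end).
have cm : (c *m mid) 0 0 = delta.
  case: Fu => _ /= Fu; case: Fv => _ /= Fv.
  by rewrite -scalemxAr mulmxDr 2!mxE Fu Fv; lra.
have cD : (c *m D) 0 0 = 0.
  have := Hc _ P1; have := Hc _ P2.
  rewrite -scaleNr !mulmx_line ?cm; try exact: mulrC.
  nra.
have Fm : (P `&` [set y | (c *m y) 0 0 = delta])%classic (mid + e *: D).
  by split=> //=; rewrite mulmx_line ?cm ?cD ?mulr0 ?addr0 //; apply: mulrC.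
have [cu Eu] := HB _ Fu; have [cv Ev] := HB _ Fv; have [cw Ew] := HB _ Fm.
have sc (w : 'cV[R]_1) : w = (w 0 0)%:M by apply/matrixP => i j; rewrite !ord1 !mxE.
have Euv : v - u = (cv 0 0 - cu 0 0) *: B *m 1%:M.
  rewrite Eu Ev (sc cu) (sc cv) !mxE /= !mulr1n.
  by rewrite !mul_mx_scalar opprD addrACA subrr add0r -scalerBl scale1r.
have nz : cv 0 0 - cu 0 0 != 0.
  apply/eqP => z; apply: nuv; apply/esym/eqP; rewrite -subr_eq0 Euv z.
  by rewrite scale0r mul0mx.
have ED : e *: D = (cw 0 0 - 2^-1 * (cu 0 0 + cv 0 0)) *: B.
  move: Ew => /(canRL (addKr _)) ->; rewrite /mid Eu Ev (sc cu) (sc cv) (sc cw).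
  rewrite !mxE /= !mulr1n !mul_mx_scalar.
  apply/matrixP => i j; rewrite !mxE; by field.
exists (e^-1 * (cw 0 0 - 2^-1 * (cu 0 0 + cv 0 0)) / (cv 0 0 - cu 0 0)).
rewrite Euv mulmx1 scalerA divfK // -scalerA -ED scalerA mulVf ?gt_eqF //.
by rewrite scale1r.
Qed.

Lemma rigid_adjacent u v : is_vertex P u -> is_vertex P v -> u != v ->
  (forall D, (forall i, tight u i -> tight v i -> (A' *m D) i 0 = 0) ->
     exists k : R, D = k *: (v - u)) ->
  adjacent P u v.
Proof.
move=> vu vv nuv ruv; have [Pu Pv] := (vertex_in vu, vertex_in vv).
split=> //; first exact/eqP.
eexists; split; first exact: (face_of [set i | tight u i && tight v i]%SET).
- exists u, (v - u); split.
  + by split=> //= i; rewrite inE => /andP[/eqP].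
  + move=> j; rewrite (_ : u + _ = v); last first.
      by apply/matrixP => i k; rewrite !mxE !ord1 addrC subrK.
    by split=> //= i; rewrite inE => /andP[_ /eqP].
  + apply/eqP; rewrite eqn_leq rank_leq_col lt0n mxrank_eq0 subr_eq0 eq_sym.
    exact: nuv.
  + move=> x [Px /= Hx]; have [k Ek] : exists k : R, x - u = k *: (v - u).
      apply: ruv => i tu tv; rewrite mulmxBr mxE Hx ?inE ?tu //.
      by rewrite mxE (eqP tu) subrr.
    exists k%:M; rewrite mul_mx_scalar -Ek addrC subrK //.
- by split=> //= i; rewrite inE => /andP[/eqP].
- by split=> //= i; rewrite inE => /andP[_ /eqP].
Qed.

End TightRows.

(** * Sparse linear systems *)

Section Rows.
Variable C : eqType.

(* A sparse linear form, in which a coordinate may be repeated, and a right-hand side. *)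
Definition row := (seq (C * int) * int)%type.

Definition entry_of (r : row) (c : C) : int := \sum_(p <- r.1 | p.1 == c) p.2.

Variables (c0 : C) (cols : seq C) (rows : seq row).

Definition sys : lin_system :=
  @LinSystem (size rows) (size cols)
    (\matrix_(i, j) (entry_of (nth ([::], 0) rows i) (nth c0 cols j))%:~R)
    (\col_i (nth ([::], 0) rows i).2%:~R).

Variable R : realType.
Implicit Types (x D : 'cV[R]_(size cols)) (r : row).

(** Written as a sum, a coordinate that is not among the columns reads as 0, and linearity needs no
    membership hypothesis. *)
Definition coor x (c : C) : R := \sum_(j < size cols | nth c0 cols j == c) x j 0.

Definition rowv r x : R := \sum_(p <- r.1) p.2%:~R * coor x p.1.

Lemma coD x D c : coor (x + D) c = coor x c + coor D c.
Proof. by rewrite /coor -big_split; apply: eq_bigr => j _; rewrite mxE. Qed.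

Lemma coZ k x c : coor (k *: x) c = k * coor x c.
Proof. by rewrite /coor mulr_sumr; apply: eq_bigr => j _; rewrite mxE. Qed.

Lemma coN x c : coor (- x) c = - coor x c.
Proof. by rewrite -scaleN1r coZ mulN1r. Qed.

Lemma co0 c : coor 0 c = 0.
Proof. by rewrite -(scale0r 0) coZ mul0r. Qed.

Definition coE := (coD, coZ, coN, co0).

Lemma evD r x D : rowv r (x + D) = rowv r x + rowv r D.
Proof. by rewrite /rowv -big_split; apply: eq_bigr => j _; rewrite coD mulrDr. Qed.

Lemma evZ r k x : rowv r (k *: x) = k * rowv r x.
Proof. by rewrite /rowv mulr_sumr; apply: eq_bigr => j _; rewrite coZ mulrCA. Qed.

Lemma evN r x : rowv r (- x) = - rowv r x.
Proof. by rewrite -scaleN1r evZ mulN1r. Qed.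

Lemma lhsE (i : 'I_(size rows)) x :
  (map_mx ratr (lhs sys) *m x) i 0 = rowv (nth ([::], 0) rows i) x.
Proof.
rewrite mxE /rowv.
under eq_bigr => j _ do
  rewrite !mxE ratr_int /entry_of rmorph_sum /= mulr_suml big_mkcond /=.
rewrite exchange_big /=; apply: eq_bigr => p _.
rewrite /coor mulr_sumr [RHS]big_mkcond; apply: eq_bigr => j _.
by rewrite eq_sym.
Qed.

Definition tight_row x r := rowv r x == r.2%:~R.

Lemma all_rows (Q : row -> Prop) :
  (forall i : 'I_(size rows), Q (nth ([::], 0) rows i)) <-> {in rows, forall r, Q r}.
Proof.
split=> [H r rin|H i]; last by apply: H; apply: mem_nth.
have ir : (index r rows < size rows)%N by rewrite index_mem.
by have := H (Ordinal ir); rewrite /= nth_index.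
Qed.

Notation P := (solution_set R sys).

Lemma in_sys x : P x <-> {in rows, forall r, rowv r x <= r.2%:~R}.
Proof.
rewrite -(all_rows (fun r => rowv r x <= r.2%:~R)).
by split=> H i; have := H i; rewrite lhsE mxE ratr_int.
Qed.

Let tightE x i : tight (lhs sys) (rhs sys) x i = tight_row x (nth ([::], 0) rows i).
Proof. by rewrite /tight lhsE mxE ratr_int. Qed.

Lemma sys_vertexP x : P x ->
  (is_vertex P x <->
   forall D, {in rows, forall r, tight_row x r -> rowv r D = 0} -> D = 0).
Proof.
move=> Px; split=> [vx D HD|H].
  apply: (vertex_rigid vx) => i; rewrite lhsE tightE.
  by move: i; apply/(all_rows (fun r => tight_row x r -> rowv r D = 0)).
apply: rigid_vertex => // D HD; apply: H.
apply/(all_rows (fun r => tight_row x r -> rowv r D = 0)) => i.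
by have := HD i; rewrite lhsE tightE.
Qed.

Lemma sys_adjacentE u v D : adjacent P u v ->
  {in rows, forall r, tight_row u r -> tight_row v r -> rowv r D = 0} ->
  exists k : R, D = k *: (v - u).
Proof.
move=> uv HD; apply: (adjacent_rigid uv) => i; rewrite lhsE !tightE.
by move: i; apply/(all_rows (fun r => tight_row u r -> tight_row v r -> rowv r D = 0)).
Qed.

Lemma sys_adjacentI u v : is_vertex P u -> is_vertex P v -> u != v ->
  (forall D, {in rows, forall r, tight_row u r -> tight_row v r -> rowv r D = 0} ->
     exists k : R, D = k *: (v - u)) ->
  adjacent P u v.
Proof.
move=> vu vv nuv H; apply: rigid_adjacent => // D HD; apply: H.
apply/(all_rows (fun r => tight_row u r -> tight_row v r -> rowv r D = 0)) => i.
by have := HD i; rewrite lhsE !tightE.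
Qed.

Hypothesis ucols : uniq cols.

Definition mk (phi : C -> R) : 'cV[R]_(size cols) := \col_j phi (nth c0 cols j).

Lemma co_mk phi c : c \in cols -> coor (mk phi) c = phi c.
Proof.
move=> cin; have ic : (index c cols < size cols)%N by rewrite index_mem.
rewrite /coor (bigD1 (Ordinal ic)) /=; last by rewrite nth_index.
rewrite mxE nth_index // big1 ?addr0 // => j /andP[/eqP E /negP[]].
by apply/eqP/val_inj; rewrite /= -E index_uniq.
Qed.

Lemma co_out x c : c \notin cols -> coor x c = 0.
Proof.
by move=> nc; rewrite /coor big_pred0 // => j; apply: contraNF nc => /eqP <-; apply: mem_nth.
Qed.

Lemma co_nth x (j : 'I_(size cols)) : coor x (nth c0 cols j) = x j 0.
Proof.
rewrite /coor (bigD1 j) //= big1 ?addr0 // => k /andP[/eqP /(uniqP c0 ucols)].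
by move=> E /negP[]; apply/eqP/val_inj/E; rewrite inE ltn_ord.
Qed.

Lemma co_ext x D : {in cols, forall c, coor x c = coor D c} -> x = D.
Proof.
move=> H; apply/colP => j; have := H _ (mem_nth c0 (ltn_ord j)).
by rewrite !co_nth.
Qed.

End Rows.

(** Reduces a goal [(A -> B) -> G] to [B -> G], the premise [A] (mostly a vanishing slack) being
    left to [lra]. *)
Ltac fire := let H := fresh in let K := fresh in intro H;
  match type of H with ?A -> _ => assert (K : A) by lra; specialize (H K); clear K; revert H end.

Lemma half_between (R : realFieldType) (a b : R) : a <= 2^-1 -> 2^-1 <= b ->
  exists l : R, [/\ 0 <= l, l <= 1 & (1 - l) * a + l * b = 2^-1].
Proof.
move=> a2 b2; have [E|ne] := eqVneq b a; first by exists 0; split; lra.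
have dp : 0 < b - a by rewrite subr_gt0 lt_neqAle eq_sym ne; apply: le_trans b2.
exists ((2^-1 - a) / (b - a)); split.
- by rewrite divr_ge0 //; lra.
- by rewrite ler_pdivrMr //; lra.
- by field; rewrite gt_eqF.
Qed.

(** * The spindle of a set of clauses *)

Section Spindle.
Variables (R : realType) (V : eqType) (vs : seq V) (cls : seq (seq (bool * V))).

Definition coord : eqType := (option bool + bool * V)%type.
Definition Ct : coord := inl None.
Definition Ch : coord := inl (Some false).
Definition Cg : coord := inl (Some true).
Definition Cy v : coord := inr (false, v).
Definition Cz v : coord := inr (true, v).

Definition sp_cols : seq coord :=
  [:: Ct; Ch; Cg] ++ flatten [seq [:: Cy v; Cz v] | v <- vs].

Definition sgi (s : bool) : int := if s then -1 else 1.
Definition bls := [:: false; true].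

(* [T_b <= E] is moved to the left as [E + tb b * t + h <= b]. *)
Definition tb (b : bool) : int := if b then 1 else -1.
(** As functions of r = T_b +- y_v, the bounds on [z_v] for [k] and [k + 1] meet at r = (k + 1)(1 -
    2h)/12. Their minimum over [k] is concave, with breaks at 1/12, 1/6 and 1/4 of 1 - 2h. *)
Definition kk (k : nat) : int := (12 * (4 - k))%N.
Definition tk (k : nat) : int := ((k * k.+1) %/ 2)%N.

(* Below, [b] selects [T_b], and the signs [s], [s'] the two halves of an absolute value. *)
Definition rH : row coord := ([:: (Ch, -1)], 0).
Definition rT b : row coord := ([:: (Ct, tb b); (Ch, 1)], (b : nat)%:Z).
(** The bounds 2, 3 - 4h, 6 - 12h on |g| meet at h = 1/4 and h = 3/8, and the last vanishes at h =
    1/2. The bound of [rG4] meets 2 at distance 1/24 from a tip. *)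
Definition rG1 s : row coord := ([:: (Cg, sgi s)], 2).
Definition rG2 s : row coord := ([:: (Cg, sgi s); (Ch, 4)], 3).
Definition rG3 s : row coord := ([:: (Cg, sgi s); (Ch, 12)], 6).
Definition rG4 b s : row coord := ([:: (Cg, sgi s); (Ct, 48 * tb b)], 48 * (b : nat)%:Z).
Definition rY v b s : row coord := ([:: (Cy v, sgi s); (Ct, tb b); (Ch, 1)], (b : nat)%:Z).
Definition rZ v k b s s' : row coord :=
  ([:: (Cz v, sgi s'); (Cy v, - kk k * sgi s); (Ct, kk k * tb b); (Ch, kk k + 2 * tk k)],
   kk k * (b : nat)%:Z + tk k).
(** For the empty clause this is a copy of [rT b]. *)
Definition rC cl b : row coord :=
  ([seq (Cy l.2, if l.1 then -1 else 1) | l <- cl] ++ [:: (Ct, tb b); (Ch, 1)], (b : nat)%:Z).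

Definition base_rows : seq (row coord) :=
  [:: rH; rT false; rT true] ++
  flatten [seq [:: rG1 s; rG2 s; rG3 s; rG4 false s; rG4 true s] | s <- bls].
Definition var_rows v : seq (row coord) :=
  flatten [seq [seq rY v b s | s <- bls] | b <- bls] ++
  flatten [seq flatten [seq flatten [seq [seq rZ v k b s s' | s' <- bls] | s <- bls] | b <- bls]
          | k <- iota 0 4].
Definition cl_rows cl : seq (row coord) := [seq rC cl b | b <- bls].

Definition sp_rows : seq (row coord) :=
  base_rows ++ flatten [seq var_rows v | v <- vs] ++ flatten [seq cl_rows cl | cl <- cls].

Definition spindle := sys Ct sp_cols sp_rows.

Notation P := (solution_set R spindle).
Notation co := (@coor coord Ct sp_cols R).
Notation ev := (@rowv coord Ct sp_cols R).
Notation tightr := (@tight_row coord Ct sp_cols R).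
Notation pt := 'cV[R]_(size sp_cols).
Implicit Types (x D X : pt).

(** These rows are all tight at [hub] and free of [g]: they cut out a cone with apex [hub], times
    the axis of [g]. *)
Definition pi_rows : seq (row coord) :=
  [:: rT false; rT true] ++
  flatten [seq var_rows v | v <- vs] ++ flatten [seq cl_rows cl | cl <- cls].

Lemma pi_rowsP (Q : row coord -> Prop) :
  {in pi_rows, forall r, Q r} <->
  [/\ forall b, Q (rT b),
      forall v, v \in vs -> (forall b s, Q (rY v b s)) /\
                forall k b s s', (k < 4)%N -> Q (rZ v k b s s')
    & forall cl, cl \in cls -> forall b, Q (rC cl b)].
Proof.
have inb (b : bool) : b \in bls by case: b.
split=> [H|[H2 H4 H5] r].
  split.
  - by case; apply: H; rewrite !inE eqxx ?orbT.
  - move=> v vin; have B r : r \in var_rows v -> Q r.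
      move=> h; apply: H; rewrite !mem_cat; apply/orP; right; apply/orP; left.
      by apply/flatten_mapP; exists v.
    split=> [b s|k b s s' k4]; apply: B; rewrite mem_cat; apply/orP.
      by left; apply/flatten_mapP; exists b => //; apply: map_f.
    right; apply/flatten_mapP; exists k; first by rewrite mem_iota.
    apply/flatten_mapP; exists b => //; apply/flatten_mapP; exists s => //.
    exact: map_f.
  - move=> cl clin b; apply: H; rewrite !mem_cat; apply/orP; right; apply/orP; right.
    by apply/flatten_mapP; exists cl => //; apply: map_f.
rewrite !mem_cat => /or3P[||].
- by rewrite !inE => /orP[] /eqP ->.
- move=> /flatten_mapP[v vin]; have [HY HZ] := H4 v vin; rewrite mem_cat => /orP[].
    by move=> /flatten_mapP[b _ /mapP[s _ ->]].
  move=> /flatten_mapP[k]; rewrite mem_iota => k4.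
  by move=> /flatten_mapP[b _ /flatten_mapP[s _ /mapP[s' _ ->]]]; apply: HZ.
- by move=> /flatten_mapP[cl clin /mapP[b _ ->]]; apply: H5.
Qed.

Lemma sp_rowsP (Q : row coord -> Prop) :
  {in sp_rows, forall r, Q r} <->
  {in pi_rows, forall r, Q r} /\
  (Q rH /\ forall s, [/\ Q (rG1 s), Q (rG2 s), Q (rG3 s) & forall b, Q (rG4 b s)]).
Proof.
split=> [H|[H [H1 H3]] r].
  split=> [r|]; last first.
    split=> [|s]; first by apply: H; rewrite mem_cat inE eqxx.
    by split=> [|||[]]; apply: H; case: s; rewrite !mem_cat !inE eqxx ?orbT.
  rewrite !mem_cat => rin; apply: H; rewrite !mem_cat; case/orP: rin => [|->]; last by rewrite !orbT.
  by rewrite !inE => /orP[] /eqP ->; rewrite eqxx ?orbT.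
rewrite mem_cat => /orP[|rin]; last by apply: H; rewrite mem_cat rin orbT.
rewrite mem_cat => /orP[].
  by rewrite !inE => /or3P[/eqP->//||] /eqP ->; apply: H; rewrite !inE eqxx ?orbT.
case/flatten_mapP=> s _; have [? ? ? ?] := H3 s.
by rewrite !inE => /or4P[/eqP->|/eqP->|/eqP->|/orP[]/eqP->].
Qed.

Definition sgr (s : bool) : R := if s then -1 else 1.
Definition tdist x b : R := if b then 1 - co x Ct else co x Ct.
Definition Tb x b : R := tdist x b - co x Ch.
Definition lits cl x : R := \sum_(l <- cl) (if l.1 then - co x (Cy l.2) else co x (Cy l.2)).
Definition Kr (k : nat) : R := (12 * (4 - k))%:R.
Definition tr (k : nat) : R := ((k * k.+1) %/ 2)%:R.

(* The linear part of [Tb]. *)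
Definition dT D b : R := (if b then - co D Ct else co D Ct) - co D Ch.

Lemma evH x : ev rH x = - co x Ch.
Proof. by rewrite /rowv big_cons big_nil /=; lra. Qed.
Lemma evT b x : ev (rT b) x = - dT x b.
Proof. by rewrite /rowv !big_cons big_nil /dT; case: b => /=; lra. Qed.
Lemma evG1 s x : ev (rG1 s) x = sgr s * co x Cg.
Proof. by rewrite /rowv !big_cons big_nil /sgr; case: s => /=; lra. Qed.
Lemma evG2 s x : ev (rG2 s) x = sgr s * co x Cg + 4 * co x Ch.
Proof. by rewrite /rowv !big_cons big_nil /sgr; case: s => /=; lra. Qed.
Lemma evG3 s x : ev (rG3 s) x = sgr s * co x Cg + 12 * co x Ch.
Proof. by rewrite /rowv !big_cons big_nil /sgr; case: s => /=; lra. Qed.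
Lemma evG4 b s x : ev (rG4 b s) x =
  sgr s * co x Cg - 48 * (if b then - co x Ct else co x Ct).
Proof. by rewrite /rowv !big_cons big_nil /sgr; case: s; case: b => /=; lra. Qed.
Lemma evY v b s x : ev (rY v b s) x = sgr s * co x (Cy v) - dT x b.
Proof. by rewrite /rowv !big_cons big_nil /dT /sgr; case: s; case: b => /=; lra. Qed.
Lemma evZr v k b s s' x : ev (rZ v k b s s') x =
  sgr s' * co x (Cz v) - Kr k * (dT x b + sgr s * co x (Cy v)) + 2 * tr k * co x Ch.
Proof.
rewrite /rowv !big_cons big_nil /dT /sgr /Kr /tr /kk /tk /=.
rewrite !(rmorphM, rmorphD, rmorphN) /= -!pmulrn.
by case: s; case: s'; case: b => /=; ring.
Qed.
Lemma evC cl b x : ev (rC cl b) x = lits cl x - dT x b.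
Proof.
rewrite /rowv big_cat !big_cons big_nil big_map /dT /lits /=.
rewrite (eq_bigr (fun l => if l.1 then - co x (Cy l.2) else co x (Cy l.2))).
  by case: b => /=; lra.
by move=> [[] v] _ /=; lra.
Qed.

(* [slack r x] is an affine function of [x] whose linear part is [- ev r]. *)
Definition slack (r : row coord) x : R := r.2%:~R - ev r x.
Lemma tightE r x : tightr x r = (slack r x == 0).
Proof. by rewrite /tight_row /slack subr_eq0 eq_sym. Qed.

Let b01 (b : bool) : ((b : nat)%:Z)%:~R = (if b then 1 else 0) :> R.
Proof. by case: b. Qed.

Lemma slH x : slack rH x = co x Ch.
Proof. by rewrite /slack evH /=; lra. Qed.
Lemma slT b x : slack (rT b) x = Tb x b.
Proof. by rewrite /slack evT /= b01 /Tb /tdist /dT; case: b; lra. Qed.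
Lemma slG1 s x : slack (rG1 s) x = 2 - sgr s * co x Cg.
Proof. by rewrite /slack evG1. Qed.
Lemma slG2 s x : slack (rG2 s) x = 3 - 4 * co x Ch - sgr s * co x Cg.
Proof. by rewrite /slack evG2 /=; lra. Qed.
Lemma slG3 s x : slack (rG3 s) x = 6 - 12 * co x Ch - sgr s * co x Cg.
Proof. by rewrite /slack evG3 /=; lra. Qed.
Lemma slG4 b s x : slack (rG4 b s) x = 48 * tdist x b - sgr s * co x Cg.
Proof. by rewrite /slack evG4 /= rmorphM /= b01 /tdist; case: b; lra. Qed.
Lemma slY v b s x : slack (rY v b s) x = Tb x b - sgr s * co x (Cy v).
Proof. by rewrite /slack evY /= b01 /Tb /tdist /dT; case: b; lra. Qed.
Lemma slZ v k b s s' x : slack (rZ v k b s s') x =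
  Kr k * (Tb x b + sgr s * co x (Cy v)) + tr k * (1 - 2 * co x Ch) - sgr s' * co x (Cz v).
Proof.
rewrite /slack evZr /= rmorphD rmorphM /= b01 /Tb /tdist /dT /Kr /tr /kk /tk -!pmulrn.
set A := _%:R; set B := _%:R.
by case: b; ring.
Qed.
Lemma slC cl b x : slack (rC cl b) x = Tb x b - lits cl x.
Proof. by rewrite /slack evC /= b01 /Tb /tdist /dT; case: b; lra. Qed.

Lemma ev_sub r x X : ev r (X - x) = slack r x - slack r X.
Proof. by rewrite /slack evD evN; ring. Qed.

Lemma slack_mid r (l : R) x X :
  slack r ((1 - l) *: x + l *: X) = (1 - l) * slack r x + l * slack r X.
Proof. by rewrite /slack evD !evZ; ring. Qed.

Definition slackE := (slH, slT, slG1, slG2, slG3, slG4, slY, slZ, slC).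
Definition evE := (evH, evT, evG1, evG2, evG3, evG4, evY, evZr, evC).

Lemma in_spindle x : P x <-> {in sp_rows, forall r, 0 <= slack r x}.
Proof.
rewrite in_sys; split=> H r rin; have := H r rin; by rewrite /slack subr_ge0.
Qed.

Hypothesis uvs : uniq vs.

Let ucols : uniq sp_cols.
Proof.
rewrite /sp_cols cat_uniq /=; apply/andP; split; last first.
  elim: vs uvs => //= v l IH /andP[nv /IH ->].
  have nin b : (inr (b, v) : coord) \notin flatten [seq [:: Cy w; Cz w] | w <- l].
    apply/flatten_mapP => -[w wl]; rewrite !inE => /orP[]/eqP[_ E];
    by rewrite E wl in nv.
  by rewrite inE negb_or !nin.
rewrite -all_predC; apply/allP => c /flatten_mapP[v _].
by rewrite !inE => /orP[]/eqP->.
Qed.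

Let inCt : Ct \in sp_cols. Proof. by []. Qed.
Let inCh : Ch \in sp_cols. Proof. by []. Qed.
Let inCg : Cg \in sp_cols. Proof. by []. Qed.
Let inCy v : v \in vs -> Cy v \in sp_cols.
Proof. by move=> vin; rewrite mem_cat; apply/orP; right; apply/flatten_mapP; exists v; rewrite ?inE ?eqxx. Qed.
Let inCz v : v \in vs -> Cz v \in sp_cols.
Proof. by move=> vin; rewrite mem_cat; apply/orP; right; apply/flatten_mapP; exists v; rewrite ?inE ?eqxx ?orbT. Qed.

Lemma pt_ext x X : co x Ct = co X Ct -> co x Ch = co X Ch -> co x Cg = co X Cg ->
  (forall v, v \in vs -> co x (Cy v) = co X (Cy v) /\ co x (Cz v) = co X (Cz v)) -> x = X.
Proof.
move=> E1 E2 E3 E4; apply: (co_ext (c0 := Ct) ucols) => c; rewrite mem_cat => /orP[].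
  by rewrite !inE => /or3P[] /eqP ->.
by move=> /flatten_mapP[v /E4[Ey Ez]]; rewrite !inE => /orP[]/eqP->.
Qed.

Lemma pt_eq0 D : co D Ct = 0 -> co D Ch = 0 -> co D Cg = 0 ->
  (forall v, v \in vs -> co D (Cy v) = 0 /\ co D (Cz v) = 0) -> D = 0.
Proof. by move=> *; apply: pt_ext; rewrite ?co0 // => v; rewrite !co0; auto. Qed.

Definition unit_pt (c : coord) : pt := mk Ct sp_cols (fun c' => (c' == c)%:R : R).

Lemma co_unit c c' : c \in sp_cols -> co (unit_pt c) c' = (c' == c)%:R.
Proof.
move=> cin; have [c'in|nc'] := boolP (c' \in sp_cols); first by rewrite co_mk.
by rewrite co_out //; case: eqP nc' => // ->; rewrite cin.
Qed.

Definition tip (b : bool) : pt := locked ((b : nat)%:R *: unit_pt Ct).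
Definition hub : pt := locked (2^-1 *: (unit_pt Ct + unit_pt Ch)).
Notation eG := (unit_pt Cg).

Lemma coU : ((co (unit_pt Ct) Ct = 1) * (co (unit_pt Ct) Ch = 0) * (co (unit_pt Ct) Cg = 0)) *
  ((co (unit_pt Ch) Ct = 0) * (co (unit_pt Ch) Ch = 1) * (co (unit_pt Ch) Cg = 0)) *
  ((co (unit_pt Cg) Ct = 0) * (co (unit_pt Cg) Ch = 0) * (co (unit_pt Cg) Cg = 1)).
Proof. by rewrite !co_unit. Qed.

Lemma coUv v : ((co (unit_pt Ct) (Cy v) = 0) * (co (unit_pt Ct) (Cz v) = 0)) *
  ((co (unit_pt Ch) (Cy v) = 0) * (co (unit_pt Ch) (Cz v) = 0)) *
  ((co (unit_pt Cg) (Cy v) = 0) * (co (unit_pt Cg) (Cz v) = 0)).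
Proof. by rewrite !co_unit. Qed.

Lemma vertexE x D : is_vertex P x ->
  {in sp_rows, forall r, slack r x = 0 -> ev r D = 0} -> D = 0.
Proof.
move=> vx H; have Px := vertex_in vx.
apply: ((sys_vertexP Px).1 vx) => r rin; rewrite tightE => /eqP.
exact: H.
Qed.

Lemma vertexI x : P x ->
  (forall D, {in sp_rows, forall r, slack r x = 0 -> ev r D = 0} -> D = 0) -> is_vertex P x.
Proof.
move=> Px H; apply: (sys_vertexP Px).2 => D HD; apply: H => r rin sl.
by apply: HD => //; rewrite tightE sl.
Qed.

Lemma adjE x X D : adjacent P x X ->
  {in sp_rows, forall r, slack r x = 0 -> slack r X = 0 -> ev r D = 0} ->
  exists k : R, D = k *: (X - x).
Proof.
move=> xX H; apply: (sys_adjacentE xX) => r rin; rewrite !tightE => /eqP sx /eqP.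
exact: H.
Qed.

(* It suffices to kill a direction [D] after subtracting a multiple of [X - x]. *)
Lemma adjI x X : is_vertex P x -> is_vertex P X -> x != X ->
  (forall D, {in sp_rows, forall r, slack r x = 0 -> slack r X = 0 -> ev r D = 0} ->
     exists k : R, D - k *: (X - x) = 0) ->
  adjacent P x X.
Proof.
move=> vx vX nxX H; apply: sys_adjacentI => // D HD.
have [|k] := H D; first by move=> r rin /eqP sx /eqP sX; apply: HD; rewrite ?tightE.
by move=> /eqP; rewrite subr_eq0 => /eqP ->; exists k.
Qed.

Lemma adj_sym x X : adjacent P x X -> adjacent P X x.
Proof. by case=> vx vX n [F [h1 h2 h3 h4]]; split=> //; [exact: nesym|exists F; split]. Qed.

Lemma coHub : ((co hub Ct = 2^-1) * (co hub Ch = 2^-1) * (co hub Cg = 0)) *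
  ((forall v, co hub (Cy v) = 0) * (forall v, co hub (Cz v) = 0)).
Proof.
by rewrite /hub -lock; do !split=> *; rewrite !coE ?coU ?coUv; lra.
Qed.

Lemma coTip b : ((co (tip b) Ct = (b : nat)%:R) * (co (tip b) Ch = 0) * (co (tip b) Cg = 0)) *
  ((forall v, co (tip b) (Cy v) = 0) * (forall v, co (tip b) (Cz v) = 0)).
Proof.
by rewrite /tip -lock; do !split=> *; rewrite ?coE ?coU ?coUv; lra.
Qed.

Lemma lits0 cl x : (forall v, co x (Cy v) = 0) -> lits cl x = 0.
Proof. by move=> H; rewrite /lits big1 // => l _; rewrite H oppr0 if_same. Qed.

Lemma tipT b b' : Tb (tip b) b' = (b != b')%:R.
Proof. by rewrite /Tb /tdist !coTip; case: b; case: b' => /=; lra. Qed.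

Lemma pi_hub : {in pi_rows, forall r, slack r hub = 0}.
Proof.
have hT b : Tb hub b = 0 by rewrite /Tb /tdist !coHub; case: b; lra.
apply/pi_rowsP; split=> [b|v vin|cl clin b]; first by rewrite slT.
  by split=> [b s|k b s s' _]; rewrite slackE hT !coHub; lra.
by rewrite slC hT lits0 ?subr0 // => v; rewrite coHub.
Qed.

Lemma pi_eG : {in pi_rows, forall r, ev r eG = 0}.
Proof.
have hT b : dT eG b = 0 by rewrite /dT !coU; case: b; lra.
apply/pi_rowsP; split=> [b|v vin|cl clin b]; first by rewrite evT hT oppr0.
  by split=> [b s|k b s s' _]; rewrite evE hT !coUv ?coU; lra.
by rewrite evC hT lits0 ?subr0 // => v; rewrite coUv.
Qed.

Lemma in_spindleP x : P x <->
  [/\ 0 <= co x Ch, forall b, 0 <= Tb x b,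
      forall s, [/\ sgr s * co x Cg <= 2, sgr s * co x Cg <= 3 - 4 * co x Ch,
          sgr s * co x Cg <= 6 - 12 * co x Ch & forall b, sgr s * co x Cg <= 48 * tdist x b],
      forall v, v \in vs -> (forall b s, sgr s * co x (Cy v) <= Tb x b) /\
        forall k b s s', (k < 4)%N -> sgr s' * co x (Cz v) <=
          Kr k * (Tb x b + sgr s * co x (Cy v)) + tr k * (1 - 2 * co x Ch)
    & forall cl, cl \in cls -> forall b, lits cl x <= Tb x b].
Proof.
rewrite in_spindle sp_rowsP pi_rowsP.
split=> [[[HT HV HC] [HH HG]]|[HH HT HG HV HC]].
  split.
  - by rewrite -slH.
  - by move=> b; rewrite -slT.
  - move=> s; have [G1 G2 G3 G4] := HG s.
    split=> [|||b]; rewrite -subr_ge0.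
    + by rewrite -slG1. + by rewrite -slG2. + by rewrite -slG3. + by rewrite -slG4.
  - move=> v vin; have [Y Z] := HV v vin; split=> [b s|k b s s' k4]; rewrite -subr_ge0.
    + by rewrite -slY. + by rewrite -slZ Z.
  - by move=> cl clin b; rewrite -subr_ge0 -slC; apply: HC.
split; first split.
- by move=> b; rewrite slT.
- move=> v vin; have [Y Z] := HV v vin; split=> [b s|k b s s' k4]; rewrite slackE subr_ge0 //.
  exact: Z.
- by move=> cl clin b; rewrite slC subr_ge0; apply: HC.
- split; first by rewrite slH.
  move=> s; have [G1 G2 G3 G4] := HG s.
  by split=> [|||b]; rewrite slackE subr_ge0.
Qed.

(* [x] is an extreme point of the base [h = 0] of the pyramid with apex [hub]. *)
Definition base_extreme x : Prop :=
  [/\ co x Ch = 0, co x Cg = 0, {in pi_rows, forall r, 0 <= slack r x} &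
      forall D, co D Ch = 0 -> co D Cg = 0 ->
        {in pi_rows, forall r, slack r x = 0 -> ev r D = 0} -> D = 0].

(** The hub has height 1/2, so [2 * h] is the fraction of the way from [x] to it at height [h]; then
    [g] is added. *)
Definition pnt x (h g : R) : pt := locked ((1 - 2 * h) *: x + (2 * h) *: hub + g *: eG).

Lemma pnt_slack x h g : {in pi_rows, forall r, slack r (pnt x h g) = (1 - 2 * h) * slack r x}.
Proof.
move=> r rin; have := slack_mid r (2 * h) x hub; rewrite (pi_hub rin) mulr0 addr0 => <-.
by rewrite /slack /pnt -lock evD evZ (pi_eG rin) mulr0 addr0.
Qed.

Lemma coPnt x h g : co x Ch = 0 -> co x Cg = 0 ->
  (co (pnt x h g) Ct = (1 - 2 * h) * co x Ct + h) * (co (pnt x h g) Ch = h) *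
  (co (pnt x h g) Cg = g).
Proof.
move=> xh xg; rewrite /pnt -lock !coE xh xg !coHub !coU; do !split; by lra.
Qed.

Lemma pnt_tt x h g b : co x Ch = 0 -> co x Cg = 0 ->
  tdist (pnt x h g) b = (1 - 2 * h) * tdist x b + h.
Proof. by move=> xh xg; rewrite /tdist !coPnt //; case: b; lra. Qed.

Lemma base_tt x b : base_extreme x -> 0 <= tdist x b.
Proof.
case=> xh _ /pi_rowsP[HT _ _] _; have := HT b; rewrite slT /Tb xh; lra.
Qed.

Lemma pnt_in x h g : base_extreme x -> 0 <= h -> h <= 2^-1 ->
  (forall s, [/\ sgr s * g <= 2, sgr s * g <= 3 - 4 * h,
          sgr s * g <= 6 - 12 * h & forall b, sgr s * g <= 48 * ((1 - 2 * h) * tdist x b + h)]) ->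
  P (pnt x h g).
Proof.
move=> [xh xg px _] h0 h1 HG; apply/in_spindle/sp_rowsP; split=> [r rin|].
  by rewrite pnt_slack // mulr_ge0 ?px //; lra.
split; first by rewrite slH coPnt.
move=> s; have [G1 G2 G3 G4] := HG s.
by split=> [|||b]; rewrite slackE ?pnt_tt ?coPnt // subr_ge0.
Qed.

(** Below the hub, the same rows of the cone are tight at [pnt x h g] and at [x]; extremality of [x]
    leaves only [h] and [g] to be fixed. *)
Lemma pnt_vertex x h g : base_extreme x -> h < 2^-1 -> P (pnt x h g) ->
  (forall D, {in sp_rows, forall r, slack r (pnt x h g) = 0 -> ev r D = 0} ->
     co D Ch = 0 /\ co D Cg = 0) ->
  is_vertex P (pnt x h g).
Proof.
move=> [xh xg px ex] h1 Pp H; apply: vertexI => // D HD; have [Dh Dg] := H D HD.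
apply: ex => // r rin sx; apply: (proj1 ((sp_rowsP _).1 HD)) => //.
by rewrite pnt_slack // sx mulr0.
Qed.

(** The common rows of the cone leave only directions spanned by [hub - x] and [eG], and the common
    row [r] on [g] cuts these down to a line. *)
Lemma pnt_adj r x h1 g1 h2 g2 : base_extreme x ->
  (exists s, r = rG1 s \/ r = rG2 s \/ r = rG3 s) ->
  is_vertex P (pnt x h1 g1) -> is_vertex P (pnt x h2 g2) -> h1 != h2 ->
  slack r (pnt x h1 g1) = 0 -> slack r (pnt x h2 g2) = 0 ->
  adjacent P (pnt x h1 g1) (pnt x h2 g2).
Proof.
move=> bx rs v1 v2 n12 s1 s2; have [xh xg px ex] := bx.
apply: adjI => //.
  apply: contra_neq n12 => /(congr1 (fun z => co z Ch)).
  by rewrite !coPnt.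
move=> D HD; have nz : h2 - h1 != 0 by rewrite subr_eq0 eq_sym.
exists (co D Ch / (h2 - h1)); apply: ex.
- by rewrite !coE !coPnt // divfK // subrr.
- have rin : r \in sp_rows.
    have /sp_rowsP[_ [_ /= H]] : {in sp_rows, forall r, r \in sp_rows} by [].
    by case: rs => s; have [? ? ? _] := H s; case=> [->|[->|->]].
  have ED : ev r (D - (co D Ch / (h2 - h1)) *: (pnt x h2 g2 - pnt x h1 g1)) = 0.
    by rewrite evD evN evZ ev_sub s1 s2 (HD r rin s1 s2); lra.
  have Eh : co (D - (co D Ch / (h2 - h1)) *: (pnt x h2 g2 - pnt x h1 g1)) Ch = 0.
    by rewrite !coE !coPnt // divfK // subrr.
  move: ED Eh; set D' := D - _ => ED Eh.
  case: rs ED => s [->|[->|->]]; rewrite evE ?Eh /sgr; case: s; lra.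
- move=> q qin sx; rewrite evD evN evZ ev_sub !pnt_slack // sx.
  rewrite (proj1 ((sp_rowsP (fun r => _ -> _ -> ev r D = 0)).1 HD) q qin) ?pnt_slack // ?sx; lra.
Qed.

Lemma sgr_mul s : sgr s * sgr s = 1.
Proof. by rewrite /sgr; case: s; lra. Qed.

Lemma sgr_neg s : sgr (~~ s) = - sgr s.
Proof. by rewrite /sgr; case: s => /=; lra. Qed.

Lemma ex_sgr (a : R) : exists s, sgr s * a = `|a|.
Proof.
case: (ger0P a) => a0; [exists false|exists true]; rewrite /sgr; lra.
Qed.

Lemma Kr4 k : (k < 4)%N -> [\/ [/\ k = 0%N, Kr k = 48 & tr k = 0],
  [/\ k = 1%N, Kr k = 36 & tr k = 1], [/\ k = 2%N, Kr k = 24 & tr k = 3] |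
  [/\ k = 3%N, Kr k = 12 & tr k = 6]].
Proof.
rewrite /Kr /tr; case: k => [|[|[|[|//]]]] _.
- by apply: Or41. - by apply: Or42. - by apply: Or43. - by apply: Or44.
Qed.

Lemma Kr0 : Kr 0 = 48. Proof. by []. Qed.
Lemma tr0 : tr 0 = 0. Proof. by []. Qed.

Lemma tt_neg x b : tdist x (~~ b) = 1 - tdist x b.
Proof. by rewrite /tdist; case: b => /=; lra. Qed.

Lemma h_half x : P x -> co x Ch <= 2^-1.
Proof.
case/in_spindleP=> _ HT _ _ _; move: (HT false) (HT true); rewrite /Tb /tdist; lra.
Qed.

(* Close to a tip, only the rows through that tip can be tight. *)
Lemma near_tight b X : P X -> tdist X b <= 24^-1 ->
  {in pi_rows, forall r, slack r X = 0 -> slack r (tip b) = 0}.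
Proof.
move=> /in_spindleP[h0 HT HG HV HC] tX.
have Tn : Tb X (~~ b) = 1 - tdist X b - co X Ch by rewrite /Tb tt_neg; lra.
have Tp := HT b; have Tp' : Tb X b = tdist X b - co X Ch by [].
have tipb b' : b' = b \/ b' = ~~ b by case: (b); case: b'; auto.
have Tb0 : Tb (tip b) b = 0 by rewrite tipT eqxx.
apply/pi_rowsP; split=> [b'|v vin|cl clin b'].
- by rewrite !slT; case: (tipb b') => -> //; lra.
- have [HY HZ] := HV v vin.
  split=> [b' s|k b' s s' k4].
    rewrite !slY coTip; case: (tipb b') => ->; first by rewrite Tb0; lra.
    by have := HY b s; lra.
  rewrite !slZ !coTip; case: (tipb b') => ->.
    (* Both signs of [y_v] bound [z_v], and T_b - |y_v| <= 1/24 - h lies strictly below the first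
       break (1 - 2h)/12. So only [k = 0] can be tight, and this row passes through the tip. *)
    rewrite Tb0; have h1 := HZ 0%N b s s' isT; have h2 := HY b s; have h3 := HY b (~~ s).
    have h4 := HZ 0%N b (~~ s) s' isT.
    rewrite sgr_neg mulNr in h3 h4; rewrite Kr0 tr0 in h1 h4.
    move: h1 h2 h3 h4; set zz := sgr s' * _; set yy := sgr s * _.
    by case: (Kr4 k4) => -[_ -> ->]; lra.
  have h1 := HZ 0%N b s s' isT; have h2 := HY b s; have h3 := HY b (~~ s).
  have h4 := HZ 0%N b (~~ s) s' isT.
  rewrite sgr_neg mulNr in h3 h4; rewrite Kr0 tr0 in h1 h4.
  move: h1 h2 h3 h4; set zz := sgr s' * _; set yy := sgr s * _.
  by case: (Kr4 k4) => -[_ -> ->]; lra.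
- rewrite !slC (@lits0 cl (tip b)); last by move=> v; rewrite coTip.
  case: (tipb b') => ->; first by rewrite Tb0; lra.
  by have := HC cl clin b; lra.
Qed.

Lemma tip_base b : base_extreme (tip b).
Proof.
split; rewrite ?coTip //.
- apply/pi_rowsP; split=> [b'|v vin|cl clin b'].
  + by rewrite slT tipT.
  + split=> [b' s|k b' s s' k4]; rewrite slackE tipT !coTip.
      by rewrite mulr0 subr0.
    by rewrite !mulr0 !subr0 addr0 mulr1 addr_ge0 ?mulr_ge0 // ler0n.
  + by rewrite slC lits0 ?subr0 ?tipT // => v; rewrite coTip.
- move=> D Dh Dg /pi_rowsP[HT HV _].
  have dTb : dT D b = 0.
    by have := HT b; rewrite slT tipT eqxx evT => /(_ erefl); lra.
  apply: pt_eq0 => //; first by move: dTb; rewrite /dT Dh; case: (b); lra.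
  move=> v vin; have [HY HZ] := HV v vin.
  have Dy : co D (Cy v) = 0.
    have := HY b false; rewrite slY tipT eqxx coTip mulr0 subr0 evY => /(_ erefl).
    by rewrite /sgr; lra.
  split=> //; have := HZ 0%N b false false isT.
  rewrite slZ tipT eqxx !coTip !mulr0 !subr0 addr0 mulr0 add0r evZr Dy dTb Dh /tr /= mul0r.
  by move=> /(_ erefl); rewrite /sgr; lra.
Qed.

Lemma tip_pnt b : tip b = pnt (tip b) 0 0.
Proof. by rewrite /pnt -lock !mulr0 !scale0r !addr0 subr0 scale1r. Qed.

Lemma hub_pnt x : hub = pnt x 2^-1 0.
Proof. by rewrite /pnt -lock divff ?pnatr_eq0 // subrr !scale0r scale1r add0r addr0. Qed.

Lemma tip_tt b b' : tdist (tip b) b' = (b != b')%:R.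
Proof. by have := tipT b b'; rewrite /Tb coTip; lra. Qed.

Lemma tip_vertex b : is_vertex P (tip b).
Proof.
rewrite tip_pnt; apply: pnt_vertex; first exact: tip_base.
- lra.
- apply: pnt_in; [exact: tip_base|lra|lra|move=> s; split=> [|||b']; rewrite mulr0; try lra].
  by rewrite tip_tt; case: (_ == _) => /=; lra.
rewrite -tip_pnt => D /sp_rowsP[_ [HH HG]]; split.
  by move: HH; rewrite slH coTip evH => /(_ erefl); lra.
have G s : sgr s * co D Cg - 48 * (if b then - co D Ct else co D Ct) = 0.
  have [_ _ _ /(_ b)] := HG s; rewrite slG4 tip_tt eqxx coTip evG4 /=.
  by apply; lra.
by have := G false; have := G true; rewrite /sgr; lra.
Qed.

Lemma hub_in : P hub.
Proof.
rewrite (hub_pnt (tip false)); apply: pnt_in; [exact: tip_base|lra|lra|].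
by move=> s; split=> [|||b']; rewrite mulr0; lra.
Qed.

Lemma hub_vertex : is_vertex P hub.
Proof.
apply: vertexI; first exact: hub_in.
move=> D /sp_rowsP[Hpi [HH HG]].
have {}Hpi : {in pi_rows, forall r, ev r D = 0} by move=> r rin; apply: Hpi => //; apply: pi_hub.
have /pi_rowsP[HT HV _] := Hpi.
have dTD b : dT D b = 0 by have := HT b; rewrite evT; lra.
have := dTD false; have := dTD true; rewrite {1 2}/dT => d1 d2.
have Dt : co D Ct = 0 by lra.
have Dh : co D Ch = 0 by lra.
apply: pt_eq0 => //.
  have [_ _ + _] := HG false; rewrite slG3 !coHub evG3 Dh /sgr.
  by fire; lra.
move=> v vin; have [HY HZ] := HV v vin.
have Dy : co D (Cy v) = 0.
  by have := HY false false; rewrite evY dTD /sgr; lra.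
by split=> //; have := HZ 0%N false false false isT; rewrite evZr Dy dTD Dh /sgr; lra.
Qed.

(** On the segment from the tip to the hub, the place where the rows [rG4] and [rG1] meet. *)
Definition near b s : pt := pnt (tip b) 24^-1 (2 * sgr s).

Lemma sgr2 s s' : sgr s * (2 * sgr s') = if s == s' then 2 else -2.
Proof. by rewrite /sgr; case: s; case: s' => /=; lra. Qed.

Lemma near_vertex b s : is_vertex P (near b s).
Proof.
have bt := tip_base b; have [th tg _ _] := bt.
apply: pnt_vertex => //; first lra.
  apply: pnt_in => //; try lra.
  by move=> s'; split=> [|||b']; rewrite sgr2 ?tip_tt; case: (s' == s); try lra; case: (b == b') => /=; lra.
move=> D /sp_rowsP[/pi_rowsP[HT _ _] [HH HG]].
have [G1 _ _ G4] := HG s.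
have Dg : co D Cg = 0.
  move: G1; rewrite slG1 coPnt // sgr2 eqxx evG1 subrr => /(_ erefl).
  by rewrite /sgr; case: (s); lra.
have Dt : (if b then - co D Ct else co D Ct) = 0.
  move: (G4 b); rewrite slG4 pnt_tt // tip_tt eqxx coPnt // sgr2 eqxx evG4 Dg mulr0.
  by fire; case: (b); lra.
split=> //; have := HT b; rewrite slT /Tb pnt_tt // coPnt // tip_tt eqxx evT /dT Dt /=.
by fire; case: (b); lra.
Qed.

(** At h = 1/4 the rows [rG1] and [rG2] are both tight and fix [h] and [g]; at h = 3/8 this is done
    by [rG2] and [rG3]. *)
Lemma quarter_vertex x s : base_extreme x -> is_vertex P (pnt x 4^-1 (2 * sgr s)).
Proof.
move=> bx; have [th tg _ _] := bx.
apply: pnt_vertex => //; first lra.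
  apply: pnt_in => //; try lra.
  by move=> s'; split=> [|||b']; rewrite sgr2; case: (s' == s); try lra; have := base_tt b' bx; lra.
move=> D /sp_rowsP[_ [_ HG]]; have [G1 G2 _ _] := HG s.
have Dg : co D Cg = 0.
  move: G1; rewrite slG1 coPnt // sgr2 eqxx evG1 subrr => /(_ erefl).
  by rewrite /sgr; case: (s); lra.
split=> //; move: G2; rewrite slG2 !coPnt // sgr2 eqxx evG2 Dg mulr0.
by fire; lra.
Qed.

Lemma threeeighth_vertex x s : base_extreme x -> is_vertex P (pnt x (3 / 8) (3 / 2 * sgr s)).
Proof.
move=> bx; have [th tg _ _] := bx.
have sg s1 s2 : sgr s1 * (3 / 2 * sgr s2) = if s1 == s2 then 3 / 2 else - 3 / 2.
  by rewrite /sgr; case: s1; case: s2 => /=; lra.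
apply: pnt_vertex => //; first lra.
  apply: pnt_in => //; try lra.
  by move=> s'; split=> [|||b']; rewrite sg; case: (s' == s); try lra; have := base_tt b' bx; lra.
move=> D /sp_rowsP[_ [_ HG]]; have [_ G2 G3 _] := HG s.
move: G2; rewrite slG2 !coPnt // sg eqxx evG2; fire => E2.
move: G3; rewrite slG3 !coPnt // sg eqxx evG3; fire => E3.
by move: E2 E3; rewrite /sgr; case: (s); split; lra.
Qed.

(** * Classification of the vertices *)

Lemma coPntv x h g v : (co (pnt x h g) (Cy v) = (1 - 2 * h) * co x (Cy v)) *
  (co (pnt x h g) (Cz v) = (1 - 2 * h) * co x (Cz v)).
Proof. by rewrite /pnt -lock !coE !coHub !coUv; split; lra. Qed.

(** So close to the tip, |g| <= 48 [tdist X b] < 2 excludes [rG1], [rG2] and [rG3]; all rows tight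
    at [X] pass through the tip, and rigidity of [X] applies to [X - tip b]. *)
Lemma classify_tip b X : is_vertex P X -> tdist X b < 24^-1 -> X = tip b.
Proof.
move=> vX tX; have PX := vertex_in vX; have /in_spindleP[h0 HT HG _ _] := PX.
have hX : co X Ch <= tdist X b by have := HT b; rewrite /Tb; lra.
apply/eqP; rewrite -subr_eq0; apply/eqP/(vertexE vX)/sp_rowsP; split=> [r rin sX|].
  by rewrite ev_sub sX (near_tight PX (ltW tX) rin sX) subrr.
split; first by rewrite slH evH !coE !coTip; lra.
move=> s; have [G1 G2 G3 G4] := HG s; have G4b := G4 b.
split=> [E|E|E|b' E].
- by exfalso; move: E; rewrite slG1; lra.
- by exfalso; move: E; rewrite slG2; lra.
- by exfalso; move: E; rewrite slG3; lra.
- have [Eb|nb] := eqVneq b' b.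
    by rewrite ev_sub E Eb slG4 tip_tt eqxx coTip /=; lra.
  have Eb : b' = ~~ b by case: (b) nb; case: (b').
  by exfalso; move: E; rewrite slG4 Eb tt_neg; lra.
Qed.

(** If no row on [g] were tight, [X] could move along [eG]. *)
Lemma vertex_height X : is_vertex P X -> exists s, [\/ slack (rG1 s) X = 0,
  slack (rG2 s) X = 0, slack (rG3 s) X = 0 | exists b, slack (rG4 b s) X = 0].
Proof.
move=> vX; apply: contrapT => N.
have : eG = 0.
  apply: (vertexE vX); apply/sp_rowsP; split=> [r rin _|]; first exact: pi_eG.
  split; first by rewrite evH coU oppr0.
  by move=> s; split=> [E|E|E|b E]; exfalso; apply: N; exists s;
    [apply: Or41|apply: Or42|apply: Or43|apply: Or44; exists b].
by move/(congr1 (fun x => co x Cg)); rewrite coU co0; lra.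
Qed.

Lemma sgr_inj s (g k : R) : sgr s * g = k -> g = k * sgr s.
Proof. by rewrite /sgr; case: s; lra. Qed.

Lemma classify_near b X : is_vertex P X -> tdist X b = 24^-1 ->
  exists s, co X Cg = 2 * sgr s /\ (co X Ch = 0 \/ X = near b s).
Proof.
move=> vX tX; have PX := vertex_in vX; have /in_spindleP[h0 HT HG HV _] := PX.
have hX : co X Ch <= tdist X b by have := HT b; rewrite /Tb; lra.
have [s Hs] := vertex_height vX; have [G1 G2 G3 G4] := HG s.
have Eg : co X Cg = 2 * sgr s.
  apply: sgr_inj; move: Hs; rewrite slG1 slG2 slG3 => -[|||[b']]; try lra.
  rewrite slG4; have [->|nb] := eqVneq b' b; first by rewrite tX; lra.
  have -> : b' = ~~ b by case: (b) nb; case: (b').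
  by rewrite tt_neg; lra.
exists s; split=> //; have [Eh|nh] := eqVneq (co X Ch) 0; [by left|right].
have [h hE] : exists h, h = co X Ch by exists (co X Ch).
(* Up to the factor [h], this leads to [X], with its [g] removed, from the point with the same [t]
   on the segment from the tip to the hub. For [h] nonzero, no row tight at [X] changes along [D],
   so [D] vanishes; its height -h ([tdist X b] - h) then gives h = [tdist X b]. *)
have [D DE] : exists D, D = h *: (X - tip b - co X Cg *: eG - (2 * h) *: (hub - tip b))
          - ((tdist X b - h) * 2 * h) *: (hub - tip b) by eexists.
have Dg : co D Cg = 0 by rewrite DE !coE !coHub !coTip !coU; ring.
have Dt : co D Ct = 0.
  by rewrite DE !coE !coHub !coTip !coU /tdist; case: (b) => /=; field.
have Dh : co D Ch = - (h * (tdist X b - h)).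
  by rewrite DE !coE !coHub !coTip !coU -hE; field.
have evDr r : ev r D = h * (ev r (X - tip b) - co X Cg * ev r eG - 2 * h * ev r (hub - tip b))
    - (tdist X b - h) * 2 * h * ev r (hub - tip b) by rewrite DE !(evD, evN, evZ).
clear DE.
have D0 : D = 0.
  apply: (vertexE vX); apply/sp_rowsP; split=> [r rin sX|].
    rewrite evDr (pi_eG rin) !ev_sub sX (pi_hub rin) (near_tight PX _ rin sX) ?tX //.
    by ring.
  split; first by rewrite slH => E; rewrite E eqxx in nh.
  move=> s'; have [G1' G2' G3' G4'] := HG s'.
  split=> [E|E|E|b' E].
  - by rewrite evG1 Dg mulr0.
  - by exfalso; move: E; rewrite slG2; lra.
  - by exfalso; move: E; rewrite slG3; lra.
  - by rewrite evG4 Dg Dt oppr0 if_same !mulr0 subr0.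
have Eh : co X Ch = tdist X b.
  have /eqP : h * (tdist X b - h) = 0.
    by apply/eqP; rewrite -oppr_eq0 -Dh D0 co0.
  by rewrite mulf_eq0 hE (negbTE nh) /= subr_eq0 => /eqP ->.
have Tb0 : Tb X b = 0 by rewrite /Tb Eh subrr.
have [th tg _ _] := tip_base b.
apply: pt_ext; rewrite ?coPnt // ?coTip ?Eh ?tX //.
  by move: tX; rewrite /tdist; case: (b) => /=; lra.
move=> v vin; rewrite !coPntv !coTip; have [HY HZ] := HV v vin.
have Ey : co X (Cy v) = 0.
  by move: (HY b false) (HY b true); rewrite Tb0 /sgr; lra.
split; first by rewrite Ey; lra.
by move: (HZ 0%N b false false isT) (HZ 0%N b false true isT); rewrite Tb0 Ey Kr0 tr0 /sgr; lra.
Qed.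

Lemma classify_mid X : is_vertex P X -> (forall b, 24^-1 < tdist X b) ->
  X = hub \/ exists2 x, base_extreme x & exists s,
    [\/ X = pnt x 0 (2 * sgr s), X = pnt x 4^-1 (2 * sgr s) | X = pnt x (3 / 8) (3 / 2 * sgr s)].
Proof.
move=> vX tX; have PX := vertex_in vX; have /in_spindleP[h0 HT HG HV _] := PX.
have h1 := h_half PX.
have [Eh|nh] := eqVneq (co X Ch) 2^-1; [left|right].
  have T0 b : Tb X b = 0.
    by move: (HT false) (HT true); rewrite /Tb /tdist Eh; case: b; lra.
  apply: pt_ext; rewrite ?coHub ?Eh //.
  - by move: (T0 false); rewrite /Tb /tdist Eh; lra.
  - have [_ _ Ga _] := HG false; have [_ _ Gb _] := HG true.
    by move: Ga Gb; rewrite Eh /sgr; lra.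
  - move=> v vin; have [HY HZ] := HV v vin.
    have Ey : co X (Cy v) = 0.
      by move: (HY false false) (HY false true); rewrite T0 /sgr; lra.
    rewrite !coHub; split=> //.
    by move: (HZ 0%N false false false isT) (HZ 0%N false false true isT);
       rewrite T0 Ey Kr0 tr0 /sgr; lra.
have [h hE] : exists h, h = co X Ch by exists (co X Ch).
rewrite -hE in h0 h1 nh; have {}HG s := HG s.
have u0 : 0 < 1 - 2 * h by have : h < 2^-1 by [rewrite lt_neqAle nh|]; lra.
(* The projection of [X] from the hub onto the base, with [g] removed. *)
have [x xE] : exists x, x = (1 - 2 * h)^-1 *: (X - (2 * h) *: hub - co X Cg *: eG) by eexists.
have EX : X = pnt x h (co X Cg).
  by rewrite /pnt -lock xE scalerA mulfV ?gt_eqF // scale1r addrAC subrK subrK.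
have xh : co x Ch = 0 by rewrite xE !coE !coHub !coU -hE; field; rewrite gt_eqF.
have xg : co x Cg = 0 by rewrite xE !coE !coHub !coU; field; rewrite gt_eqF.
clear xE.
have sX r : r \in pi_rows -> slack r X = (1 - 2 * h) * slack r x.
  by move=> rin; rewrite {1}EX pnt_slack.
have G4n s b : 0 < slack (rG4 b s) X.
  by have [G1 _ _ _] := HG s; rewrite slG4; have := tX b; lra.
have bx : base_extreme x.
  split=> //.
    move=> r rin; have : 0 <= slack r X.
      by apply: (proj1 ((sp_rowsP _).1 ((in_spindle X).1 PX))).
    by rewrite sX // pmulr_rge0.
  move=> D Dh Dg HD; apply: (vertexE vX); apply/sp_rowsP; split=> [r rin|].
    by rewrite sX // => /eqP; rewrite mulf_eq0 gt_eqF //= => /eqP; apply: HD.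
  split; first by rewrite evH Dh oppr0.
  move=> s; split=> [E|E|E|b E].
  - by rewrite evG1 Dg mulr0.
  - by rewrite evG2 Dg Dh !mulr0 addr0.
  - by rewrite evG3 Dg Dh !mulr0 addr0.
  - by have := G4n s b; rewrite E ltxx.
exists x => //.
have [s Hs] := vertex_height vX; exists s.
have [G1 G2 G3 _] := HG s; have [G1' G2' G3' _] := HG (~~ s); rewrite -hE in G2 G3 G2' G3'.
have [z zE] : exists z, z = sgr s * co X Cg by eexists.
rewrite -zE in G1 G2 G3.
have {}Hs : [\/ z = 2, z = 3 - 4 * h | z = 6 - 12 * h].
  case: Hs => [||| [b]].
  - by rewrite slG1 -zE => E; apply: Or31; lra.
  - by rewrite slG2 -zE -hE => E; apply: Or32; lra.
  - by rewrite slG3 -zE -hE => E; apply: Or33; lra.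
  - by move=> E; have := G4n s b; rewrite E ltxx.
have z0 : 0 < z by case: Hs => ->; lra.
have zn : sgr (~~ s) * co X Cg = - z by rewrite sgr_neg mulNr -zE.
have Eg (c : R) : z = c -> co X Cg = c * sgr s by rewrite zE; apply: sgr_inj.
(* Along [hub - x] the height grows by 1/2, so the three bounds on [g] change by 0, -2 and -6. If
   only one of them is tight and h > 0, then [X] could move along it; hence vertices above the base
   occur at the breaks only. *)
have slope (g : R) : 0 < h -> (z = 2 -> g = 0) -> (z = 3 - 4 * h -> g = - 2) ->
    (z = 6 - 12 * h -> g = - 6) -> False.
  move=> hp S1 S2 S3.
  have : hub - x + (sgr s * g) *: eG = 0.
    apply: (vertexE vX); apply/sp_rowsP; split=> [r rin|].
      rewrite sX // => /eqP; rewrite mulf_eq0 gt_eqF //= => /eqP sx.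
      by rewrite evD evZ (pi_eG rin) ev_sub sx (pi_hub rin); lra.
    split; first by rewrite slH -hE => E; rewrite E ltxx in hp.
    have gg : sgr s * (sgr s * g) = g by rewrite /sgr; case: (s); lra.
    move=> s'; have [->|ns] := eqVneq s' s; last first.
      have -> : s' = ~~ s by case: (s) ns; case: (s').
      split=> [E|E|E|b E]; exfalso; move: E; rewrite ?slG1 ?slG2 ?slG3 ?zn -?hE; try lra.
      by move=> E; have := G4n (~~ s) b; rewrite E ltxx.
    split=> [E|E|E|b E]; last by have := G4n s b; rewrite E ltxx.
    - move: E; rewrite slG1 -zE evG1 !coE !coHub !coU xg => E.
      have E' : g = 0 by apply: S1; lra.
      by move: gg; rewrite E'; lra.
    - move: E; rewrite slG2 -zE -hE evG2 !coE !coHub !coU xg xh => E.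
      have E' : g = -2 by apply: S2; lra.
      by move: gg; rewrite E'; lra.
    - move: E; rewrite slG3 -zE -hE evG3 !coE !coHub !coU xg xh => E.
      have E' : g = -6 by apply: S3; lra.
      by move: gg; rewrite E'; lra.
  move/(congr1 (fun x => co x Ch)); rewrite !coE !coHub !coU xh; lra.
have [z2|nz2] := eqVneq z 2.
  rewrite (Eg _ z2) in EX.
  have [z3|nz3] := eqVneq z (3 - 4 * h).
    by apply: Or32; rewrite {1}EX; congr pnt; lra.
  have [hz|nh0] := eqVneq h 0; first by apply: Or31; rewrite {1}EX hz.
  exfalso; apply: (slope 0) => //.
  - by rewrite lt_neqAle eq_sym nh0.
  - by move=> E; rewrite E eqxx in nz3.
  - by move=> E; exfalso; lra.
have [z3|nz3] := eqVneq z (3 - 4 * h).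
  have [z6|nz6] := eqVneq z (6 - 12 * h).
    have h38 : h = 3 / 8 by lra.
    by apply: Or33; rewrite {1}EX h38; congr pnt; apply: Eg; lra.
  exfalso; apply: (slope (-2)) => //; first by lra.
  - by move=> E; rewrite E eqxx in nz2.
  - by move=> E; rewrite E eqxx in nz6.
exfalso; apply: (slope (-6)) => //.
- by case: Hs nz2 nz3 => [->|->|E _ _]; rewrite ?eqxx //; lra.
- by move=> E; rewrite E eqxx in nz2.
- by move=> E; rewrite E eqxx in nz3.
Qed.

(** * Walks to the hub *)

Definition wk (k : nat) x X := exists2 n, (n <= k)%N & walk P n x X.

Lemma wk_refl k x : wk k x x.
Proof. by exists 0%N => //; apply: walk_nil. Qed.

Lemma wk_adj x X : adjacent P x X -> wk 1 x X.
Proof. by move=> xX; exists 1%N => //; apply: walk_cons xX (walk_nil _ _). Qed.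

Lemma walk_cat n1 n2 x y z : walk P n1 x y -> walk P n2 y z -> walk P (n1 + n2) x z.
Proof.
move=> w; elim: w z => // n u v w' uv _ IH z wz; rewrite addSn.
exact: walk_cons uv (IH _ wz).
Qed.

Lemma wk_trans k1 k2 x y z : wk k1 x y -> wk k2 y z -> wk (k1 + k2) x z.
Proof.
by move=> [n1 l1 w1] [n2 l2 w2]; exists (n1 + n2)%N; [apply: leq_add|apply: walk_cat w1 w2].
Qed.

Lemma walk_sym n x y : walk P n x y -> walk P n y x.
Proof.
elim=> {n x y} [u|n u v w uv _ IH]; first exact: walk_nil.
rewrite -addn1; apply: walk_cat IH _; apply: walk_cons (walk_nil _ _).
exact: adj_sym.
Qed.

Lemma wk_sym k x y : wk k x y -> wk k y x.
Proof. by move=> [n l w]; exists n => //; apply: walk_sym. Qed.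

Lemma wk_le k k' x y : wk k x y -> (k <= k')%N -> wk k' x y.
Proof. by move=> [n l w] h; exists n => //; apply: leq_trans h. Qed.

Lemma wk_38 x s : base_extreme x -> wk 1 (pnt x (3 / 8) (3 / 2 * sgr s)) hub.
Proof.
move=> bx; have [xh xg _ _] := bx; rewrite (hub_pnt x); apply: wk_adj.
apply: (pnt_adj (r := rG3 s)) => //.
- by exists s; right; right.
- exact: threeeighth_vertex.
- by rewrite -hub_pnt; apply: hub_vertex.
- by apply/eqP; lra.
- by rewrite slG3 !coPnt // /sgr; case: (s); lra.
- by rewrite slG3 !coPnt // /sgr; case: (s); lra.
Qed.

Lemma wk_14 x s : base_extreme x -> wk 2 (pnt x 4^-1 (2 * sgr s)) hub.
Proof.
move=> bx; have [xh xg _ _] := bx.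
apply: (wk_trans (k1 := 1) (k2 := 1)) (wk_38 s bx); apply: wk_adj.
apply: (pnt_adj (r := rG2 s)) => //.
- by exists s; right; left.
- exact: quarter_vertex.
- exact: threeeighth_vertex.
- by apply/eqP; lra.
- by rewrite slG2 !coPnt // /sgr; case: (s); lra.
- by rewrite slG2 !coPnt // /sgr; case: (s); lra.
Qed.

Lemma wk_0 x h s : base_extreme x -> is_vertex P (pnt x h (2 * sgr s)) -> h != 4^-1 ->
  wk 3 (pnt x h (2 * sgr s)) hub.
Proof.
move=> bx vx nh; have [xh xg _ _] := bx.
apply: (wk_trans (k1 := 1) (k2 := 2)) (wk_14 s bx); apply: wk_adj.
apply: (pnt_adj (r := rG1 s)) => //.
- by exists s; left.
- exact: quarter_vertex.
- by rewrite slG1 !coPnt // /sgr; case: (s); lra.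
- by rewrite slG1 !coPnt // /sgr; case: (s); lra.
Qed.

Lemma wk_near b s : wk 3 (near b s) hub.
Proof. by apply: wk_0; [apply: tip_base|apply: near_vertex|apply/eqP; lra]. Qed.

Let eq_le (a b : R) : a = b -> a <= b.
Proof. by move->. Qed.

(** All rows tight at [X] are also tight at the tip, except [rG1 s]. Giving up this single row frees
    just the direction towards the tip. *)
Lemma adj_tip b s X : is_vertex P X -> tdist X b = 24^-1 -> co X Cg = 2 * sgr s ->
  adjacent P (tip b) X.
Proof.
move=> vX tX gX; have PX := vertex_in vX; have /in_spindleP[h0 HT HG _ _] := PX.
have hX : co X Ch <= 24^-1 by have := HT b; rewrite /Tb tX; lra.
apply: adjI => //; first exact: tip_vertex.
  apply/eqP => E; move: tX; rewrite -E tip_tt eqxx /=; lra.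
move=> D /sp_rowsP[Hpi [HH H]].
exists (24 * (if b then - co D Ct else co D Ct)); apply: (vertexE vX).
have Xt : co X Ct = if b then 23 / 24 else 24^-1.
  by move: tX; rewrite /tdist; case: (b); lra.
have [D' D'E] : exists D', D' = D - (24 * (if b then - co D Ct else co D Ct)) *: (X - tip b).
  by eexists.
have evD' r : ev r D' = ev r D - 24 * (if b then - co D Ct else co D Ct) *
    (slack r (tip b) - slack r X) by rewrite D'E evD evN evZ ev_sub.
have D't : co D' Ct = 0.
  by rewrite D'E !coE coTip Xt; case: (b) => /=; field.
rewrite -D'E; clear D'E.
have G4 : ev (rG4 b s) D' = 0.
  have [_ _ _ /(_ b)] := H s; rewrite evD' !slG4 tip_tt eqxx coTip tX gX mulrCA sgr_mul /=.
  by fire; fire => ->; lra.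
have D'g : co D' Cg = 0.
  by move: G4; rewrite evG4 D't oppr0 if_same /sgr; case: (s); lra.
apply/sp_rowsP; split=> [r rin sX|].
  have st := near_tight PX (eq_le tX) rin sX.
  by rewrite evD' (Hpi r rin st sX) sX st; lra.
split.
  by rewrite slH => E; rewrite evD' !slH E coTip HH ?slH ?coTip //; lra.
move=> s'; have [G1 G2 G3 _] := HG s'; split=> [E|E|E|b' E].
- by rewrite evG1 D'g mulr0.
- by exfalso; move: E; rewrite slG2; lra.
- by exfalso; move: E; rewrite slG3; lra.
- by rewrite evG4 D'g D't oppr0 if_same !mulr0 subr0.
Qed.

(** Rows of the cone tight at [X] pass through the tip and the hub, hence through [near b s]. The
    edge gives up [rH] only, and keeps [t] and [g]. *)
Lemma adj_near b s X : is_vertex P X -> tdist X b = 24^-1 -> co X Cg = 2 * sgr s ->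
  co X Ch = 0 -> adjacent P X (near b s).
Proof.
move=> vX tX gX hX; have PX := vertex_in vX; have /in_spindleP[h0 HT HG _ _] := PX.
have [th tg _ _] := tip_base b.
apply: adjI => //; first exact: near_vertex.
  by apply/eqP => E; move: hX; rewrite E coPnt //; lra.
move=> D /sp_rowsP[Hpi [HH H]].
exists (24 * co D Ch); apply: (vertexE vX).
have Xt : co X Ct = if b then 23 / 24 else 24^-1.
  by move: tX; rewrite /tdist; case: (b); lra.
have [D' D'E] : exists D', D' = D - (24 * co D Ch) *: (near b s - X) by eexists.
have evD' r : ev r D' = ev r D - 24 * co D Ch * (slack r X - slack r (near b s)).
  by rewrite D'E evD evN evZ ev_sub.
have D'h : co D' Ch = 0 by rewrite D'E !coE coPnt // hX; field.
rewrite -D'E; clear D'E.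
have sn s' : slack (rG1 s') (near b s) = slack (rG1 s') X by rewrite !slG1 coPnt // gX.
have tn : tdist (near b s) b = 24^-1 by rewrite pnt_tt // tip_tt eqxx /=; lra.
have D'g : co D' Cg = 0.
  have [/(_ _ _) G _ _ _] := H s.
  have : ev (rG1 s) D' = 0.
    move: G; rewrite evD' sn !slG1 gX mulrCA sgr_mul.
    by fire; fire => ->; lra.
  by rewrite evG1 /sgr; case: (s); lra.
have D't : co D' Ct = 0.
  have [_ _ _ /(_ b)] := H s.
  have : ev (rG4 b s) D' = ev (rG4 b s) D.
    by rewrite evD' !slG4 tn tX coPnt // gX; lra.
  move=> <-; rewrite !slG4 tX tn coPnt // gX mulrCA sgr_mul evG4 D'g.
  by fire; fire; case: (b); lra.
apply/sp_rowsP; split=> [r rin sX|].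
  have st := near_tight PX (eq_le tX) rin sX.
  have sN : slack r (near b s) = 0 by rewrite pnt_slack // st mulr0.
  by rewrite evD' (Hpi r rin sX sN) sX sN; lra.
split; first by rewrite evH D'h oppr0.
move=> s'; split=> [E|E|E|b' E].
- by rewrite evG1 D'g mulr0.
- by rewrite evG2 D'g D'h !mulr0 addr0.
- by rewrite evG3 D'g D'h !mulr0 addr0.
- by rewrite evG4 D'g D't oppr0 if_same !mulr0 subr0.
Qed.

Lemma wk_tip_hub b : wk 4 (tip b) hub.
Proof.
apply: (wk_trans (k1 := 1) (k2 := 3)) (wk_near b false); apply: wk_adj.
have [th tg _ _] := tip_base b.
apply: (adj_tip (s := false)); first exact: near_vertex.
  by rewrite pnt_tt // tip_tt eqxx /=; lra.
by rewrite coPnt.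
Qed.

Lemma vertex_dist X : is_vertex P X -> wk 3 X hub \/ exists b, wk 4 X hub /\ wk 1 X (tip b).
Proof.
move=> vX; have [[b tX]|far] := pselect (exists b, tdist X b <= 24^-1).
  move: tX; rewrite le_eqVlt => /orP[/eqP tX|tX]; last first.
    by rewrite (classify_tip vX tX); right; exists b; split; [apply: wk_tip_hub|apply: wk_refl].
  have [s [gX [hX|->]]] := classify_near vX tX; last by left; apply: wk_near.
  right; exists b; split.
    apply: (wk_trans (k1 := 1) (k2 := 3)) (wk_near b s).
    by apply: wk_adj; apply: adj_near.
  by apply: wk_sym; apply: wk_adj; apply: adj_tip gX.
have {}far b : 24^-1 < tdist X b by rewrite ltNge; apply/negP => h; apply: far; exists b.
left; have [->|[x bx [s [E|->|->]]]] := classify_mid vX far.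
- exact: wk_refl.
- by rewrite E; apply: wk_0 => //; rewrite -?E //; apply/eqP; lra.
- by apply: wk_le (wk_14 _ _) _.
- by apply: wk_le (wk_38 _ _) _.
Qed.

(** If one end is within 3 of the hub, the walk goes through the hub, in 3 + 4 steps at most;
    otherwise it goes through the tips, in 1 + 4 + 1. *)
Lemma tips_diameter : wk 4 (tip false) (tip true) ->
  forall x X, is_vertex P x -> is_vertex P X -> wk 7 x X.
Proof.
move=> w01 x X /vertex_dist [h3|[b [h4 hb]]] /vertex_dist [h3'|[b' [h4' hb']]].
- by apply: wk_le (wk_trans h3 (wk_sym h3')) _.
- by apply: wk_le (wk_trans h3 (wk_sym h4')) _.
- by apply: wk_le (wk_trans h4 (wk_sym h3')) _.
have w : wk 4 (tip b) (tip b').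
  by case: (b); case: (b'); try exact: wk_refl; [apply: wk_sym|].
by apply: wk_le (wk_trans hb (wk_trans w (wk_sym hb'))) _.
Qed.

(* The empty clause stands for the absence of a clause. *)
Definition sat : Prop := exists alpha : V -> bool,
  {in cls, forall cl, cl != [::] -> has (fun l => alpha l.2 == l.1) cl}.

Hypothesis lits_in : {in cls, forall cl, {in cl, forall l, l.2 \in vs}}.
Hypothesis size_cls : {in cls, forall cl, cl != [::] -> size cl = 3%N}.
Hypothesis vs0 : vs != [::].

(** * A short walk from a satisfying assignment *)

Section Satisfied.
Variable alpha : V -> bool.
Hypothesis Halpha : {in cls, forall cl, cl != [::] -> has (fun l => alpha l.2 == l.1) cl}.

(** Here both T_b are 1/2, so the choice y_v = +- 1/2 makes a row [rY] tight for both [b], and with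
    z_v = 0 also rows [rZ] with [k = 0]. The point [cb b] has the same pattern at distance 1/24 from
    a tip, for one [b] only. *)
Let cpt : pt := mk Ct sp_cols (fun c => match c with
  | inl None => 2^-1 | inr (false, v) => if alpha v then 2^-1 else - 2^-1 | _ => 0 end).
Let cb (b : bool) : pt := mk Ct sp_cols (fun c => match c with
  | inl None => if b then 23 / 24 else 24^-1 | inl (Some true) => 2
  | inr (false, v) => if alpha v then 24^-1 else - 24^-1 | _ => 0 end).

Let sa v : bool := ~~ alpha v.

(** One true literal contributes -k, and the other two at most k each. *)
Let lits_half cl (k : R) x : cl \in cls -> 0 <= k ->
  (forall v, v \in vs -> co x (Cy v) = if alpha v then k else - k) -> lits cl x <= k.
Proof.
move=> clin k0 Ey; have [->|ncl] := eqVneq cl [::]; first by rewrite /lits big_nil.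
have := Halpha clin ncl; have := size_cls clin ncl; have := lits_in clin.
case: (cl) => [|l1 [|l2 [|l3 [|? ?]]]] //= lin _.
rewrite /lits !big_cons big_nil !Ey ?lin ?inE ?eqxx ?orbT //.
case: l1 l2 l3 {lin} => [b1 v1] [b2 v2] [b3 v3] /=.
by case: (alpha v1); case: b1; case: (alpha v2); case: b2; case: (alpha v3); case: b3 => //= _; lra.
Qed.

Let cpt_co : ((co cpt Ct = 2^-1) * (co cpt Ch = 0) * (co cpt Cg = 0)).
Proof. by rewrite !co_mk. Qed.
Let cpt_cov v : v \in vs ->
  (co cpt (Cy v) = if alpha v then 2^-1 else - 2^-1) * (co cpt (Cz v) = 0).
Proof. by move=> vin; rewrite !co_mk ?inCy ?inCz. Qed.
Let cb_co b : ((co (cb b) Ct = if b then 23 / 24 else 24^-1) * (co (cb b) Ch = 0) * (co (cb b) Cg = 2)).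
Proof. by rewrite !co_mk. Qed.
Let cb_cov b v : v \in vs ->
  (co (cb b) (Cy v) = if alpha v then 24^-1 else - 24^-1) * (co (cb b) (Cz v) = 0).
Proof. by move=> vin; rewrite !co_mk ?inCy ?inCz. Qed.

Let sgy v (k : R) s : sgr s * (if alpha v then k else - k) = if s == sa v then k else - k.
Proof. by rewrite /sgr /sa; case: s; case: (alpha v) => /=; lra. Qed.

Let cpt_base : base_extreme cpt.
Proof.
have T b : Tb cpt b = 2^-1 by rewrite /Tb /tdist !cpt_co; case: b; lra.
split; rewrite ?cpt_co //.
  apply/pi_rowsP; split=> [b|v vin|cl clin b].
  - by rewrite slT T; lra.
  - split=> [b s|k b s s' k4]; rewrite slackE T !(cpt_cov vin) sgy; case: (s == sa v); try lra;
    rewrite ?cpt_co; by case: (Kr4 k4) => -[_ -> ->]; lra.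
  - by rewrite slC T subr_ge0; apply: lits_half => //; [lra|move=> v vin; rewrite cpt_cov].
move=> D Dh Dg /pi_rowsP[_ HV _].
have Y v b : v \in vs -> sgr (sa v) * co D (Cy v) = dT D b.
  move=> vin; have [HY _] := HV v vin; have := HY b (sa v).
  by rewrite slY T (cpt_cov vin).1 sgy eqxx evY; fire; lra.
have Dt : co D Ct = 0.
  case: (vs) vs0 Y => // v0 vs' _ Y; have := Y v0 false; have := Y v0 true.
  by rewrite mem_head => /(_ isT) -> /(_ isT); rewrite /dT; lra.
have dT0 b : dT D b = 0 by rewrite /dT Dt Dh; case: b; lra.
apply: pt_eq0 => // v vin.
have Dy : co D (Cy v) = 0 by have := Y v false vin; rewrite dT0 /sgr; case: (sa v); lra.
split=> //; have [_ HZ] := HV v vin; have := HZ 0%N false (~~ sa v) false isT.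
rewrite slZ T !(cpt_cov vin) sgy Kr0 tr0 cpt_co (_ : (~~ sa v == sa v) = false); last by case: (sa v).
by rewrite evZr Dy dT0 Dh /sgr; fire; lra.
Qed.

Let cpt_vertex : is_vertex P (pnt cpt 0 2).
Proof.
have T b : tdist cpt b = 2^-1 by rewrite /tdist !cpt_co; case: b; lra.
have [ch cg _ _] := cpt_base.
apply: pnt_vertex; [exact: cpt_base|lra| |].
  apply: pnt_in; [exact: cpt_base|lra|lra|].
  by move=> s; split=> [|||b]; rewrite ?T /sgr; case: s; lra.
move=> D /sp_rowsP[_ [HH HG]]; split.
  by move: HH; rewrite slH coPnt // evH; fire; lra.
by have [+ _ _ _] := HG false; rewrite slG1 coPnt // evG1 /sgr; fire; lra.
Qed.

Let cb_T b b' : Tb (cb b) b' = if b == b' then 24^-1 else 23 / 24.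
Proof. by rewrite /Tb /tdist !cb_co; case: b; case: b' => /=; lra. Qed.

Let cb_tt b b' : tdist (cb b) b' = if b == b' then 24^-1 else 23 / 24.
Proof. by have := cb_T b b'; rewrite /Tb cb_co subr0. Qed.

Let cb_vertex b : is_vertex P (cb b).
Proof.
apply: vertexI.
  apply/in_spindleP; split.
  - by rewrite cb_co.
  - by move=> b'; rewrite cb_T; case: ifP; lra.
  - by move=> s; split=> [|||b']; rewrite ?cb_tt !cb_co /sgr; case: s; try case: ifP; lra.
  - move=> v vin; split=> [b' s|k b' s s' k4]; rewrite cb_T !(cb_cov _ vin) sgy.
      by case: ifP; case: ifP; lra.
    by rewrite cb_co; case: (Kr4 k4) => -[_ -> ->]; case: ifP; case: ifP; lra.
  - move=> cl clin b'; apply: (@le_trans _ _ 24^-1).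
      by apply: lits_half => //; [lra|move=> v vin; rewrite cb_cov].
    by rewrite cb_T; case: ifP; lra.
move=> D /sp_rowsP[/pi_rowsP[_ HV _] [HH HG]].
have [G1 _ _ /(_ b) G4] := HG false.
have Dh : co D Ch = 0 by move: HH; rewrite slH cb_co evH; fire; lra.
have Dg : co D Cg = 0 by move: G1; rewrite slG1 cb_co evG1 /sgr; fire; lra.
have Dt : co D Ct = 0.
  by move: G4; rewrite slG4 cb_tt eqxx cb_co evG4 Dg /sgr; fire; case: (b); lra.
have dT0 b' : dT D b' = 0 by rewrite /dT Dt Dh; case: b'; lra.
apply: pt_eq0 => // v vin; have [HY HZ] := HV v vin.
have Dy : co D (Cy v) = 0.
  have := HY b (sa v); rewrite slY cb_T eqxx (cb_cov _ vin).1 sgy eqxx evY dT0; fire.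
  by rewrite /sgr; case: (sa v); lra.
split=> //; have := HZ 0%N b (~~ sa v) false isT.
rewrite slZ cb_T eqxx !(cb_cov _ vin) sgy Kr0 tr0 cb_co (_ : (~~ sa v == sa v) = false); last by case: (sa v).
by rewrite evZr Dy dT0 Dh /sgr; fire; lra.
Qed.

(** The common rows [rH], [rG1] and, for the index [b], [rY] and [rZ] determine a direction from its
    [t] alone. *)
Let cb_adj b : adjacent P (cb b) (pnt cpt 0 2).
Proof.
have [ch cg _ _] := cpt_base.
have T b' : Tb (pnt cpt 0 2) b' = 2^-1.
  by rewrite /Tb pnt_tt // coPnt // /tdist !cpt_co; case: b'; lra.
have y v s : v \in vs -> sgr s * co (pnt cpt 0 2) (Cy v) = if s == sa v then 2^-1 else - 2^-1.
  by move=> vin; rewrite coPntv (cpt_cov vin).1 mulr0 subr0 mul1r sgy.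
apply: adjI => //.
  by apply/eqP => /(congr1 (fun x => co x Ct)); rewrite cb_co coPnt // cpt_co; case: (b); lra.
move=> D /sp_rowsP[/pi_rowsP[_ HV _] [HH HG]].
have [G1 _ _ _] := HG false.
have Dh : co D Ch = 0 by move: HH; rewrite !slH cb_co coPnt // evH; fire; fire; lra.
have Dg : co D Cg = 0 by move: G1; rewrite !slG1 cb_co coPnt // evG1 /sgr; fire; fire; lra.
exists ((if b then - (24 / 11) else 24 / 11) * co D Ct).
apply: pt_eq0 => [|||v vin].
- by rewrite !coE coPnt // cb_co cpt_co; case: (b); field.
- by rewrite !coE coPnt // cb_co Dh; ring.
- by rewrite !coE coPnt // cb_co Dg; ring.
have [HY HZ] := HV v vin.
have Dy : sgr (sa v) * co D (Cy v) = dT D b.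
  by have := HY b (sa v); rewrite !slY cb_T T y // eqxx (cb_cov _ vin).1 sgy eqxx evY; fire; fire; lra.
have Dz : co D (Cz v) = 0.
  have nn : (~~ sa v == sa v) = false by case: (sa v).
  have e1 : slack (rZ v 0 b (~~ sa v) false) (cb b) = 0.
    by rewrite slZ cb_T eqxx !(cb_cov _ vin) sgy nn Kr0 tr0; lra.
  have e2 : slack (rZ v 0 b (~~ sa v) false) (pnt cpt 0 2) = 0.
    by rewrite slZ T y // nn coPntv (cpt_cov vin).2 Kr0 tr0; lra.
  have := HZ 0%N b (~~ sa v) false isT e1 e2.
  by rewrite evZr Dh sgr_neg mulNr Dy Kr0 tr0 /sgr; lra.
have Ey : co D (Cy v) = dT D b * sgr (sa v) by apply: sgr_inj.
rewrite !coE !coPntv !(cpt_cov vin) !(cb_cov _ vin) Dz Ey /dT Dh /sgr /sa.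
by split; case: (b); case: (alpha v) => /=; field.
Qed.

Lemma wk_sat : wk 4 (tip false) (tip true).
Proof.
have a b : wk 1 (tip b) (cb b).
  apply: wk_adj; apply: (adj_tip (s := false)) => //; first by rewrite cb_tt eqxx.
  by rewrite cb_co /sgr mulr1.
have c b : wk 1 (cb b) (pnt cpt 0 2) by apply: wk_adj; apply: cb_adj.
apply: (wk_trans (k1 := 2) (k2 := 2)); first exact: (wk_trans (a false) (c false)).
by apply: wk_sym; apply: (wk_trans (a true) (c true)).
Qed.

End Satisfied.

(** * How far an edge can climb *)

Lemma adj_same c x X : adjacent P x X -> c \in sp_cols ->
  {in sp_rows, forall r, slack r x = 0 -> slack r X = 0 -> ev r (unit_pt c) = 0} ->
  forall c', c' != c -> co X c' = co x c'.
Proof.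
move=> xX cin H c' nc; have [k E] := adjE xX H.
have k0 : k != 0.
  apply/eqP => k0; move: E; rewrite k0 scale0r => /(congr1 (fun x => co x c)).
  by rewrite co_unit // eqxx co0 => /eqP; rewrite oner_eq0.
move/(congr1 (fun x => co x c')): E; rewrite co_unit // (negbTE nc) !coE => /esym/eqP.
by rewrite mulf_eq0 (negbTE k0) /= subr_eq0 => /eqP.
Qed.

(** If no row that involves [g] is tight along the edge, then [eG] survives all the common tight
    rows and must be parallel to the edge. The next lemma applies this to [z_v]. *)
Lemma adj_g x X : adjacent P x X ->
  (exists s, [\/ slack (rG1 s) x = 0 /\ slack (rG1 s) X = 0,
     slack (rG2 s) x = 0 /\ slack (rG2 s) X = 0, slack (rG3 s) x = 0 /\ slack (rG3 s) X = 0 |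
     exists b, slack (rG4 b s) x = 0 /\ slack (rG4 b s) X = 0])
  \/ (forall c, c != Cg -> co X c = co x c).
Proof.
move=> xX; apply: contrapT => /not_orP[N []].
apply: (adj_same xX) => //; apply/sp_rowsP; split=> [r rin _ _|]; first exact: pi_eG.
split; first by rewrite evH coU oppr0.
by move=> s; split=> [E E'|E E'|E E'|b E E']; exfalso; apply: N; exists s;
  [apply: Or41|apply: Or42|apply: Or43|apply: Or44; exists b].
Qed.

Lemma adj_z v x X : adjacent P x X -> v \in vs ->
  (exists k b s s', (k < 4)%N /\
     (slack (rZ v k b s s') x = 0 /\ slack (rZ v k b s s') X = 0))
  \/ (forall c, c != Cz v -> co X c = co x c).
Proof.
move=> xX vin; apply: contrapT => /not_orP[N []].
have cin : Cz v \in sp_cols by apply: inCz.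
have U : (co (unit_pt (Cz v)) Ct = 0) * (co (unit_pt (Cz v)) Ch = 0) * (co (unit_pt (Cz v)) Cg = 0).
  by rewrite !co_unit.
have Uy w : co (unit_pt (Cz v)) (Cy w) = 0 by rewrite co_unit.
have UT b : dT (unit_pt (Cz v)) b = 0 by rewrite /dT !U; case: b; lra.
apply: (adj_same xX cin); apply/sp_rowsP; split; last first.
  split; first by rewrite evH U oppr0.
  by move=> s; split=> [_ _|_ _|_ _|b _ _]; rewrite evE !U ?oppr0 ?if_same; lra.
apply/pi_rowsP; split=> [b _ _|w win|cl clin b _ _].
- by rewrite evT UT oppr0.
- split=> [b s _ _|k b s s' k4 E1 E2]; first by rewrite evY UT Uy; lra.
  rewrite evZr UT Uy U co_unit //; have [wv|nwv] := eqVneq w v.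
    by exfalso; apply: N; exists k, b, s, s'; rewrite -wv.
  have -> : (Cz w == Cz v) = false.
    by apply/negbTE; apply: contra_neq nwv => -[].
  by rewrite mulr0n; ring.
- by rewrite evC UT lits0 // subr0.
Qed.

(* A tight [z]-row realises the minimum of the piecewise linear bound on [z]. *)
Lemma zrow_min v k b s s' x : P x -> v \in vs -> (k < 4)%N -> slack (rZ v k b s s') x = 0 ->
  (forall b' t', Tb x b + sgr s * co x (Cy v) <= Tb x b' + sgr t' * co x (Cy v)) /\
  forall k', (k' < 4)%N ->
    Kr k * (Tb x b + sgr s * co x (Cy v)) + tr k * (1 - 2 * co x Ch)
    <= Kr k' * (Tb x b + sgr s * co x (Cy v)) + tr k' * (1 - 2 * co x Ch).
Proof.
move=> /in_spindleP[_ _ _ HV _] vin k4; rewrite slZ => E.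
have [_ HZ] := HV v vin; split=> [b' t'|k' k4'].
  have := HZ k b' t' s' k4; move: E; case: (Kr4 k4) => -[_ -> ->]; lra.
by have := HZ k' b s s' k4'; lra.
Qed.

(** The argument of the concave bound on [z_v], in units of 1 - 2h, is at most [c]. The values 1/12
    and 1/6 used below are its first two breaks. *)
Definition lev (c : R) x := forall v, v \in vs ->
  exists b s, Tb x b + sgr s * co x (Cy v) <= c * (1 - 2 * co x Ch).

(* The vertices at distance at most [i] of a tip lie in [Lev i]. *)
Definition Lev (i : nat) x : Prop :=
  match i with
  | 0 => exists b, x = tip b
  | 1 => exists b, tdist x b <= 24^-1
  | 2 => co x Ch <= 4^-1 /\ lev 12^-1 x
  | _ => co x Ch <= 3 / 8 /\ lev 6^-1 x
  end.

Lemma Lev1_h x : P x -> Lev 1 x -> co x Ch <= 24^-1.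
Proof. by case/in_spindleP=> _ HT _ _ _ [b tx]; have := HT b; rewrite /Tb; lra. Qed.

(** The strict inequality is what excludes the piece [k = 1] for the rows [rZ] tight at such a
    point. *)
Lemma Lev1_lev x : P x -> Lev 1 x -> lev 12^-1 x /\
  forall v, v \in vs -> exists b s, Tb x b + sgr s * co x (Cy v) < 12^-1 * (1 - 2 * co x Ch).
Proof.
move=> Px L; have hx := Lev1_h Px L; have /in_spindleP[h0 _ _ _ _] := Px; case: L => b tx.
have H v : exists b s, Tb x b + sgr s * co x (Cy v) < 12^-1 * (1 - 2 * co x Ch).
  have [s E] := ex_sgr (co x (Cy v)); exists b, (~~ s).
  by rewrite sgr_neg mulNr E /Tb; have := normr_ge0 (co x (Cy v)); lra.
split=> v _; last exact: H.
by have [b' [s /ltW ?]] := H v; exists b', s.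
Qed.

Lemma Lev_sub i x : P x -> Lev i x -> Lev 3 x.
Proof.
move=> Px; case: i => [[b ->]|[L|[|i //]]].
- split; first by rewrite coTip; lra.
  move=> v vin; exists b, false; rewrite tipT eqxx !coTip /=; lra.
- have hx := Lev1_h Px L; have [l1 _] := Lev1_lev Px L; split; first lra.
  by move=> v vin; have [b [s E]] := l1 v vin; exists b, s; lra.
- case=> hx l2; split; first lra.
  by move=> v vin; have [b [s E]] := l2 v vin; exists b, s; lra.
Qed.

(** By [adj_g] and [adj_z] the edge stays on one affine piece of the bounds on [g] and [z_v], or
    changes that coordinate alone, which affects neither the height nor [lev]. *)
Lemma Lev_adj i x X : adjacent P x X -> (i < 3)%N -> Lev i x -> Lev i.+1 X.
Proof.
move=> xX; have [vx vX _ _] := xX; have Px := vertex_in vx; have PX := vertex_in vX.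
have /in_spindleP[h0 HT HG HV _] := Px; have /in_spindleP[h0' HT' HG' HV' _] := PX.
case: i => [_ [b Ex]|[_ L|[_ [hx lx]|//]]].
- subst x; exists b; case: (adj_g xX) => [[s Hs]|same]; last first.
    by rewrite /tdist !same // !coTip; case: (b) => /=; lra.
  case: Hs; rewrite ?slG1 ?slG2 ?slG3 ?coTip; try (move=> -[E _]; lra).
  (* Of the rows on [g], only [rG4 b] is tight at the tip, and along it 48 [tdist X b] = |g| <=
     2. *)
  move=> [b' []]; rewrite !slG4 tip_tt !coTip; have [<-|nb] := eqVneq b b'; last by move=> /= E _; lra.
  by move=> _ E; have [G1 _ _ _] := HG' s; lra.
- have hx := Lev1_h Px L; have [lx lx'] := Lev1_lev Px L.
  have hX : co X Ch <= 4^-1.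
    case: (adj_g xX) => [[s Hs]|same]; last by rewrite same //; lra.
    have [G1 G2 G3 _] := HG s; have [G1' G2' G3' _] := HG' s.
    case: Hs; rewrite ?slG1 ?slG2 ?slG3; try (move=> -[E E']; lra).
    by move=> [b' []]; rewrite !slG4 => _ E; have := HT' b'; rewrite /Tb; lra.
  split=> // v vin; case: (adj_z xX vin) => [[k [b [s [s' [k4 [E E']]]]]]|same]; last first.
    have [b [s E]] := lx v vin; exists b, s; move: E.
    by rewrite /Tb /tdist !same.
  (* Below the first break, a row tight at [x] has [k = 0]. As it is tight at [X] too, it is no
     larger there than the row with [k = 1], which places [X] at or below that break. *)
  exists b, s; have [m1 m2] := zrow_min Px vin k4 E; have [_ m2'] := zrow_min PX vin k4 E'.
  have [b1 [s1 E1]] := lx' v vin; have := m1 b1 s1; have := m2 0%N isT; have := m2' 1%N isT.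
  have -> : Kr 1 = 36 by []. have -> : tr 1 = 1 by [].
  by rewrite Kr0 tr0; case: (Kr4 k4) => -[_ -> ->]; lra.
- have hX : co X Ch <= 3 / 8.
    case: (adj_g xX) => [[s Hs]|same]; last by rewrite same //; lra.
    have [G1 G2 G3 _] := HG s; have [G1' G2' G3' _] := HG' s.
    case: Hs; rewrite ?slG1 ?slG2 ?slG3; try (move=> -[E E']; lra).
    by move=> [b' []]; rewrite !slG4 => _ E; have := HT' b'; rewrite /Tb; lra.
  split=> // v vin; case: (adj_z xX vin) => [[k [b [s [s' [k4 [E E']]]]]]|same]; last first.
    have [b [s E]] := lx v vin; exists b, s; move: E.
    by rewrite /Tb /tdist !same //; case: (b); lra.
  exists b, s; have [m1 m2] := zrow_min Px vin k4 E; have [_ m2'] := zrow_min PX vin k4 E'.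
  have [b1 [s1 E1]] := lx v vin; have := m1 b1 s1; have := m2 1%N isT; have := m2' 2%N isT.
  have -> : Kr 1 = 36 by []. have -> : tr 1 = 1 by [].
  have -> : Kr 2 = 24 by []. have -> : tr 2 = 3 by [].
  by case: (Kr4 k4) => -[_ -> ->]; lra.
Qed.

(* An edge with both ends in [Lev 3] that crosses [t = 1/2] carries, at the
   crossing point, coordinates [y] far enough from 0 to be rounded to a
   satisfying assignment. *)
Lemma crossing_sat x X : adjacent P x X -> Lev 3 x -> Lev 3 X ->
  co x Ct <= 2^-1 -> 2^-1 <= co X Ct -> sat.
Proof.
move=> xX [hx lx] [hX _] tx tX; have [vx vX _ _] := xX.
have Px := vertex_in vx; have PX := vertex_in vX.
have [l [l0 l1 El]] := half_between tx tX.
have [m mE] : exists m, m = (1 - l) *: x + l *: X by eexists.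
have slm r : slack r m = (1 - l) * slack r x + l * slack r X by rewrite mE slack_mid.
have com c : co m c = (1 - l) * co x c + l * co X c by rewrite mE !coE.
clear mE.
have Pm : P m.
  apply/in_spindle => r rin; rewrite slm.
  have /in_spindle/(_ r rin) := Px; have /in_spindle/(_ r rin) := PX.
  by move=> a1 a2; rewrite addr_ge0 // mulr_ge0 //; lra.
have mt : co m Ct = 2^-1 by rewrite com.
have u0 : co m Ch <= 3 / 8 by rewrite com; nra.
have mT b : Tb m b = (1 - 2 * co m Ch) / 2 by rewrite /Tb /tdist mt; case: b; lra.
(* A smaller |y_v| would place all T_b +- y_v at (1 - 2h)/3 or more, beyond the last break 1/4,
   where only [k = 3] is tight. But [lev 6^-1 x] allows only [k <= 2] for a common row, and
   contradicts this directly if the edge moves [z_v] alone. *)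
have big v : v \in vs -> (1 - 2 * co m Ch) / 6 < `|co m (Cy v)|.
  move=> vin; rewrite ltNge; apply/negP => small.
  have sm s : - ((1 - 2 * co m Ch) / 6) <= sgr s * co m (Cy v).
    by move: small; rewrite ler_norml /sgr => /andP[]; case: s; lra.
  case: (adj_z xX vin) => [[k [b [s [s' [k4 [E E']]]]]]|same].
    have Em : slack (rZ v k b s s') m = 0 by rewrite slm E E'; lra.
    have [m1 m2] := zrow_min Px vin k4 E; have [_ m3] := zrow_min Pm vin k4 Em.
    have [b1 [s1 E1]] := lx v vin; have := m1 b1 s1; have := m2 2%N isT; have := m3 3%N isT.
    have -> : Kr 2 = 24 by []. have -> : tr 2 = 3 by [].
    have -> : Kr 3 = 12 by []. have -> : tr 3 = 6 by [].
    have := sm s; rewrite mT; case: (Kr4 k4) => -[_ -> ->]; lra.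
  have cs c : c != Cz v -> co m c = co x c by move=> nc; rewrite com same //; lra.
  have [b [s E]] := lx v vin; move: E (sm s).
  have -> : Tb x b = Tb m b by rewrite /Tb /tdist !cs.
  by rewrite mT -!cs //; lra.
exists (fun v => 0 < co m (Cy v)) => cl clin ncl; apply/negPn/negP => /hasPn N.
have /in_spindleP[_ _ _ _ /(_ cl clin false)] := Pm; rewrite mT.
(* Three false literals would add up to more than (1 - 2h)/2, the value of T_b at the crossing,
   against the row of the clause. *)
have T l' : l' \in cl -> (1 - 2 * co m Ch) / 6 < (if l'.1 then - co m (Cy l'.2) else co m (Cy l'.2)).
  move=> lin; have := big _ (lits_in clin lin); have := N _ lin.
  case: l' {lin} => [[] v] /=; case: (ltrP 0 (co m (Cy v))) => // y0 _.
    by rewrite ler0_norm.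
  by rewrite gtr0_norm.
have := size_cls clin ncl; move: T; case: (cl) => [|l1' [|l2' [|l3' [|? ?]]]] //= T _.
rewrite /lits !big_cons big_nil.
have := T l1'; have := T l2'; have := T l3'; rewrite !inE !eqxx ?orbT => /(_ isT) + /(_ isT) + /(_ isT).
move: (if l1'.1 then _ else _) (if l2'.1 then _ else _) (if l3'.1 then _ else _) => a1 a2 a3.
by lra.
Qed.

Lemma walk_Lev n x b : walk P n x (tip b) -> (n <= 3)%N -> Lev n x.
Proof.
move E : (tip b) => y w; elim: w E => {n x y} [u <- _|n u v w uv _ IH E n3]; first by exists b.
exact: Lev_adj (adj_sym uv) n3 (IH E (ltnW n3)).
Qed.

(** [i] counts the steps made from the first tip, up to 3. The walk is followed until an edge
    reaches t >= 1/2. *)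
Lemma short_walk_sat n i x : walk P n x (tip true) -> P x -> (i <= 3)%N -> Lev i x ->
  co x Ct < 2^-1 -> (n + i <= 7)%N -> sat.
Proof.
move E : (tip true) => y w; elim: w i E => {n x y} [u|n u v w uv wv IH] i E Pu i3 Li tu le7.
  by move: tu; rewrite -E coTip /=; lra.
have [_ vv _ _] := uv; have Pv := vertex_in vv.
have [j [j3 Lj le]] : exists j, [/\ (j <= 3)%N, Lev j v & (n + j <= 7)%N].
  have [ilt|ige] := ltnP i 3; first by exists i.+1; split=> //; [apply: Lev_adj uv _ _|lia].
  (* After three steps and the present one, at most three remain, so [v] is low as seen from the
     other tip. *)
  exists 3%N; split=> //; last lia.
  by apply: (@Lev_sub n) => //; apply: (@walk_Lev n v true); [rewrite E|lia].
have [tv|tv] := ltrP (co v Ct) 2^-1; first exact: (IH j).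
by apply: (crossing_sat uv) (Lev_sub Pu Li) (Lev_sub Pv Lj) (ltW tu) tv.
Qed.

Lemma spindle_diameter (D : nat) : is_diameter P D -> (D <= 7)%N <-> sat.
Proof.
move=> [[x [X [vx vX [w Hw]]]] HD]; split=> [D7|[alpha Ha]].
  have [n [[wn _] nD]] := HD _ _ (tip_vertex false) (tip_vertex true).
  apply: (@short_walk_sat n 0 (tip false)) => //.
  - exact: vertex_in (tip_vertex false).
  - by exists false.
  - by rewrite coTip /=; lra.
  - by rewrite addn0; apply: leq_trans D7.
have [k k7 wk'] := tips_diameter (wk_sat Ha) vx vX.
exact: leq_trans (Hw _ wk') k7.
Qed.

Lemma spindle_bounded : is_bounded P.
Proof.
exists 200 => x Px i; have /in_spindleP[h0 HT HG HV _] := Px; have h1 := h_half Px.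
suff H c : c \in sp_cols -> `|co x c| <= 200.
  have := H _ (mem_nth Ct (ltn_ord i)).
  by rewrite co_nth.
have t0 := HT false; have t1 := HT true; rewrite /Tb /tdist in t0 t1.
rewrite mem_cat => /orP[].
  have [G1 _ _ _] := HG false; have [G2 _ _ _] := HG true; rewrite /sgr in G1 G2.
  by rewrite !inE => /or3P[] /eqP ->; rewrite ler_norml; lra.
case/flatten_mapP=> v vin; have [HY HZ] := HV v vin.
have y1 := HY false false; have y2 := HY false true.
have z1 := HZ 0%N false false false isT; have z2 := HZ 0%N false false true isT.
rewrite Kr0 tr0 /Tb /tdist /sgr in y1 y2 z1 z2.
by rewrite !inE => /orP[] /eqP ->; rewrite ler_norml; lra.
Qed.

Lemma spindle_nonempty : (P !=set0)%classic.
Proof. by exists (tip false); apply: vertex_in (tip_vertex false). Qed.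

End Spindle.

Local Close Scope ring_scope.

(** * The encoding of sparse systems *)

Lemma bits_rec n : 0 < n -> bits n = odd n :: bits n./2.
Proof.
move=> n0; rewrite /bits up_log2S //= expn0 divn1; congr (_ :: _).
rewrite -[1]addn0 iotaDl -map_comp; apply: eq_map => i /=.
by rewrite add1n expnS divnMA divn2.
Qed.

Lemma bits_succ n : bits n.+1 = inc (bits n).
Proof.
elim: n {-2}n (leqnn n) => [|m IH] n nm.
  by case: n nm => // _; rewrite bits_rec.
rewrite bits_rec //; case: n nm => [|n] nm; first by [].
rewrite (@bits_rec n.+1) //= uphalf_half.
have E := odd_double_half n; case: (odd n) => /=.
  by rewrite add1n.
by rewrite add0n IH //; lia.
Qed.

Lemma iter_inc n : iter n inc [::] = bits n.
Proof. by elim: n => [|n IH] //=; rewrite bits_succ IH. Qed.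

Lemma size_bits_le3 n : (size (bits n) <= 3) = (n <= 7).
Proof.
rewrite size_map size_iota.
have [n7|n7] := leqP n 7.
  by apply: (@up_log_min 2 n.+1 3) => //; lia.
apply/negbTE; rewrite -ltnNge; apply: leq_trans (@leq_up_log 2 9 n.+1 _); last lia.
by rewrite (@up_log_eq 2 3 9).
Qed.

Definition code_int (z : int) : word :=
  delim ((z < 0)%R :: bits `|z|%N) ++ delim (bits 1).

Lemma encode_int (z : int) : encode_rat z%:~R = code_int z.
Proof. by rewrite /encode_rat numq_int denq_int. Qed.

Lemma flatten_allpairs T U V (g : T -> U -> seq V) s t :
  flatten [seq g x y | x <- s, y <- t] = flatten [seq flatten [seq g x y | y <- t] | x <- s].
Proof. by elim: s => //= x s <-; rewrite flatten_cat. Qed.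

Section EncodeSys.
Variables (C : eqType) (c0 : C) (cols : seq C) (rows : seq (row C)).

Lemma map_enum_nth T U (x0 : T) (s : seq T) (g : T -> U) :
  [seq g (nth x0 s (nat_of_ord i)) | i <- enum 'I_(size s)] = map g s.
Proof.
rewrite (map_comp (fun i => g (nth x0 s i)) val) val_enum_ord.
by rewrite (map_comp g (nth x0 s)) map_nth_iota0 // take_size.
Qed.

Lemma encode_sys : encode_system (sys c0 cols rows) =
  delim (bits (size rows)) ++ delim (bits (size cols)) ++
  flatten [seq flatten [seq code_int (entry_of r c) | c <- cols] | r <- rows] ++
  flatten [seq code_int r.2 | r <- rows].
Proof.
rewrite /encode_system /=; congr (_ ++ (_ ++ (_ ++ _))).
  rewrite -(map_enum_nth ([::], 0%R) rows) flatten_allpairs.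
  congr flatten; apply: eq_map => i /=.
  rewrite -(map_enum_nth c0 cols); congr flatten; apply: eq_map => j /=.
  by rewrite mxE encode_int.
rewrite -(map_enum_nth ([::], 0%R) rows); congr flatten; apply: eq_map => i.
by rewrite mxE encode_int.
Qed.

Lemma height_sys B : 0 < B ->
  {in rows, forall r, \sum_(p <- r.1) `|p.2|%N <= B /\ `|r.2|%N <= B} ->
  system_height (sys c0 cols rows) <= B.
Proof.
move=> B0 H; rewrite /system_height geq_max; apply/andP; split; apply/bigmax_leqP => i _ /=.
  apply/bigmax_leqP => j _; rewrite mxE /height numq_int denq_int geq_max B0 andbT.
  have [+ _] := H _ (mem_nth ([::], 0%R) (ltn_ord i)); apply: leq_trans.
  rewrite /entry_of; elim: (nth _ _ _).1 => [|p l IH]; first by rewrite !big_nil.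
  rewrite !big_cons; case: ifP => _; last by apply: leq_trans IH _; apply: leq_addl.
  apply: leq_trans (leq_add (leqnn _) IH).
  by move: (\sum_(_ <- _ | _) _)%R => z; lia.
rewrite mxE /height numq_int denq_int geq_max B0 andbT.
by have [] := H _ (mem_nth ([::], 0%R) (ltn_ord i)).
Qed.

End EncodeSys.

Definition grid T (S : nat) (g : nat -> nat -> seq T) : seq T :=
  flatten [seq flatten [seq g s j | j <- iota 0 S] | s <- iota 0 S].

Lemma flatten_map_flatten T U (h : T -> seq U) (ss : seq (seq T)) :
  flatten [seq h x | x <- flatten ss] = flatten [seq flatten [seq h x | x <- s] | s <- ss].
Proof. by elim: ss => //= s ss IH; rewrite map_cat flatten_cat IH. Qed.

Lemma flatten_grid T U S g (h : T -> seq U) :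
  flatten [seq h x | x <- grid S g] = grid S (fun s j => flatten [seq h x | x <- g s j]).
Proof.
rewrite /grid flatten_map_flatten -map_comp; congr flatten; apply: eq_map => s /=.
by rewrite flatten_map_flatten -map_comp.
Qed.

Lemma eq_grid T S (g g' : nat -> nat -> seq T) : (forall s j, g s j = g' s j) ->
  grid S g = grid S g'.
Proof.
by move=> E; congr flatten; apply: eq_map => s; congr flatten; apply: eq_map => j.
Qed.

Lemma gridP (T : eqType) S (g : nat -> nat -> seq T) x :
  reflect (exists s j, [/\ s < S, j < S & x \in g s j]) (x \in grid S g).
Proof.
apply: (iffP flatten_mapP) => [[s +] /flatten_mapP[j + xg]|[s [j [sS jS xg]]]].
  by rewrite !mem_iota => sS jS; exists s, j.
exists s; first by rewrite mem_iota.
by apply/flatten_mapP; exists j => //; rewrite mem_iota.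
Qed.

(** * Rows and columns relative to a time and a cell *)

Section Schema.
Variable M : machine.
Notation fact := (fact M).
Notation ref := (ref M).
Notation place := (nat * nat * fact)%type.
Variables (S : nat) (D W : word).
Notation prof := (prof S D W).

Definition all_vars : seq place := grid S (fun s j => [seq (s, j, e) | e <- enum fact]).
Definition all_clauses : seq (seq (bool * place)) :=
  grid S (fun s j => [seq clause_at S D W t s j | t <- enum (clause_kind M)]).

Definition inst_coord s j (c : coord ref) : coord place :=
  match c with inl o => inl o | inr (z, r) => inr (z, resolve s j r) end.

Definition inst_row s j (r : row (coord ref)) : row (coord place) :=
  ([seq (inst_coord s j p.1, p.2) | p <- r.1], r.2).

Definition inst_col s j (c : coord fact) : coord place :=
  match c with inl o => inl o | inr (z, e) => inr (z, (s, j, e)) end.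

Notation schema := (profile -> row (coord ref)).

(** [M] alone determines the finite lists of schemas, so a program can be unrolled over them and
    loops over times and cells only. *)
Definition base_schemas : seq schema := [seq fun=> r | r <- base_rows ref].
Definition var_schemas : seq schema :=
  flatten [seq [seq fun=> r | r <- var_rows (false, here, e)] | e <- enum fact].
Definition clause_schemas : seq schema :=
  flatten [seq [seq (fun pr => rC (tmpl t pr) b) | b <- bls] | t <- enum (clause_kind M)].

Definition base_cols : seq (coord fact) := [:: Ct _; Ch _; Cg _].
Definition var_cols : seq (coord fact) := flatten [seq [:: Cy e; Cz e] | e <- enum fact].

Lemma sp_rowsE : sp_rows all_vars all_clauses =
  [seq inst_row 0 0 (sc (prof 0 0)) | sc <- base_schemas] ++
  grid S (fun s j => [seq inst_row s j (sc (prof s j)) | sc <- var_schemas]) ++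
  grid S (fun s j => [seq inst_row s j (sc (prof s j)) | sc <- clause_schemas]).
Proof.
rewrite /sp_rows; congr (_ ++ (_ ++ _)).
- rewrite flatten_grid; apply: eq_grid => s j.
  rewrite /var_schemas map_flatten -!map_comp; congr flatten; apply: eq_map => e.
  by transitivity (var_rows (resolve s j (false, here, e))) => //; rewrite /resolve /= !addn0.
- rewrite flatten_grid; apply: eq_grid => s j.
  rewrite /clause_schemas map_flatten -!map_comp; congr flatten; apply: eq_map => t.
  by rewrite /= /cl_rows /= /inst_row /rC /= !map_cat -!map_comp.
Qed.

Lemma sp_colsE : sp_cols all_vars =
  [seq inst_col 0 0 c | c <- base_cols] ++ grid S (fun s j => [seq inst_col s j c | c <- var_cols]).
Proof.
rewrite /sp_cols flatten_grid; congr (_ ++ _); apply: eq_grid => s j.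
by rewrite /var_cols map_flatten -!map_comp.
Qed.

(* [tm b] stands for the test [s' = s + b], and [jm] similarly for the cells. *)
Definition same_coord (tm : bool -> bool) (jm : option bool -> bool)
    (p : coord ref) (c : coord fact) : bool :=
  match p, c with
  | inl a, inl b => a == b
  | inr (z, r), inr (z', e) => [&& z == z', tm r.1.1, jm r.1.2 & r.2 == e]
  | _, _ => false
  end.

Definition same_time s s' (b : bool) := s' == s + b.
Definition same_cell j j' (o : option bool) := j' == if o is Some b then j + b else 0.

Lemma inst_coord_eq s j s' j' p c :
  (inst_coord s j p == inst_col s' j' c) = same_coord (same_time s s') (same_cell j j') p c.
Proof.
case: p c => [a|[z r]] [b|[z' e]] //=.
rewrite /resolve /same_time /same_cell [s' == _]eq_sym [j' == _]eq_sym.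
by rewrite -[LHS]/((z == z') && ((_ == _) && (_ == _) && (_ == _))) -!andbA.
Qed.

Definition schema_entry tm jm (r : row (coord ref)) (c : coord fact) : int :=
  (\sum_(p <- r.1 | same_coord tm jm p.1 c) p.2)%R.

Lemma schema_entryE s j s' j' r c : entry_of (inst_row s j r) (inst_col s' j' c) =
  schema_entry (same_time s s') (same_cell j j') r c.
Proof.
by rewrite /entry_of big_map; apply: eq_bigl => p /=; rewrite inst_coord_eq.
Qed.

End Schema.

Notation tpe := 'I_13.
(* Input, delimited input, guess length, time bound, scratch, four loop counters,
   numbers of rows and columns, an empty tape, and the oracle tape. *)
Notation tX := (@Ordinal 13 0 isT).
Notation tD := (@Ordinal 13 1 isT).
Notation tW := (@Ordinal 13 2 isT).
Notation tS := (@Ordinal 13 3 isT).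
Notation tB := (@Ordinal 13 4 isT).
Notation r1 := (@Ordinal 13 5 isT).
Notation r2 := (@Ordinal 13 6 isT).
Notation c1 := (@Ordinal 13 7 isT).
Notation c2 := (@Ordinal 13 8 isT).
Notation tR := (@Ordinal 13 9 isT).
Notation tC := (@Ordinal 13 10 isT).
Notation tZ := (@Ordinal 13 11 isT).
Notation tO := (@Ordinal 13 12 isT).
Notation env13 := (tpe -> word).

Definition loop_tapes : pred tpe := mem [:: r1; r2; c1; c2].
Definition range_tapes (out : pred tpe) : pred tpe := fun u => ~~ out u && ~~ loop_tapes u.

Lemma upd_comm (h : env13) u v x y : u != v -> upd (upd h u x) v y = upd (upd h v y) u x.
Proof.
by move=> uv; apply/funext => i; rewrite /upd; case: (i =P u) => // ->; rewrite (negbTE uv).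
Qed.

Lemma upd_upd (h : env13) u x y : upd (upd h u x) u y = upd h u y.
Proof. by apply/funext => i; rewrite /upd; case: eqP. Qed.

Lemma upd_id (h : env13) u x : h u = x -> upd h u x = h.
Proof. by move=> <-; apply/funext => i; rewrite /upd; case: eqP => // ->. Qed.

Lemma look_blank (h : env13) u v sh : (look h u v sh == None) = (size (h u) <= size (h v) + sh).
Proof.
rewrite /look; case: (ltnP (size (h v) + sh) (size (h u))) => le.
  by rewrite cellw_nth.
by rewrite cellw_default.
Qed.

(** * Delimited words and polynomials *)

Definition delim_prog (u v : tpe) : prog 11 :=
  Seq (For r1 u (Case u r1 false (fun s =>
         Seq (Prim (Put v true)) (Prim (Put v (s == bit true))))))
      (Prim (Put v false)).

Lemma says_delim u v (h : env13) : u != r1 ->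
  says (Put v) (delim_prog u v) h (delim (h u)).
Proof.
move=> ur; apply: says_seq; last exact: says_prim.
rewrite (_ : flatten _ = flatten [seq [:: true; nth false (h u) k] | k <- iota 0 (size (h u))]).
  apply: says_for => k kh; rewrite /says /= /look /upd eqxx (negbTE ur) size_nseq addn0.
  by rewrite cellw_nth //; case: (nth _ _ _).
by rewrite (map_comp (fun b => [:: true; b]) (nth false (h u))) map_nth_iota0 // take_size.
Qed.

Lemma run_put (c : prog 11) u (e : word -> env13) (w : word -> word) :
  ~~ loop_tapes u -> wf loop_tapes (range_tapes (pred1 u)) (pred1 u) [::] c ->
  (forall x v, loop_tapes v -> e x v = [::]) ->
  (forall x, says (Put u) c (e x) (w x)) ->
  run (compile c) e (fun x => upd (e x) u (e x u ++ w x)).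
Proof.
move=> nu wc le sc.
rewrite (_ : (fun x => _) = (fun x => foldl (@doprim 11) (e x) (em c (e x)))).
  by apply: run_compile wc le => v lv /=; apply: contraNneq nu => <-.
by apply/funext => x; rewrite sc foldl_put.
Qed.

Lemma run_inc T (c : prog 11) u (e : word -> env13) (w : word -> seq T) :
  ~~ loop_tapes u -> wf loop_tapes (range_tapes (pred1 u)) (pred1 u) [::] c ->
  (forall x v, loop_tapes v -> e x v = [::]) -> (forall x, e x u = [::]) ->
  (forall x, says (fun=> Inc u) c (e x) (w x)) ->
  run (compile c) e (fun x => upd (e x) u (bits (size (w x)))).
Proof.
move=> nu wc le eu sc.
rewrite (_ : (fun x => _) = (fun x => foldl (@doprim 11) (e x) (em c (e x)))).
  by apply: run_compile wc le => v lv /=; apply: contraNneq nu => <-.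
by apply/funext => x; rewrite sc foldl_inc eu iter_inc.
Qed.

(** One step of Horner's scheme in unary, at the length of the input: m becomes m * |x| + k, through
    the scratch tape [tB]. *)
Definition horner_step (a : tpe) (k : nat) : code 11 :=
  Sq (compile (Seq (For r1 a (For r2 tX (Prim (Put tB true)))) (puts tB (unary k))))
  (Sq (clearc a) (Sq (compile (For r1 tB (Prim (Put a true)))) (clearc tB))).

Lemma flatten_unary (l : seq nat) n : flatten [seq unary n | _ <- l] = unary (size l * n).
Proof. by elim: l => //= _ l ->; rewrite mulSn /unary -nseqD. Qed.

Lemma says_unary v u (h : env13) c n :
  (forall k, says (Put v) c (upd h u (unary k)) (unary n)) ->
  forall r, says (Put v) (For u r c) h (unary (size (h r) * n)).
Proof.
move=> H r; rewrite -{1}(size_iota 0 (size (h r))) -flatten_unary.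
by apply: says_for => k _.
Qed.

Lemma run_horner_step a k (e : word -> env13) (m : word -> nat) :
  a \in [:: tW; tS] -> (forall x v, loop_tapes v -> e x v = [::]) ->
  (forall x, e x tB = [::]) ->
  run (horner_step a k) (fun x => upd (e x) a (unary (m x)))
    (fun x => upd (e x) a (unary (m x * size (e x tX) + k))).
Proof.
move=> aWS le eB.
have na : ~~ loop_tapes a by move: aWS; rewrite !inE => /orP[] /eqP ->.
have aB : a != tB by move: aWS; rewrite !inE => /orP[] /eqP ->.
have aX : a != tX by move: aWS; rewrite !inE => /orP[] /eqP ->.
have le' x v w : loop_tapes v -> upd (e x) a w v = [::].
  by move=> lv; rewrite /upd; case: eqP => [E|_]; [rewrite -E lv in na|apply: le].
pose n x := m x * size (e x tX) + k.
apply: (@run_sq _ _ _ _ (fun x => upd (upd (e x) a (unary (m x))) tB (unary (n x)))).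
  have := @run_put (Seq (For r1 a (For r2 tX (Prim (Put tB true)))) (puts tB (unary k)))
    tB (fun x => upd (e x) a (unary (m x))) (fun x => unary (n x)) isT.
  rewrite (_ : (fun x => upd _ tB (_ ++ _)) =
               (fun x => upd (upd (e x) a (unary (m x))) tB (unary (n x)))); last first.
    apply/funext => x; congr upd; rewrite /upd; case: eqP => [E|_]; first by rewrite -E eqxx in aB.
    by rewrite eB.
  apply=> [|x v /le' //|x].
    split; last exact: wf_puts.
    by split=> //; rewrite /range_tapes /= aB na.
  rewrite /n /unary nseqD; apply: says_seq; last exact: says_puts.
  have sa : size (upd (e x) a (unary (m x)) a) = m x by rewrite /upd eqxx size_nseq.
  rewrite -{2}sa; apply: says_unary => i.
  have sX : size (upd (upd (e x) a (unary (m x))) r1 (unary i) tX) = size (e x tX).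
    by rewrite /upd /= eq_sym (negbTE aX).
  rewrite -sX -[size (upd _ _ _ _)]muln1.
  by apply: says_unary => i'.
apply: run_sq; first exact: run_clear.
apply: (@run_sq _ _ _ _ (fun x => upd (upd (e x) a (unary (n x))) tB (unary (n x)))).
  have := @run_put (For r1 tB (Prim (Put a true))) a
    (fun x => upd (upd (upd (e x) a (unary (m x))) tB (unary (n x))) a [::])
    (fun x => unary (n x)) na.
  rewrite (_ : (fun x => upd _ a (_ ++ _)) =
               (fun x => upd (upd (e x) a (unary (n x))) tB (unary (n x)))); last first.
    apply/funext => x; rewrite upd_upd [upd _ a [::] a]/upd eqxx cat0s.
    by rewrite (upd_comm _ _ _ aB) upd_upd upd_comm // eq_sym.
  apply=> [|x v lv|x].
    by split; rewrite //= ?eqxx // /range_tapes /= eq_sym aB.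
  -    rewrite {1}/upd; case: eqP => // _; rewrite {1}/upd; case: eqP => [E|_]; first by rewrite E in lv.
    exact: le'.
  set h := upd _ a [::].
  have hB : size (h tB) * 1 = n x.
    by rewrite muln1 /h {1}/upd eq_sym (negbTE aB) /upd eqxx size_nseq.
  rewrite -hB.
  by apply: says_unary => i.
rewrite (_ : (fun x => upd (e x) a _) = (fun x =>
   upd (upd (upd (e x) a (unary (n x))) tB (unary (n x))) tB [::])); first exact: run_clear.
apply/funext => x; rewrite upd_upd [RHS]upd_id //.
by rewrite /upd eq_sym (negbTE aB) eB.
Qed.

Fixpoint horner_code (a : tpe) (l : seq nat) : code 11 :=
  if l is k :: l' then Sq (horner_code a l') (horner_step a k) else clearc a.

Lemma run_horner_code a (p : {poly nat}) (e : word -> env13) :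
  a \in [:: tW; tS] -> (forall x v, loop_tapes v -> e x v = [::]) ->
  (forall x, e x tB = [::]) ->
  run (horner_code a p) e (fun x => upd (e x) a (unary p.[size (e x tX)]%R)).
Proof.
move=> aWS le eB; rewrite /horner; elim: (polyseq p) => [|k l IH] /=.
  exact: run_clear.
by apply: run_sq IH _; apply: run_horner_step.
Qed.

(** * Printing the linear system *)

Section Print.
Variable M : machine.
Notation schema := (profile -> row (coord (ref M))).

(** The cell of one counter selected by the length of another is blank exactly if the first is not
    longer. Equality, successor and bound tests thus become tests for blanks, and the empty tape
    [tZ] gives comparisons with 0. *)
Definition probes : seq (tpe * tpe * bool) :=
  [:: (c1, r1, false); (c1, r1, true); (r1, c1, false);
      (c2, r2, false); (c2, r2, true); (r2, c2, false); (c2, tZ, false);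
      (tS, r1, true); (tS, r2, true); (r1, tZ, false); (r2, tZ, false);
      (tD, r2, false); (tW, r2, false)].

Definition blank_at (l : seq sym) i := nth None l i == None.

Definition probed_profile l : profile :=
  Profile (blank_at l 9) (~~ blank_at l 7) (blank_at l 10) (~~ blank_at l 8)
    (if nth None l 11 is Some (inl b) then Some b else None) (~~ blank_at l 12).

Definition probed_time l (b : bool) :=
  if b then ~~ blank_at l 0 && blank_at l 1 else blank_at l 0 && blank_at l 2.

Definition probed_cell l (o : option bool) :=
  match o with
  | Some true => ~~ blank_at l 3 && blank_at l 4
  | Some false => blank_at l 3 && blank_at l 5
  | None => blank_at l 6
  end.

Definition probe (h : env13) : seq sym := [seq look h a.1.1 a.1.2 a.2 | a <- probes].

Lemma probed_profileE (h : env13) : h tZ = [::] ->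
  probed_profile (probe h) = prof (size (h tS)) (h tD) (h tW) (size (h r1)) (size (h r2)).
Proof.
move=> hZ; rewrite /probed_profile /prof /blank_at /=; congr Profile.
- by rewrite look_blank hZ addn0 leqn0.
- by rewrite look_blank addn1 -ltnNge.
- by rewrite look_blank hZ addn0 leqn0.
- by rewrite look_blank addn1 -ltnNge.
- rewrite /look addn0; case: ltnP => le; first by rewrite cellw_nth.
  by rewrite cellw_default.
- by rewrite look_blank addn0 -ltnNge.
Qed.

Lemma probed_timeE (h : env13) :
  probed_time (probe h) =1 same_time (size (h r1)) (size (h c1)).
Proof.
by case; rewrite /probed_time /same_time /blank_at /= !look_blank /= ?addn0 ?addn1; lia.
Qed.

Lemma probed_cellE (h : env13) : h tZ = [::] ->
  probed_cell (probe h) =1 same_cell (size (h r2)) (size (h c2)).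
Proof.
move=> hZ; case=> [[]|]; rewrite /probed_cell /same_cell /blank_at /= !look_blank /= ?hZ /=; lia.
Qed.

Definition for_rows (g : schema -> prog 11) : prog 11 :=
  Seq (seqm (base_schemas M) g)
  (Seq (For r1 tS (For r2 tS (seqm (var_schemas M) g)))
       (For r1 tS (For r2 tS (seqm (clause_schemas M) g)))).

Definition for_cols (g : coord (fact M) -> prog 11) : prog 11 :=
  Seq (seqm (base_cols M) g) (For c1 tS (For c2 tS (seqm (var_cols M) g))).

(** Once the probed symbols are known, the coefficient is a constant: no arithmetic is done at run
    time. *)
Definition entry_prog (sc : schema) (c : coord (fact M)) : prog 11 :=
  tests probes (fun l => puts tO (code_int
    (schema_entry (probed_time l) (probed_cell l) (sc (probed_profile l)) c))).

Definition rhs_prog (sc : schema) : prog 11 :=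
  tests probes (fun l => puts tO (code_int (sc (probed_profile l)).2)).

Definition print_prog : prog 11 :=
  Seq (delim_prog tR tO) (Seq (delim_prog tC tO)
  (Seq (for_rows (fun sc => for_cols (entry_prog sc))) (for_rows rhs_prog))).

Lemma says_grid T (G : T -> prim 11) u v (c : prog 11) (h : env13) (w : nat -> nat -> seq T) :
  u != tS ->
  (forall s j, says G c (upd (upd h u (unary s)) v (unary j)) (w s j)) ->
  says G (For u tS (For v tS c)) h (grid (size (h tS)) w).
Proof.
move=> uS H; apply: says_for => s _.
have -> : size (h tS) = size (upd h u (unary s) tS) by rewrite /upd eq_sym (negbTE uS).
by apply: says_for => j _.
Qed.

Lemma says_eq T (G : T -> prim 11) c h w w' : says G c h w -> w = w' -> says G c h w'.
Proof. by move=> ? <-. Qed.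

Lemma says_rows T (G : T -> prim 11) g (h : env13) (w : row (coord _) -> seq T) S D W :
  size (h tS) = S -> h r1 = [::] -> h r2 = [::] ->
  (forall s j sc, says G (g sc) (upd (upd h r1 (unary s)) r2 (unary j))
     (w (inst_row s j (sc (prof S D W s j))))) ->
  says G (for_rows g) h
    (flatten [seq w r | r <- sp_rows (all_vars M S) (all_clauses M S D W)]).
Proof.
move=> <- h1 h2 H; rewrite sp_rowsE !map_cat !flatten_cat; apply: says_seq.
  rewrite -map_comp; apply: says_seqm => sc /=.
  by have := H 0 0 sc; rewrite (upd_id h1) (upd_id h2).
by apply: says_seq; rewrite flatten_grid; apply: says_grid => // s j;
  rewrite -map_comp; apply: says_seqm => sc; apply: H.
Qed.

Lemma says_cols T (G : T -> prim 11) g (h : env13) (w : coord _ -> seq T) S :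
  size (h tS) = S -> h c1 = [::] -> h c2 = [::] ->
  (forall s j c, says G (g c) (upd (upd h c1 (unary s)) c2 (unary j)) (w (inst_col s j c))) ->
  says G (for_cols g) h (flatten [seq w c | c <- sp_cols (all_vars M S)]).
Proof.
move=> <- h1 h2 H; rewrite sp_colsE !map_cat !flatten_cat; apply: says_seq.
  rewrite -map_comp; apply: says_seqm => c /=.
  by have := H 0 0 c; rewrite (upd_id h1) (upd_id h2).
by rewrite flatten_grid; apply: says_grid => // s j;
  rewrite -map_comp; apply: says_seqm => c; apply: H.
Qed.

Lemma says_rhs S D W (h : env13) s j sc :
  size (h tS) = S -> h tD = D -> h tW = W -> h tZ = [::] ->
  says (Put tO) (rhs_prog sc) (upd (upd h r1 (unary s)) r2 (unary j))
    (code_int (inst_row s j (sc (prof S D W s j))).2).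
Proof.
move=> <- <- <- hZ; apply: says_tests; apply: says_eq (says_puts _ _ _) _.
by rewrite -/(probe _) probed_profileE //= /upd /= !size_nseq.
Qed.

Lemma says_entry S D W (h : env13) s j s' j' sc c :
  size (h tS) = S -> h tD = D -> h tW = W -> h tZ = [::] ->
  says (Put tO) (entry_prog sc c)
    (upd (upd (upd (upd h r1 (unary s)) r2 (unary j)) c1 (unary s')) c2 (unary j'))
    (code_int (entry_of (inst_row s j (sc (prof S D W s j))) (inst_col s' j' c))).
Proof.
move=> <- <- <- hZ; apply: says_tests; apply: says_eq (says_puts _ _ _) _.
rewrite -/(probe _) probed_profileE // schema_entryE; set h' := upd _ c2 _.
have -> : probed_time (probe h') = same_time s s'.
  by apply/funext => b; rewrite probed_timeE /h' /upd /= !size_nseq.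
have -> : probed_cell (probe h') = same_cell j j'.
  by apply/funext => b; rewrite probed_cellE /h' /upd /= ?size_nseq.
by rewrite /h' /upd /= !size_nseq.
Qed.

Lemma says_print S D W (h : env13) :
  let cols := sp_cols (all_vars M S) in
  let rows := sp_rows (all_vars M S) (all_clauses M S D W) in
  size (h tS) = S -> h tD = D -> h tW = W -> h tZ = [::] ->
  h r1 = [::] -> h r2 = [::] -> h c1 = [::] -> h c2 = [::] ->
  h tR = bits (size rows) -> h tC = bits (size cols) ->
  says (Put tO) print_prog h (encode_system (spindle (all_vars M S) (all_clauses M S D W))).
Proof.
move=> cols rows hS hD hW hZ h1 h2 h3 h4 hR hC.
rewrite /spindle encode_sys -/cols -/rows -hR -hC.
apply: says_seq; first exact: says_delim.
apply: says_seq; first exact: says_delim.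
apply: says_seq; last by apply: says_rows => // s j sc; apply: says_rhs.
apply: (says_rows (w := fun r => flatten [seq code_int (entry_of r c) | c <- cols])) => // s j sc.
by apply: says_cols => // s' j' c; apply: says_entry.
Qed.

(** The encoding begins with the dimensions in binary, which are found by a dry run of the printing
    loops. *)
Definition count_rows : prog 11 := for_rows (fun=> Prim (Inc tR)).
Definition count_cols : prog 11 := for_cols (fun=> Prim (Inc tC)).

Lemma flatten_seq1 T (l : seq T) : flatten [seq [:: x] | x <- l] = l.
Proof. by elim: l => //= x l ->. Qed.

Lemma says_count_rows S D W (h : env13) : size (h tS) = S -> h r1 = [::] -> h r2 = [::] ->
  says (fun=> Inc tR) count_rows h (sp_rows (all_vars M S) (all_clauses M S D W)).
Proof.
move=> hS h1 h2; rewrite -[X in says _ _ _ X]flatten_seq1.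
by apply: says_rows => // s j sc; apply: (says_prim (fun=> Inc tR)).
Qed.

Lemma says_count_cols S (h : env13) : size (h tS) = S -> h c1 = [::] -> h c2 = [::] ->
  says (fun=> Inc tC) count_cols h (sp_cols (all_vars M S)).
Proof.
move=> hS h1 h2; rewrite -[X in says _ _ _ X]flatten_seq1.
by apply: says_cols => // s j sc; apply: (says_prim (fun=> Inc tC)).
Qed.

Lemma wf_rows out A g : ~~ out tS -> r1 \notin A -> r2 \notin A ->
  (forall A' sc, {subset A' <= [:: r1, r2 & A]} -> wf loop_tapes (range_tapes out) out A' (g sc)) ->
  wf loop_tapes (range_tapes out) out A (for_rows g).
Proof.
move=> oS A1 A2 H.
have rS : range_tapes out tS by rewrite /range_tapes oS.
have W A' l : {subset A' <= [:: r1, r2 & A]} -> wf loop_tapes (range_tapes out) out A' (seqm l g).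
  by move=> sA; apply: wf_seqm => sc; apply: H.
split; first by apply: W => u uA; rewrite !inE uA !orbT.
have G l : wf loop_tapes (range_tapes out) out A (For r1 tS (For r2 tS (seqm l g))).
  split=> //; split=> //.
  by apply: W => u; rewrite !inE => /or3P[] ->; rewrite ?orbT.
by split.
Qed.

Lemma wf_cols out A g : ~~ out tS -> c1 \notin A -> c2 \notin A ->
  (forall A' c, wf loop_tapes (range_tapes out) out A' (g c)) ->
  wf loop_tapes (range_tapes out) out A (for_cols g).
Proof.
move=> oS A1 A2 H.
have rS : range_tapes out tS by rewrite /range_tapes oS.
split; first exact: wf_seqm.
split=> //; split=> //.
exact: wf_seqm.
Qed.

Lemma wf_count_rows : wf loop_tapes (range_tapes (pred1 tR)) (pred1 tR) [::] count_rows.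
Proof. exact: wf_rows. Qed.

Lemma wf_count_cols : wf loop_tapes (range_tapes (pred1 tC)) (pred1 tC) [::] count_cols.
Proof. exact: wf_cols. Qed.

Lemma wf_print : wf loop_tapes (range_tapes (pred1 tO)) (pred1 tO) [::] print_prog.
Proof.
split; first by do ?split.
split; first by do ?split.
split.
  apply: wf_rows => // A' sc sA.
  apply: wf_cols => // [||A'' c].
  - by apply/negP => /sA.
  - by apply/negP => /sA.
  by apply: wf_tests => // l; apply: wf_puts.
by apply: wf_rows => // A' sc _; apply: wf_tests => // l; apply: wf_puts.
Qed.

End Print.

(** * The reduction *)

Lemma uniq_flatten_map (I T : eqType) (s : seq I) (g : I -> seq T) :
  uniq s -> (forall x, uniq (g x)) -> (forall x y z, z \in g x -> z \in g y -> x = y) ->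
  uniq (flatten [seq g x | x <- s]).
Proof.
move=> + ug dg; elim: s => //= x s IH /andP[xs us]; rewrite cat_uniq ug IH // andbT /=.
apply/hasPn => z /flatten_mapP[y ys zy]; apply/negP => zx.
by rewrite (dg _ _ _ zx zy) ys in xs.
Qed.

Section Spindle.
Variables (R : realType) (M : machine) (S : nat) (D W : word).
Notation vs := (all_vars M S).
Notation cls := (all_clauses M S D W).

Lemma all_varsP s j (e : fact M) : ((s, j, e) \in vs) = (s < S) && (j < S).
Proof.
apply/gridP/andP => [[s' [j' [sS jS /mapP[e' _ [-> -> _]]]]] //|[sS jS]].
by exists s, j; split=> //; apply: map_f; rewrite mem_enum.
Qed.

Lemma uniq_all_vars : uniq vs.
Proof.
apply: uniq_flatten_map => [|s|s s' x]; first exact: iota_uniq.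
  apply: uniq_flatten_map => [|j|j j' x]; first exact: iota_uniq.
    by rewrite map_inj_uniq ?enum_uniq // => e e' [].
  by move=> /mapP[e _ ->] /mapP[e' _ [-> _]].
by move=> /flatten_mapP[j _ /mapP[e _ ->]] /flatten_mapP[j' _ /mapP[e' _ [-> _ _]]].
Qed.

Lemma all_vars_neq0 : 0 < S -> vs != [::].
Proof.
move=> S0; have : (0, 0, Cell ord0 false None) \in vs by rewrite all_varsP S0.
by case: (vs).
Qed.

Lemma all_clausesP cl : cl \in cls ->
  exists t s j, [/\ s < S, j < S & cl = clause_at S D W t s j].
Proof. by move=> /gridP[s [j [sS jS /mapP[t _ ->]]]]; exists t, s, j. Qed.

Lemma all_clauses_lits : {in cls, forall cl, {in cl, forall l, l.2 \in vs}}.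
Proof.
move=> cl /all_clausesP[t [s [j [sS jS ->]]]] _ /mapP[l lt ->] /=.
have /allP/(_ _ lt)/andP[/implyP ht /implyP hc] := templates_ok t (prof S D W s j).
rewrite /resolve all_varsP; apply/andP; split.
  by case: (l.2.1.1) ht => //= h; rewrite ?addn0 // addn1 h.
case: (l.2.1.2) hc => [[]|] /= h; rewrite ?addn0 ?addn1 ?h //.
exact: leq_ltn_trans jS.
Qed.

Lemma all_clauses_size : {in cls, forall cl, cl != [::] -> size cl = 3}.
Proof.
move=> cl /all_clausesP[t [s [j [_ _ ->]]]]; rewrite -!size_eq0 /clause_at size_map.
by rewrite size_eq0; apply: templates_size.
Qed.

Lemma sat_all_clauses : sat cls <-> exists alpha, @tableau_sat M S D W alpha.
Proof.
split=> -[alpha H]; exists alpha.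
  move=> t s j sS jS n0; apply: (H _ _ n0); apply/gridP; exists s, j; split=> //.
  by apply: map_f; rewrite mem_enum.
by move=> cl /all_clausesP[t [s [j [sS jS ->]]]]; apply: H.
Qed.

(** The heaviest rows are [rZ] with [k = 0], whose coefficients have absolute values 1, 48, 48,
    48. *)
Lemma spindle_height : system_height (spindle vs cls) <= 200.
Proof.
apply: height_sys => //; apply/sp_rowsP; split; last first.
  split; first by rewrite !big_cons big_nil.
  by case; split=> [|||[]]; rewrite !big_cons big_nil.
apply/pi_rowsP; split=> [b|v _|cl clin b].
- by case: b; rewrite !big_cons big_nil.
- split=> [b s|k b s s' k4]; first by case: b s => [] []; rewrite !big_cons big_nil.
  by case: k k4 => [|[|[|[|]]]] // _; case: b; case: s; case: s'; rewrite !big_cons big_nil.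
- rewrite /rC /= big_cat big_map /=; split; last by case: b.
  rewrite (eq_bigr (fun=> 1)); last by move=> [[] v] _.
  rewrite sum1_size !big_cons big_nil.
  have [->|n0] := eqVneq cl [::]; first by case: b.
  by rewrite all_clauses_size //; case: b.
Qed.

Lemma spindle_valid :
  @valid (bounded_problem 200%:P%R (diameter_problem R)) (spindle vs cls).
Proof.
split; last by rewrite hornerC; apply: spindle_height.
split; [exact: spindle_bounded uniq_all_vars|exact: spindle_nonempty uniq_all_vars].
Qed.

Lemma tableau_diameter n : 0 < S -> is_diameter (solution_set R (spindle vs cls)) n ->
  n <= 7 <-> exists alpha, @tableau_sat M S D W alpha.
Proof.
move=> S0 dn; rewrite -sat_all_clauses.
apply: spindle_diameter dn; [exact: uniq_all_vars|exact: all_clauses_lits|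
  exact: all_clauses_size|exact: all_vars_neq0].
Qed.

End Spindle.

Lemma leq_horner (p : {poly nat}) m n : m <= n -> p.[m]%R <= p.[n]%R.
Proof.
move=> mn; rewrite /horner; elim: (polyseq p) => //= k l IH.
by apply: leq_add => //; apply: leq_mul.
Qed.

Lemma size_delim x : size (delim x) = (size x).*2.+1.
Proof. by rewrite size_cat addn1; congr _.+1; elim: x => //= b x ->; rewrite doubleS. Qed.

Lemma verdict_stable M w T T' b : T <= T' -> verdict (conf M w T).1 = Some b ->
  verdict (conf M w T').1 = Some b.
Proof.
move=> /subnK <- H; elim: (T' - T) => //= k IH; move: IH.
by rewrite /tstep /step; case: (conf _ _ _) => q ts /= H'; rewrite H'.
Qed.

Section Reduction.
Variables (R : realType) (L V : language) (pp q : {poly nat}) (M : machine).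
Hypothesis ofree : oracle_free M.
Hypothesis decV : forall x, decides_within (fun=> [::]) M q.[size x]%R x (V x).
Hypothesis LV : forall x, L x <->
  exists y : word, (size y <= pp.[size x]%R)%N /\ V (pair_word x y).

(** The length 2n + 1 of [delim x], plus that of the longest certificate. *)
Definition guess_poly : {poly nat} := ('X * 2%:P + 1 + pp)%R.
(** Large enough for the verifier to halt on each such input, and beyond the guessed cells, as
    [sat_trace] requires. *)
Definition time_poly : {poly nat} := (guess_poly + 2%:P + (q \Po guess_poly))%R.

Lemma guess_polyE n : guess_poly.[n]%R = n.*2.+1 + pp.[n]%R.
Proof. by rewrite /guess_poly !hornerE /=; lia. Qed.

Lemma time_polyE n : time_poly.[n]%R = guess_poly.[n]%R + 2 + q.[guess_poly.[n]]%R.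
Proof. by rewrite /time_poly hornerD hornerD hornerC horner_comp. Qed.

Definition time (x : word) := time_poly.[size x]%R.
Definition guess (x : word) : word := unary guess_poly.[size x]%R.

Lemma language_tableau x : L x <-> exists alpha, @tableau_sat M (time x) (delim x) (guess x) alpha.
Proof.
have sg : size (guess x) = (size x).*2.+1 + pp.[size x]%R by rewrite size_nseq guess_polyE.
have St : size (guess x) < time x by rewrite /time time_polyE size_nseq; lia.
have acc y : size (delim x) + size y <= size (guess x) ->
    verdict (conf M (delim x ++ y) (time x).-1).1 = Some true <-> V (delim x ++ y).
  move=> sy; have [b [hb Hb]] := decV (delim x ++ y).
  rewrite (verdict_stable _ hb) -?Hb; first by split=> [[]|->].
  apply: (@leq_trans q.[size (guess x)]%R); first by rewrite leq_horner // size_cat.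
  by rewrite /time time_polyE size_nseq; lia.
rewrite LV; split=> [[y [sy Vy]]|[alpha H]].
  have le : size (delim x) + size y <= size (guess x) by rewrite size_delim sg leq_add2l.
  by eexists; apply: (trace_sat ofree le); [lia|apply/acc].
have [|y sy vy] := sat_trace ofree St _ H; first by rewrite size_delim sg leq_addr.
exists y; split; first by move: sy; rewrite size_delim sg leq_add2l.
by apply/acc.
Qed.

Definition query x :=
  spindle (all_vars M (time x)) (all_clauses M (time x) (delim x) (guess x)).

Definition query_code : code 11 :=
  Sq (compile (delim_prog tX tD)) (Sq (horner_code tW guess_poly) (Sq (horner_code tS time_poly)
  (Sq (compile (count_rows M)) (Sq (compile (count_cols M)) (compile (print_prog M)))))).

Definition start_env (x : word) : env13 := fun i => if i == ord0 then x else [::].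

Lemma run_query : exists2 e : word -> env13, run query_code start_env e &
  forall x, e x ord_max = encode_system (query x).
Proof.
pose e1 x := upd (start_env x) tD (delim x).
pose e2 x := upd (e1 x) tW (guess x).
pose e3 x := upd (e2 x) tS (unary (time x)).
pose cols x := sp_cols (all_vars M (time x)).
pose rows x := sp_rows (all_vars M (time x)) (all_clauses M (time x) (delim x) (guess x)).
pose e4 x := upd (e3 x) tR (bits (size (rows x))).
pose e5 x := upd (e4 x) tC (bits (size (cols x))).
pose e6 x := upd (e5 x) tO (encode_system (query x)).
have lt (P : tpe -> Prop) : P r1 -> P r2 -> P c1 -> P c2 -> forall v, loop_tapes v -> P v.
  by move=> ? ? ? ? v; rewrite /loop_tapes !inE => /or4P[] /eqP ->.
exists e6; last by move=> x; rewrite /e6 /upd.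
apply: (@run_sq _ _ _ _ e1).
  apply: (@run_put (delim_prog tX tD) tD start_env delim) => // x.
    exact: lt.
  exact: says_delim.
apply: (@run_sq _ _ _ _ e2).
  by apply: (@run_horner_code tW guess_poly e1) => // x; apply: lt.
apply: (@run_sq _ _ _ _ e3).
  by apply: (@run_horner_code tS time_poly e2) => // x; apply: lt.
have S3 x : size (e3 x tS) = time x by rewrite /e3 /upd /= size_nseq.
apply: (@run_sq _ _ _ _ e4).
  apply: run_inc => // [|x|x]; [exact: wf_count_rows|exact: lt|].
  by apply: says_count_rows => //; apply: S3.
apply: (@run_sq _ _ _ _ e5).
  apply: run_inc => // [|x|x]; [exact: wf_count_cols|exact: lt|].
  by apply: says_count_cols => //; apply: S3.
apply: (@run_put (print_prog M) tO e5 (fun x => encode_system (query x))) => // [|x|x].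
- exact: wf_print.
- exact: lt.
by apply: says_print => //; apply: S3.
Qed.

Definition step_right : code 11 := Act (mv (pred1 ord_max) MoveR).
(** After the oracle call the head scans the first digit; three moves later it scans a blank exactly
    if the answer has at most three digits, that is, if the diameter is at most 7. *)
Definition answer_code : code 11 :=
  Sq query_code (Sq (Ask 11) (Sq step_right (Sq step_right step_right))).

(** The oracle is called once, and just three moves follow it however long the answer is; so one
    polynomial serves all [f]. *)
Lemma answer_code_decides : exists p : {poly nat}, forall f,
  solves f (bounded_problem 200%:P%R (diameter_problem R)) ->
  forall x, decides_within f (code_machine answer_code) p.[size x]%R x (L x).
Proof.
have [e run_e e_out] := run_query.
have [|_ [g [p gp] ex]] := run_e.
  apply: smallP (pb_poly 'X%R) _ => x i; rewrite hornerX /start_env.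
  by case: eqP.
(* One step for the oracle, three moves, and a last step into the halting state. *)
exists (p + 5%:P)%R => f solf x.
have [n [dn fn]] := solf _ (spindle_valid R M (time x) (delim x) (guess x)).
pose us : pred tpe := pred1 ord_max.
pose e' := upd (e x) ord_max (bits n).
have H : exec f answer_code (g x + (1 + (1 + (1 + 1)))) (home (start_env x)) (setq (home e') us 4).
  apply: exec_sq (ex f x) _; apply: exec_sq (exec_ask f (e x)) _.
  rewrite e_out -[encode_system _]/(encode (p := diameter_problem R) (query x)) fn.
  rewrite -/e' -[home e' in X in exec _ _ _ X](setq_home e' us).
  by do 2?[apply: exec_sq (exec_moveR _ _ _ _) _]; apply: exec_moveR.
have [k kle Hk] := H.
have [ts' tk rts] := Hk (init (code_machine answer_code) x).2 (fun i => word_tape_rep _).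
apply: code_machine_decides tk _ _.
  by rewrite hornerD hornerC; have := gp x; move: kle; clear; lia.
have -> : scanned (ts' ord_max) = cellw (bits n) 4 by rewrite (rep_scan (rts _)).
rewrite language_tableau -(tableau_diameter _ dn); last by rewrite /time time_polyE; lia.
rewrite -size_bits_le3; case: ltnP => sn; last by rewrite cellw_default.
by rewrite cellw_nth.
Qed.

End Reduction.

Theorem theorem2 (R : realType) : strongly_NP_hard (diameter_problem R).
Proof.
exists 200%:P%R => L [V [pp [[M [q [ofree decV]]] LV]]].
have [p Hp] := @answer_code_decides R L V pp q M ofree decV LV.
by exists (code_machine (answer_code pp q M)), p.
Qed.
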